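(* Let $\mu\in(0,1)$, let $V_\mu\subset E_\mu$ be open, and suppose the following two hypotheses hold. (1) $(A,F_1): V_\mu\to \mathcal{M}_\mu(E_1,E_0)\times E_0$ is locally Lipschitz continuous (with $\mathcal{M}_\mu(E_1,E_0)$ carrying the norm of $\mathcal{L}(E_1,E_0)$). (2) There is a number $\beta\in(\mu,1)$ such that $F_2:V_\mu\cap E_\beta\to E_0$, and there are $m\in\mathbb{N}$ and numbers $\beta_j\in[\mu,\beta]$, $\rho_j\ge 0$ with $$\frac{\rho_j(\beta-\mu)+(\beta_j-\mu)}{1-\mu}\le 1\qquad\text{for all } j=1,\dots,m,$$ such that for each $x_0\in V_\mu$ and $R>0$ there is a constant $C_R=C_R(x_0)>0$ for which $$|F_2(x_1)-F_2(x_2)|_{E_0}\le C_R\sum_{j=1}^m\big(1+|x_1|_{E_\beta}^{\rho_j}+|x_2|_{E_\beta}^{\rho_j}\big)|x_1-x_2|_{E_{\beta_j}}$$ holds for all $x_1,x_2\in\bar B_{E_\mu}(x_0,R)\cap(V_\mu\cap E_\beta)$. Let $\bar\mu\in[\beta,1)$ and $x_0\in V_\mu\cap E_{\bar\mu}$. Then there exist positive constants $\tau=\tau(x_0)$, $\varepsilon=\varepsilon(x_0)$ and $\sigma=\sigma(x_0)$ such that the problem $$\dot u+A(u)u=F_1(u)+F_2(u)\ \text{ for } t>0,\qquad u(0)=x$$ has a unique solution $$u(\cdot,x)\in\mathbb{E}_{1,\bar\mu}([0,\tau])=BC^1_{1-\bar\mu}([0,\tau],E_0)\cap BC_{1-\bar\mu}([0,\tau],E_1)$$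 for all initial values $x\in\bar B_{E_{\bar\mu}}(x_0,\varepsilon)$, and $$\|u(\cdot,x_1)-u(\cdot,x_2)\|_{\mathbb{E}_{1,\bar\mu}([0,\tau])}\le\sigma|x_1-x_2|_{E_{\bar\mu}},\qquad x_1,x_2\in\bar B_{E_{\bar\mu}}(x_0,\varepsilon).$$
   Context: $E_0,E_1$ are Banach spaces with $E_1$ continuously and densely embedded in $E_0$. For $\theta\in(0,1)$, $E_\theta:=(E_0,E_1)^0_{\theta,\infty}$ is the continuous interpolation space (the closure of $E_1$ in the real interpolation space $(E_0,E_1)_{\theta,\infty}$). $\bar B_E(x,R)$ is the closed ball in $E$. For a Banach space $E$, $\nu\in(0,1)$, $J=[0,T]$, $\dot J=(0,T]$: $$BC_{1-\nu}(J,E):=\{v\in C(\dot J,E): [t\mapsto t^{1-\nu}v(t)]\in BC(\dot J,E),\ \lim_{t\to0^+}|t^{1-\nu}v(t)|_E=0\},$$ $$BC^1_{1-\nu}(J,E):=\{v\in C^1(\dot J,E): v,\dot v\in BC_{1-\nu}(J,E)\}.$$ Set $\mathbb{E}_{0,\nu}(J):=BC_{1-\nu}(J,E_0)$ with norm $\sup_{t\in\dot J}t^{1-\nu}|v(t)|_{E_0}$, and $\mathbb{E}_{1,\nu}(J):=BC^1_{1-\nu}(J,E_0)\cap BC_{1-\nu}(J,E_1)$ with norm $\sup_{t\in\dot J}t^{1-\nu}(|\dot v(t)|_{E_0}+|v(t)|_{E_1})$. Functions in $\mathbb{E}_{1,\nu}(J)$ extend continuously to $t=0$ with values in $E_0$.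 $\mathcal{M}_\mu(E_1,E_0)$ is the set of all $B\in\mathcal{L}(E_1,E_0)$ such that, for some (hence all) $T>0$ and $J=[0,T]$: for every $(f,x)\in\mathbb{E}_{0,\mu}(J)\times E_\mu$ there is a unique $u\in\mathbb{E}_{1,\mu}(J)$ with $\dot u(t)+Bu(t)=f(t)$ for $t\in\dot J$ and $u(0)=x$. A solution on $[0,\tau]$ takes values in $V_\mu$, satisfies the equation on $(0,\tau]$ and the initial condition $u(0)=x$. *)

(* Defs.v *)
From HB Require Import structures.
From mathcomp Require Import all_boot all_order all_algebra.
From mathcomp Require Import all_classical all_reals all_analysis.

Set Implicit Arguments.
Unset Strict Implicit.
Unset Printing Implicit Defensive.

Import Order.TTheory GRing.Theory Num.Theory.
Import numFieldNormedType.Exports.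

Local Open Scope classical_set_scope.
Local Open Scope ring_scope.

(* The inclusion of E1 into E0 is an explicit map i : E1 -> E0.  The
   interpolation spaces are kept as subsets of E0, each with its own norm,
   so that sets such as V `&` E_beta are literal intersections. *)

Section Interpolation.
Context {R : realType} {E0 E1 : completeNormedModType R}.
Variable i : {linear E1 -> E0}.

Definition dense_embedding : Prop :=
  [/\ injective i, continuous i & dense (range i)].

(* Peetre's K-functional: the infimum over all splittings
   x = (x - i b) + i b with b in E1. *)
Definition Kfun (t : R) (x : E0) : R :=
  inf [set `|x - i b| + t * `|b| | b in [set: E1]].

Definition interp_enorm (theta : R) (x : E0) : \bar R :=
  ereal_sup [set (t `^ (- theta) * Kfun t x)%:E | t in `]0, +oo[].

Definition real_interp (theta : R) : set E0 :=
  [set x | (interp_enorm theta x < +oo)%E].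

(* Only meaningful on real_interp theta: fine +oo = 0. *)
Definition interp_norm (theta : R) (x : E0) : R := fine (interp_enorm theta x).

(* The continuous interpolation space (E0, E1)^0_{theta, oo}. *)
Definition cont_interp (theta : R) : set E0 :=
  [set x | real_interp theta x /\
    forall e : R, 0 < e -> exists b : E1, (interp_enorm theta (x - i b)%R < e%:E)%E].

Definition interp_closed_ball (theta : R) (x : E0) (r : R) : set E0 :=
  cont_interp theta `&` closed_ball_ (interp_norm theta) x r.

Definition open_in_interp (theta : R) (V : set E0) : Prop :=
  V `<=` cont_interp theta /\
  forall x, V x -> exists2 r : R, 0 < r &
    cont_interp theta `&` ball_ (interp_norm theta) x r `<=` V.

(* The norm of L(E1, E0); a genuine supremum when B is linear and bounded. *)
Definition opnorm (B : E1 -> E0) : R :=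
  sup [set `|B b| | b in [set b : E1 | `|b| <= 1]].

Definition locally_lipschitz (theta : R) (V : set E0)
    (A : E0 -> {linear E1 -> E0}) (F : E0 -> E0) : Prop :=
  forall x0, V x0 -> exists r L : R, 0 < r /\
    forall x y, (V `&` ball_ (interp_norm theta) x0 r) x ->
                (V `&` ball_ (interp_norm theta) x0 r) y ->
      opnorm (fun b => A x b - A y b) + `|F x - F y|
        <= L * interp_norm theta (x - y).

End Interpolation.

(* Functions on ]0, T] are represented by functions on R whose values outside
   ]0, T] are irrelevant. *)

Section WeightedSpaces.
Context {R : realType} {E : normedModType R}.

(* BC_{1 - nu}([0, T], E) *)
Definition BCw (nu T : R) (v : R -> E) : Prop :=
  [/\ {within `]0, T], continuous v},
      [bounded t `^ (1 - nu) *: v t | t in `]0, T]%classic]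
    & `|t `^ (1 - nu) *: v t| @[t --> 0^'+] --> (0 : R)].

(* Derivatives are taken relative to ]0, T], hence one-sided at T. *)
Definition diff_quot (v : R -> E) (t s : R) : E := (s - t)^-1 *: (v s - v t).

Definition derivable_on (T : R) (v : R -> E) : Prop :=
  forall t, t \in `]0, T] ->
    cvg (diff_quot v t s @[s --> within `]0, T]%classic t^']).

Definition derive_on (T : R) (v : R -> E) (t : R) : E :=
  lim (diff_quot v t s @[s --> within `]0, T]%classic t^']).

(* BC^1_{1 - nu}([0, T], E) *)
Definition BC1w (nu T : R) (v : R -> E) : Prop :=
  [/\ derivable_on T v, BCw nu T v & BCw nu T (derive_on T v)].

End WeightedSpaces.

Section Evolution.
Context {R : realType} {E0 E1 : completeNormedModType R}.
Variable i : {linear E1 -> E0}.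

(* E_{1, nu}([0, T]) = BC^1_{1 - nu}([0, T], E0) /\ BC_{1 - nu}([0, T], E1) *)
Definition EE1 (nu T : R) (u : R -> E1) : Prop :=
  BC1w nu T (i \o u) /\ BCw nu T u.

Definition EE1_norm (nu T : R) (u : R -> E1) : \bar R :=
  ereal_sup [set (t `^ (1 - nu) * (`|derive_on T (i \o u) t| + `|u t|))%:E
            | t in `]0, T]].

(* u(0) = x, where u(0) is the value at 0 of the continuous extension of u
   to [0, T] as an E0-valued function. *)
Definition initial_value (u : R -> E1) (x : E0) : Prop :=
  i (u t) @[t --> 0^'+] --> x.

(* M_mu(E1, E0) *)
Definition max_reg (mu : R) (B : {linear E1 -> E0}) : Prop :=
  continuous B /\
  exists2 T : R, 0 < T &
    forall (f : R -> E0) (x : E0), BCw mu T f -> cont_interp i mu x ->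
      let sol (u : R -> E1) :=
        [/\ EE1 mu T u,
            forall t, t \in `]0, T] -> derive_on T (i \o u) t + B (u t) = f t
          & initial_value u x] in
      exists u, sol u /\ forall v, sol v -> {in `]0, T], v =1 u}.

(* u is a solution on [0, T], in the class E_{1, nu}([0, T]) and with values
   in V, of u' + A(u) u = F1(u) + F2(u), u(0) = x. *)
Definition is_solution (V : set E0) (A : E0 -> {linear E1 -> E0})
    (F1 F2 : E0 -> E0) (nu T : R) (x : E0) (u : R -> E1) : Prop :=
  [/\ EE1 nu T u,
      V x /\ (forall t, t \in `]0, T] -> V (i (u t))),
      forall t, t \in `]0, T] ->
        derive_on T (i \o u) t + A (i (u t)) (u t) = F1 (i (u t)) + F2 (i (u t))
    & initial_value u x].

End Evolution.

(* Main.v *)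
Require Import Defs.
From HB Require Import structures.
From mathcomp Require Import all_boot all_order all_algebra.
From mathcomp Require Import all_classical all_reals all_analysis.
From mathcomp Require Import ring lra.

Set Implicit Arguments.
Unset Strict Implicit.
Unset Printing Implicit Defensive.

Import Order.TTheory GRing.Theory Num.Theory.
Import numFieldNormedType.Exports.

Local Open Scope classical_set_scope.
Local Open Scope ring_scope.

(** The problem is solved by freezing the operator at the initial value:
    u' + B u = (B - A(u)) u + F1(u) + F2(u) with B = A(x0), treated as a fixed
    point problem in the space E_{1, nu}([0, tau]) for the weight nu = mubar.

    Linear part.  Only maximal regularity for the weight mu is given.  The
    solution operator for zero initial value is bounded by the closed graph
    theorem (solution_bound), and it is causal: uniqueness on ]0, T] implies
    uniqueness on every ]0, t], because the primitive of a solution with zero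
    data, delayed by T - t and continued by zero, is again a solution
    (uniqueness_sub).  Hence |u(t)| is controlled by the data on ]0, t] with a
    constant independent of t.  As t^(nu - mu) is increasing, the estimate for mu
    implies at once the one for every nu >= mu (causal_bound_weight).  For the
    homogeneous problem with initial value x, considering the primitive of u and
    then t u gives t |u(t)| <= C |x|, while an initial value i b gives
    |u(t)| <= C |b|; splitting x yields t |u(t)| <= C K(t, x)
    (homogeneous_split), which is the required bound by the norm of x in E_nu.
    Together these give maximal regularity for the weight nu on all short
    intervals with a uniform constant (max_reg_package); neither semigroups nor
    vector-valued integrals are used, and antiderivatives are limits of Riemann
    sums (antiderivative).

    Nonlinear part.  If u has norm at most delta in E_{1, nu}([0, t]) and starts
    near x0, then u stays near x0 in E_mu and bounded in E_beta (near_start),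
    since nu >= beta.  So the coefficients are Lipschitz along u, the term
    (B - A(u)) u is quadratically small in delta, and F1(u) + F2(u) is bounded
    and gains the factor tau^(1 - nu).  The right-hand side is therefore a
    contraction on a small ball (fixed_point), and the same estimate shows that
    two solutions in the ball differ by a multiple of the difference of their
    initial values (stability).  Solutions that are not assumed to lie in the ball
    start in it, because their weighted norms vanish at 0, and cannot leave it:
    while inside, they agree with the constructed solution, which stays in the
    ball of half the radius (exit_time). *)

(** * Linear identities in modules *)

(** Reified linear combinations: the tactic ring decides identities of
    coefficients but does not act on vectors, so an identity between vectors is
    first reduced to one identity per vector. *)
Inductive lin_expr (R : Type) : Type :=
  | LVar of nat
  | LZero
  | LAdd of lin_expr R & lin_expr R
  | LOpp of lin_expr R
  | LScale of R & lin_expr R.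

Section LinearIdentities.
Context {R : comNzRingType} {M : lmodType R}.

Fixpoint lin_eval (env : seq M) (e : lin_expr R) : M :=
  match e with
  | LVar n => nth 0 env n
  | LZero => 0
  | LAdd a b => lin_eval env a + lin_eval env b
  | LOpp a => - lin_eval env a
  | LScale k a => k *: lin_eval env a
  end.

Fixpoint lin_coef (e : lin_expr R) (n : nat) : R :=
  match e with
  | LVar k => if k == n then 1 else 0
  | LZero => 0
  | LAdd a b => lin_coef a n + lin_coef b n
  | LOpp a => - lin_coef a n
  | LScale k a => k * lin_coef a n
  end.

Lemma lin_evalE env e :
  lin_eval env e = \sum_(n < size env) lin_coef e n *: nth 0 env n.
Proof.
elim: e => [k||a IHa b IHb|a IHa|k a IHa] /=.
- have [klt|kge] := ltnP k (size env); last first.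
    rewrite nth_default// big1// => n _.
    by rewrite gtn_eqF ?scale0r// (leq_trans (ltn_ord n)).
  rewrite (bigD1 (Ordinal klt)) //= big1 => [|n].
    by rewrite eqxx scale1r addr0.
  rewrite -val_eqE /= eq_sym => kn.
  by rewrite (negbTE kn) scale0r.
- by rewrite big1// => n _; rewrite scale0r.
- by rewrite IHa IHb -big_split; apply: eq_bigr => n _; rewrite scalerDl.
- by rewrite IHa -sumrN; apply: eq_bigr => n _; rewrite scaleNr.
- by rewrite IHa scaler_sumr; apply: eq_bigr => n _; rewrite scalerA.
Qed.

Fixpoint lin_same (k : nat) (a b : lin_expr R) : Prop :=
  if k is k'.+1 then lin_coef a k' = lin_coef b k' /\ lin_same k' a b else True.

Lemma lin_eval_eq env a b : lin_same (size env) a b ->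
  lin_eval env a = lin_eval env b.
Proof.
move=> h; rewrite !lin_evalE; apply: eq_bigr => -[n hn] _ /=; congr (_ *: _).
elim: (size env) hn h => // k IHk; rewrite ltnS leq_eqVlt => /orP[/eqP->|kn] [h1 h2] //.
exact: IHk.
Qed.

End LinearIdentities.

Ltac lin_index x env :=
  match env with
  | x :: _ => constr:(O)
  | _ :: ?l => let n := lin_index x l in constr:(S n)
  end.

Ltac lin_atoms t env :=
  match t with
  | (?a + ?b)%R => let env1 := lin_atoms a env in lin_atoms b env1
  | (- ?a)%R => lin_atoms a env
  | (?k *: ?a)%R => lin_atoms a env
  | (0)%R => env
  | _ => match env with
         | context [t :: _] => env
         | _ => constr:(t :: env)
         end
  end.

Ltac lin_reify R t env :=
  match t with
  | (?a + ?b)%R => let x := lin_reify R a env in let y := lin_reify R b env in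
      constr:(LAdd x y)
  | (- ?a)%R => let x := lin_reify R a env in constr:(LOpp x)
  | (?k *: ?a)%R => let x := lin_reify R a env in constr:(LScale k x)
  | (0)%R => constr:(@LZero R)
  | _ => let n := lin_index t env in constr:(@LVar R n)
  end.

(** The argument tac receives the comparisons of coefficients. *)
Ltac linear_with R tac :=
  match goal with
  | |- @eq ?M ?a ?b =>
    let env0 := lin_atoms a (@nil M) in
    let env := lin_atoms b env0 in
    let x := lin_reify R a env in
    let y := lin_reify R b env in
    change (lin_eval env x = lin_eval env y);
    apply: lin_eval_eq; rewrite /=; repeat split; tac
  end.

Tactic Notation "module_ring" constr(R) := linear_with R ltac:(ring).

(** * Mean value inequalities *)

Section Calculus.
Context {R : realType} {E : normedModType R}.
Implicit Types (v d : R -> E) (T : R).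

Lemma ler_eps_pos (x y : R) : (forall e, 0 < e -> x <= y + e) -> x <= y.
Proof. by move=> h; apply/ler_addgt0Pr. Qed.

(** The points t up to which the bound from a holds form a closed set, and the
    local hypothesis at its supremum lets one go past it unless it is b. *)
Lemma local_lipschitz_global v (a b k : R) : a <= b ->
  (forall t : R, a <= t <= b -> exists2 r : R, 0 < r &
     forall s : R, a <= s <= b -> `|s - t| < r ->
       `|v s - v t| <= k * `|s - t|) ->
  `|v b - v a| <= k * (b - a).
Proof.
move=> ab loc.
pose S := [set t | a <= t <= b /\ `|v t - v a| <= k * (t - a)].
have Sa : S a by split; [rewrite lexx ab | rewrite !subrr normr0 mulr0].
have hS : has_sup S.
  split; first by exists a.
  by exists b => t [/andP[]].
set c := sup S.
have ac : a <= c by apply: ub_le_sup => //; case: hS.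
have cb : c <= b by apply: ge_sup; [exists a | move=> t [/andP[]]].
have [r r0 hr] := loc c (introT andP (conj ac cb)).
have Sc : S c.
  split; first by rewrite ac cb.
  have [t St tc] := sup_adherent r0 hS.
  have tle : t <= c by apply: ub_le_sup => //; case: hS.
  have [/andP[at_ tb] ht] := St.
  rewrite -/c in tc.
  have := hr t; rewrite at_ tb => /(_ isT).
  have dn : `|t - c| = c - t by rewrite ler0_norm ?subr_le0// opprB.
  rewrite dn => /(_ ltac:(lra)) h1.
  rewrite -[v c](subrK (v t)) -addrA.
  apply: (le_trans (ler_normD _ _)).
  rewrite distrC; apply: le_trans (lerD h1 ht) _; lra.
have [cltb|bc] := ltP c b; last first.
  have -> : b = c by apply/le_anti; rewrite cb bc.
  by case: Sc.
pose s := Num.min b (c + r / 2).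
have cs : c < s by rewrite lt_min cltb; lra.
have sb : s <= b by rewrite ge_min lexx.
have sr : s <= c + r / 2 by rewrite ge_min lexx orbT.
suff Ss : S s.
  by have : s <= c by [apply: ub_le_sup => //; case: hS]; rewrite leNgt cs.
split; first by apply/andP; split; lra.
have dn : `|s - c| = s - c by rewrite ger0_norm// subr_ge0 ltW.
have h1 : `|v s - v c| <= k * `|s - c| by apply: hr; rewrite ?dn; lra.
rewrite dn in h1.
have [_ h2] := Sc.
rewrite -[v s](subrK (v c)) -addrA.
apply: (le_trans (ler_normD _ _)).
apply: le_trans (lerD h1 h2) _; lra.
Qed.

Definition cont_on T v := forall t e : R, 0 < t <= T -> 0 < e ->
  exists2 r : R, 0 < r &
    forall s : R, 0 < s <= T -> `|s - t| < r -> `|v s - v t| <= e.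

Definition der_on T v d := forall t e : R, 0 < t <= T -> 0 < e ->
  exists2 r : R, 0 < r & forall s : R, 0 < s <= T -> `|s - t| < r ->
    `|v s - v t - (s - t) *: d t| <= e * `|s - t|.

(** For continuous d this says that v is an antiderivative of d.  Unlike
    differentiability, the condition survives pointwise limits of v. *)
Definition mean_on T v d := forall (s t : R) (e : E) (w : R), 0 < s -> s <= t -> t <= T ->
  (forall r : R, s <= r <= t -> `|d r - e| <= w) ->
  `|v t - v s - (t - s) *: e| <= w * (t - s).

(** Apply local_lipschitz_global to v r - r *: e, whose derivative d r - e is
    bounded by w. *)
Lemma der_on_mean T v d : der_on T v d -> mean_on T v d.
Proof.
move=> hd s t e w s0 st tT hw.
apply: ler_eps_pos => eps eps0.
pose k := eps / (1 + (t - s)).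
have k0 : 0 < k by rewrite divr_gt0//; lra.
have kle : k * (t - s) <= eps.
  rewrite /k mulrAC ler_pdivrMr; last by lra.
  by rewrite ler_pM2l//; lra.
apply: (@le_trans _ _ ((w + k) * (t - s))); last by rewrite mulrDl lerD2l.
pose g r := v r - r *: e.
have -> : v t - v s - (t - s) *: e = g t - g s.
  by rewrite /g; module_ring R.
apply: local_lipschitz_global => // r /andP[sr rt].
have rT : 0 < r <= T by apply/andP; split; lra.
have [de de0 hde] := hd r k rT k0.
exists de => // q /andP[sq qt] qr.
have qT : 0 < q <= T by apply/andP; split; lra.
have h1 := hde q qT qr.
have -> : g q - g r = (v q - v r - (q - r) *: d r) + (q - r) *: (d r - e).
  by rewrite /g; module_ring R.
apply: (le_trans (ler_normD _ _)).
rewrite mulrDl [X in _ <= X]addrC; apply: lerD => //.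
rewrite normrZ mulrC ler_wpM2r// hw// sr rt//.
Qed.

Lemma cont_onW T T' v : T' <= T -> cont_on T v -> cont_on T' v.
Proof.
move=> TT h t e /andP[t0 tT] e0; have [|r r0 hr] := h t e _ e0.
  by rewrite t0 (le_trans tT).
exists r => // s /andP[s0 sT]; apply: hr; rewrite s0; exact: le_trans TT.
Qed.

Lemma der_onW T T' v d : T' <= T -> der_on T v d -> der_on T' v d.
Proof.
move=> TT h t e /andP[t0 tT] e0; have [|r r0 hr] := h t e _ e0.
  by rewrite t0 (le_trans tT).
exists r => // s /andP[s0 sT]; apply: hr; rewrite s0; exact: le_trans TT.
Qed.

Lemma mean_der_on T v d : cont_on T d -> mean_on T v d -> der_on T v d.
Proof.
move=> hc hm t e tT e0; have [r r0 hr] := hc t e tT e0.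
exists r => // s sT; rewrite ltr_distl => sr.
have /andP[s0 s1] := sT; have /andP[t0 t1] := tT.
have [st|ts] := leP s t.
  have h : forall q, s <= q <= t -> `|d q - d t| <= e.
    by move=> q hq; apply: hr; rewrite ?ltr_distl; lra.
  have := hm s t (d t) e s0 st t1 h.
  have -> : `|s - t| = t - s by rewrite ler0_norm ?subr_le0// opprB.
  have -> : v s - v t - (s - t) *: d t = - (v t - v s - (t - s) *: d t).
    by module_ring R.
  by rewrite normrN.
have h : forall q, t <= q <= s -> `|d q - d t| <= e.
  by move=> q hq; apply: hr; rewrite ?ltr_distl; lra.
have := hm t s (d t) e t0 (ltW ts) s1 h.
by have -> : `|s - t| = s - t by rewrite ger0_norm// subr_ge0 ltW.
Qed.

End Calculus.

(** * Real powers and Cauchy sequences *)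

Section Powers.
Context {R : realType}.
Implicit Types (s t nu : R).

Lemma powR_neg_inv t nu : t `^ (nu - 1) = (t `^ (1 - nu))^-1.
Proof. by rewrite -opprB powRN. Qed.

Lemma weight_le t nu y (M : R) : 0 < t ->
  (t `^ (1 - nu) * y <= M) = (y <= M * t `^ (nu - 1)).
Proof.
by move=> t0; rewrite powR_neg_inv ler_pdivlMr ?powR_gt0// mulrC.
Qed.

Lemma powR_split t a b : 0 < t -> t `^ (a + b) = t `^ a * t `^ b.
Proof. by move=> t0; apply: powRD; apply/implyP => _; rewrite gt_eqF. Qed.

Lemma powR_mono s t a : 0 <= a -> 0 <= s -> s <= t -> s `^ a <= t `^ a.
Proof.
move=> a0 s0 st; apply: ge0_ler_powR => //; rewrite nnegrE//; exact: le_trans st.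
Qed.

Lemma powR_anti s t a : a <= 0 -> 0 < s -> s <= t -> t `^ a <= s `^ a.
Proof.
move=> a0 s0 st; rewrite -[a]opprK (powRN t) (powRN s) lef_pV2 ?posrE ?powR_gt0// ?(lt_le_trans s0 st)//.
by apply: powR_mono => //; [lra | exact: ltW].
Qed.

Lemma powR_small a (e : R) : 0 < a -> 0 < e -> exists2 r : R, 0 < r &
  forall t : R, 0 <= t <= r -> t `^ a <= e.
Proof.
move=> a0 e0; exists (e `^ a^-1); first exact: powR_gt0.
move=> t /andP[t0 te]; apply: (le_trans (powR_mono (ltW a0) t0 te)).
by rewrite -powRrM mulVf ?gt_eqF// powRr1// ltW.
Qed.

End Powers.

Lemma geometric_small {R : realType} (a e : R) : 0 < e -> exists n, a / 2 ^+ n <= e.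
Proof.
move=> e0; exists (Num.truncn (a / e)).+1.
rewrite ler_pdivrMr ?exprn_gt0// [leRHS]mulrC -ler_pdivrMr//.
apply: (le_trans (ltW (truncnS_gt _))); rewrite -natrX ler_nat.
by apply: ltnW; apply: ltn_expl.
Qed.

Lemma geometric_le {R : realType} (x a b : R) :
  (forall n, x <= a / 2 ^+ n + b) -> x <= b.
Proof.
move=> h; apply: ler_eps_pos => e e0; have [n hn] := geometric_small a e0.
by apply: (le_trans (h n)); rewrite addrC lerD2l.
Qed.

Section Cauchy.
Context {R : realType} {E : completeNormedModType R}.

Lemma cauchy_limit (x : nat -> E) :
  (forall e : R, 0 < e -> exists n, forall m, (n <= m)%N -> `|x m - x n| <= e) ->
  exists l, forall e : R, 0 < e -> exists n, forall m, (n <= m)%N -> `|l - x m| <= e.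
Proof.
move=> hx.
have cx : cvgn x.
  apply/cauchy_cvgP/cauchy_exP => e e0.
  have [n hn] := hx (e / 2) ltac:(by rewrite divr_gt0).
  exists (x n); exists n => // m /= nm.
  by rewrite -ball_normE /= distrC; apply: (le_lt_trans (hn m nm)); lra.
exists (limn x) => e e0.
have /cvgrPdist_le/(_ e e0)[n _ hn] := cx.
by exists n => m nm; apply: hn.
Qed.

Lemma geometric_cauchy (x : nat -> E) (a : R) :
  (forall n, `|x n.+1 - x n| <= a / 2 ^+ n) ->
  exists l, forall n, `|l - x n| <= 2 * a / 2 ^+ n.
Proof.
move=> hx.
have a0 : 0 <= a by have := le_trans (normr_ge0 _) (hx 0%N); rewrite expr0 divr1.
have p2 n : 0 < (2 : R) ^+ n by rewrite exprn_gt0.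
have hd n m : (n <= m)%N -> `|x m - x n| <= 2 * a / 2 ^+ n.
  move=> nm; rewrite -(subnKC nm); move: (m - n)%N => {nm}k.
  suff : `|x (n + k)%N - x n| <= 2 * a / 2 ^+ n - 2 * a / 2 ^+ (n + k).
    by move/le_trans; apply; rewrite lerBlDr lerDl divr_ge0 ?mulr_ge0// ltW.
  elim: k => [|k IH]; first by rewrite addn0 !subrr normr0.
  rewrite addnS.
  have -> : x (n + k).+1 - x n = (x (n + k).+1 - x (n + k)%N) + (x (n + k)%N - x n).
    by module_ring R.
  apply: (le_trans (ler_normD _ _)); apply: (le_trans (lerD (hx _) IH)).
  rewrite exprS.
  have -> : 2 * a / (2 * 2 ^+ (n + k)) = a / 2 ^+ (n + k).
    by field; rewrite gt_eqF.
  have -> : 2 * a / 2 ^+ (n + k) = 2 * (a / 2 ^+ (n + k)) by rewrite mulrA.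
  lra.
have [l hl] : exists l, forall e : R, 0 < e ->
    exists n, forall m, (n <= m)%N -> `|l - x m| <= e.
  apply: cauchy_limit => e e0; have [n hn] := geometric_small (2 * a) e0.
  by exists n => m nm; apply: le_trans hn; exact: hd.
exists l => n; apply: ler_eps_pos => e e0.
have [N hN] := hl e e0.
have -> : l - x n = (l - x (maxn n N)) + (x (maxn n N) - x n) by module_ring R.
apply: (le_trans (ler_normD _ _)); rewrite addrC lerD ?hd ?leq_maxl//.
by apply: hN; rewrite leq_maxr.
Qed.

End Cauchy.

(** * Weighted sup-norms on half-open intervals *)

Section Weighted.
Context {R : realType} {E : normedModType R}.
Implicit Types (v w d f g : R -> E) (T nu N M : R).

(** Continuity is always obtained below from that of other functions, with
    possibly different codomains, by comparing increments. *)
Lemma cont_on_dom (E1 E2 : normedModType R) T (v : R -> E)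
    (u1 : R -> E1) (u2 : R -> E2) :
  cont_on T u1 -> cont_on T u2 ->
  (forall t : R, 0 < t <= T -> exists L r : R, 0 < r /\
     forall s : R, 0 < s <= T -> `|s - t| < r ->
       `|v s - v t| <= L * (`|u1 s - u1 t| + `|u2 s - u2 t|)) ->
  cont_on T v.
Proof.
move=> h1 h2 h t e tT e0; have [L [r [r0 hr]]] := h t tT.
pose k := e / (2 * (`|L| + 1)).
have L0 : 0 < `|L| + 1 by rewrite ltr_wpDl.
have k0 : 0 < k by rewrite divr_gt0// mulr_gt0.
have [r1 r10 hr1] := h1 t k tT k0; have [r2 r20 hr2] := h2 t k tT k0.
exists (Num.min r (Num.min r1 r2)); first by rewrite !lt_min r0 r10.
move=> s sT; rewrite !lt_min => /and3P[sr sr1 sr2].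
apply: (le_trans (hr s sT sr)).
have -> : e = (`|L| + 1) * (k + k) by rewrite /k; field; rewrite gt_eqF.
apply: (@le_trans _ _ (`|L| * (k + k))).
  apply: (@le_trans _ _ (`|L| * (`|u1 s - u1 t| + `|u2 s - u2 t|))).
    by rewrite ler_wpM2r ?addr_ge0// ler_norm.
  by rewrite ler_wpM2l// lerD ?hr1 ?hr2.
by rewrite ler_wpM2r ?addr_ge0 ?ltW// ltrDl.
Qed.

Lemma cont_on_lin T v w k : cont_on T v -> cont_on T w ->
  cont_on T (fun t => v t + k *: w t).
Proof.
move=> hv hw; apply: (cont_on_dom hv hw) => t tT.
exists (1 + `|k|), 1; split=> // s sT _.
have -> : v s + k *: w s - (v t + k *: w t) = (v s - v t) + k *: (w s - w t).
  by module_ring R.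
apply: (le_trans (ler_normD _ _)); rewrite normrZ.
rewrite mulrDl mul1r mulrDr -addrA lerD2l.
have := normr_ge0 (w s - w t); have := normr_ge0 k; have := normr_ge0 (v s - v t).
nra.
Qed.

Lemma cont_on_cst T (c : E) : cont_on T (fun=> c).
Proof. by move=> t e tT e0; exists 1 => // s _ _; rewrite subrr normr0 ltW. Qed.

Lemma cont_on_eq T v w : (forall t : R, 0 < t <= T -> v t = w t) ->
  cont_on T v -> cont_on T w.
Proof.
move=> h hv t e tT e0; have [r r0 hr] := hv t e tT e0.
by exists r => // s sT sr; rewrite -!h//; apply: hr.
Qed.

Lemma der_on_cont T v d : der_on T v d -> cont_on T v.
Proof.
move=> h t e tT e0; have [r r0 hr] := h t 1 tT ltr01.
pose k := `|d t| + 1.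
have k0 : 0 < k by rewrite ltr_wpDl.
exists (Num.min r (e / k)); first by rewrite lt_min r0 divr_gt0.
move=> s sT; rewrite lt_min => /andP[sr se].
have -> : v s - v t = (v s - v t - (s - t) *: d t) + (s - t) *: d t by module_ring R.
apply: (le_trans (ler_normD _ _)); rewrite normrZ.
apply: (le_trans (lerD (hr s sT sr) (lexx _))).
move: se; rewrite ltr_pdivlMr// /k mulrDr mulr1 mul1r => se; lra.
Qed.

Lemma der_on_lin T v w d e k : der_on T v d -> der_on T w e ->
  der_on T (fun t => v t + k *: w t) (fun t => d t + k *: e t).
Proof.
move=> hv hw t eps tT e0.
pose q := eps / (1 + `|k|).
have k0 : 0 < 1 + `|k| by rewrite ltr_pwDl.
have q0 : 0 < q by rewrite divr_gt0.
have [r1 r10 h1] := hv t q tT q0; have [r2 r20 h2] := hw t q tT q0.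
exists (Num.min r1 r2); first by rewrite lt_min r10.
move=> s sT; rewrite lt_min => /andP[s1 s2].
have -> : v s + k *: w s - (v t + k *: w t) - (s - t) *: (d t + k *: e t)
  = (v s - v t - (s - t) *: d t) + k *: (w s - w t - (s - t) *: e t).
  by module_ring R.
apply: (le_trans (ler_normD _ _)); rewrite normrZ.
have -> : eps = q + `|k| * q by rewrite /q; field; rewrite gt_eqF.
by rewrite mulrDl lerD ?h1// -mulrA ler_wpM2l// h2.
Qed.

Lemma der_on_eq T v w d e : (forall t : R, 0 < t <= T -> v t = w t) ->
  (forall t : R, 0 < t <= T -> d t = e t) -> der_on T v d -> der_on T w e.
Proof.
move=> h h' hv t k tT k0; have [r r0 hr] := hv t k tT k0.
by exists r => // s sT sr; rewrite -!h// -h'//; apply: hr.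
Qed.

Lemma der_on_cst T (c : E) : der_on T (fun=> c) (fun=> 0).
Proof.
move=> t e tT e0; exists 1 => // s _ _.
by rewrite subrr scaler0 subr0 normr0 mulr_ge0// ltW.
Qed.

Lemma der_on_mulid T v d : der_on T v d ->
  der_on T (fun t => t *: v t) (fun t => v t + t *: d t).
Proof.
move=> hv t e tT e0; have t0 : 0 < t by case/andP: tT.
have [r r0 hr] := hv t (e / 2 / t) tT ltac:(by rewrite !divr_gt0).
have [r1 r10 hr1] := der_on_cont hv tT (divr_gt0 e0 (ltr0Sn R 1)).
exists (Num.min r r1); first by rewrite lt_min r0.
move=> s sT; rewrite lt_min => /andP[sr sr1].
have -> : s *: v s - t *: v t - (s - t) *: (v t + t *: d t) =
   (s - t) *: (v s - v t) + t *: (v s - v t - (s - t) *: d t) by module_ring R.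
apply: (le_trans (ler_normD _ _)); rewrite !normrZ (gtr0_norm t0).
have h1 := hr1 s sT sr1; have h2 := hr s sT sr.
have -> : e * `|s - t| = `|s - t| * (e / 2) + t * (e / 2 / t * `|s - t|).
  by field; rewrite gt_eqF.
by rewrite lerD// ler_wpM2l// ltW.
Qed.

Definition starts_at T v (x : E) := forall e : R, 0 < e ->
  exists2 r : R, 0 < r & forall t : R, 0 < t <= T -> t <= r -> `|v t - x| <= e.

Lemma starts_at_lin T v w x y k : starts_at T v x -> starts_at T w y ->
  starts_at T (fun t => v t + k *: w t) (x + k *: y).
Proof.
move=> hv hw e e0.
pose q := e / (1 + `|k|).
have k0 : 0 < 1 + `|k| by rewrite ltr_pwDl.
have q0 : 0 < q by rewrite divr_gt0.
have [r1 r10 h1] := hv q q0; have [r2 r20 h2] := hw q q0.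
exists (Num.min r1 r2); first by rewrite lt_min r10.
move=> t tT; rewrite le_min => /andP[t1 t2].
have -> : v t + k *: w t - (x + k *: y) = (v t - x) + k *: (w t - y).
  by module_ring R.
apply: (le_trans (ler_normD _ _)); rewrite normrZ.
have -> : e = q + `|k| * q by rewrite /q; field; rewrite gt_eqF.
by rewrite lerD ?h1// ler_wpM2l// h2.
Qed.

Lemma starts_at_cst T (x : E) : starts_at T (fun=> x) x.
Proof. by move=> e e0; exists 1 => // t _ _; rewrite subrr normr0 ltW. Qed.

Lemma starts_atW T T' v x : T' <= T -> starts_at T v x -> starts_at T' v x.
Proof.
move=> TT h e e0; have [r r0 hr] := h e e0; exists r => // t tT tr.
by apply: hr => //; lra.
Qed.

Lemma starts_at_eq T v w x : (forall t : R, 0 < t <= T -> v t = w t) ->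
  starts_at T v x -> starts_at T w x.
Proof.
move=> h hv e e0; have [r r0 hr] := hv e e0; exists r => // t tT tr.
by rewrite -h// hr.
Qed.

(** The sum of the geometric series 2^(-nu) + 2^(-2 nu) + ..., from the increments
    over dyadic intervals in increments_from_start. *)
Definition dyadic_const nu : R := 2^-1 `^ nu / (1 - 2^-1 `^ nu).

Lemma half_powR_lt1 nu : 0 < nu -> (2^-1 : R) `^ nu < 1.
Proof.
move=> n0; have h : (2^-1 : R) < 1 by lra.
apply: (@lt_le_trans _ _ (1 `^ nu)); last by rewrite powR1.
by apply: gt0_ltr_powR => //; rewrite nnegrE ?ler01 ?invr_ge0.
Qed.

Lemma dyadic_const_gt0 nu : 0 < nu -> 0 < dyadic_const nu.
Proof.
move=> n0; rewrite divr_gt0 ?powR_gt0 ?invr_gt0//.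
by rewrite subr_gt0 half_powR_lt1.
Qed.

(** Integration of s^(nu-1) without integrals: add up the increments over the
    dyadic intervals [t/2^(k+1), t/2^k], each at most N (t/2^(k+1))^nu. *)
Lemma increments_from_start T v x nu N : 0 < nu -> 0 <= N ->
  starts_at T v x ->
  (forall s t : R, 0 < s -> s <= t -> t <= T ->
     `|v t - v s| <= N * s `^ (nu - 1) * (t - s)) ->
  forall t : R, 0 < t <= T -> `|v t - x| <= dyadic_const nu * N * t `^ nu.
Proof.
move=> n0 N0 hx hv t tT; set c := dyadic_const nu.
have c0 : 0 < c by exact: dyadic_const_gt0.
have step k : forall t : R, 0 < t <= T -> `|v t - v (t / 2 ^+ k)| <= c * N * t `^ nu.
  elim: k => [|k IH] {}t {}tT.
    by rewrite expr0 divr1 subrr normr0 mulr_ge0 ?powR_ge0// mulr_ge0// ltW.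
  have t0 : 0 < t by case/andP: tT.
  have -> : v t - v (t / 2 ^+ k.+1) = (v t - v (t / 2)) + (v (t / 2) - v (t / 2 / 2 ^+ k)).
    have -> : t / 2 ^+ k.+1 = t / 2 / 2 ^+ k by rewrite exprS invfM mulrA.
    by module_ring R.
  apply: (le_trans (ler_normD _ _)).
  have h1 := IH (t / 2) ltac:(lra).
  have h2 := hv (t / 2) t ltac:(lra) ltac:(lra) ltac:(lra).
  apply: (le_trans (lerD h2 h1)).
  have e1 : (t / 2) `^ nu = (t / 2) `^ (nu - 1) * (t / 2).
    by rewrite -[X in _ = _ * X]powRr1 -?powR_split ?subrK//; lra.
  have e2 : (t / 2) `^ nu = t `^ nu * 2^-1 `^ nu by rewrite powRM//; lra.
  have -> : t - t / 2 = t / 2 by field.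
  rewrite -mulrA -e1 e2 /c /dyadic_const.
  have q1 := half_powR_lt1 n0.
  rewrite le_eqVlt; apply/orP; left; apply/eqP; field.
  by rewrite gt_eqF// subr_gt0.
apply: ler_eps_pos => e e0.
have [r r0 hr] := hx e e0.
have t0 : 0 < t by case/andP: tT.
have [k kr] := geometric_small t r0.
have p2 : 0 < t / 2 ^+ k by rewrite divr_gt0// exprn_gt0.
have kt : t / 2 ^+ k <= t.
  rewrite ler_pdivrMr ?exprn_gt0// ler_peMr ?exprn_ege1 ?ler1n//.
  exact: ltW.
have -> : v t - x = (v t - v (t / 2 ^+ k)) + (v (t / 2 ^+ k) - x) by module_ring R.
apply: (le_trans (ler_normD _ _)); rewrite lerD ?step// hr//; lra.
Qed.

(** wbound, wnull and in_BC describe BC_{1-nu}([0, T], E); the norm only enters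
    through upper bounds, which avoids suprema of possibly empty or unbounded
    sets. *)
Definition wbound nu T v (M : R) :=
  forall t : R, 0 < t <= T -> t `^ (1 - nu) * `|v t| <= M.

Definition wnull nu T v := forall e : R, 0 < e -> exists2 r : R, 0 < r &
  forall t : R, 0 < t <= T -> t <= r -> t `^ (1 - nu) * `|v t| <= e.

Definition in_BC nu T v :=
  [/\ cont_on T v, exists M, wbound nu T v M & wnull nu T v].

Lemma wboundW nu T v M M' : M <= M' -> wbound nu T v M -> wbound nu T v M'.
Proof. by move=> MM h t tT; apply: (le_trans (h t tT)). Qed.

Lemma wbound_sub nu T T' v M : T' <= T -> wbound nu T v M -> wbound nu T' v M.
Proof. by move=> TT h t tT; apply: h; lra. Qed.

Lemma wnull_sub nu T T' v : T' <= T -> wnull nu T v -> wnull nu T' v.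
Proof.
move=> TT h e e0; have [r r0 hr] := h e e0; exists r => // t tT tr.
by apply: hr => //; lra.
Qed.

Lemma in_BC_sub nu T T' v : T' <= T -> in_BC nu T v -> in_BC nu T' v.
Proof.
move=> TT [h1 [M h2] h3]; split; first exact: cont_onW h1.
  by exists M; apply: wbound_sub h2.
exact: wnull_sub h3.
Qed.

Lemma wnorm_lin nu t (x y : E) k :
  t `^ (1 - nu) * `|x + k *: y| <=
    t `^ (1 - nu) * `|x| + `|k| * (t `^ (1 - nu) * `|y|).
Proof.
rewrite mulrCA -mulrDr ler_wpM2l ?powR_ge0//.
by apply: (le_trans (ler_normD _ _)); rewrite normrZ.
Qed.

Lemma wbound_lin nu T v w k M N : wbound nu T v M -> wbound nu T w N ->
  wbound nu T (fun t => v t + k *: w t) (M + `|k| * N).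
Proof.
move=> hv hw t tT; apply: (le_trans (wnorm_lin _ _ _ _ _)).
by rewrite lerD ?hv// ler_wpM2l// hw.
Qed.

Lemma wnull_lin nu T v w k : wnull nu T v -> wnull nu T w ->
  wnull nu T (fun t => v t + k *: w t).
Proof.
move=> hv hw e e0.
pose q := e / (1 + `|k|).
have k0 : 0 < 1 + `|k| by rewrite ltr_pwDl.
have q0 : 0 < q by rewrite divr_gt0.
have [r1 r10 h1] := hv q q0; have [r2 r20 h2] := hw q q0.
exists (Num.min r1 r2); first by rewrite lt_min r10.
move=> t tT; rewrite le_min => /andP[t1 t2].
apply: (le_trans (wnorm_lin _ _ _ _ _)).
have -> : e = q + `|k| * q by rewrite /q; field; rewrite gt_eqF.
by rewrite lerD ?h1// ler_wpM2l// h2.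
Qed.

Lemma in_BC_lin nu T v w k : in_BC nu T v -> in_BC nu T w ->
  in_BC nu T (fun t => v t + k *: w t).
Proof.
move=> [h1 [M h2] h3] [h1' [M' h2'] h3']; split.
- exact: cont_on_lin.
- by exists (M + `|k| * M'); apply: wbound_lin.
- exact: wnull_lin.
Qed.

Lemma wnull_bounded nu T v M : nu < 1 ->
  (forall t : R, 0 < t <= T -> `|v t| <= M) -> wnull nu T v.
Proof.
move=> n1 h e e0.
have M0 : 0 < `|M| + 1 by rewrite ltr_wpDl.
have [r r0 hr] := @powR_small R (1 - nu) (e / (`|M| + 1)) ltac:(lra) ltac:(by rewrite divr_gt0).
exists r => // t tT tr.
apply: (@le_trans _ _ (e / (`|M| + 1) * (`|M| + 1))); last by rewrite divfK ?gt_eqF.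
apply: ler_pM; rewrite ?powR_ge0//; first by apply: hr; lra.
by apply: (le_trans (h t tT)); have := ler_norm M; lra.
Qed.

Lemma in_BC_bounded nu T v M : nu < 1 -> cont_on T v ->
  (forall t : R, 0 < t <= T -> `|v t| <= M) -> in_BC nu T v.
Proof.
move=> n1 hc h; split=> //; last exact: wnull_bounded h.
exists (T `^ (1 - nu) * M) => t tT.
by apply: ler_pM; rewrite ?powR_ge0 ?h//; apply: powR_mono; lra.
Qed.

Lemma in_BC_cst nu T (c : E) : nu < 1 -> in_BC nu T (fun=> c).
Proof.
by move=> n1; apply: (@in_BC_bounded _ _ _ `|c|) => //; exact: cont_on_cst.
Qed.

Lemma in_BC_eq nu T v w : (forall t : R, 0 < t <= T -> v t = w t) ->
  in_BC nu T v -> in_BC nu T w.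
Proof.
move=> h [h1 [M h2] h3]; split; first exact: cont_on_eq h1.
- by exists M => t tT; rewrite -h// h2.
- by move=> e e0; have [r r0 hr] := h3 e e0; exists r => // t tT tr; rewrite -h// hr.
Qed.

(** The weights for mu <= nu differ by the factor t^(nu-mu), which is increasing
    in t; this monotonicity is what transfers estimates from mu to nu. *)
Lemma weight_mono mu nu t (y : R) : mu <= nu -> 0 < t -> 
  t `^ (1 - mu) * y = t `^ (nu - mu) * (t `^ (1 - nu) * y).
Proof. by move=> mn t0; rewrite mulrA -powR_split//; congr (_ `^ _ * _); ring. Qed.

Lemma wbound_weight mu nu T v M : mu <= nu -> 0 <= T ->
  wbound nu T v M -> wbound mu T v (T `^ (nu - mu) * M).
Proof.
move=> mn T0 h t /[dup] tT /andP[t0 t1].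
rewrite (weight_mono _ mn t0) ler_pM ?h ?powR_ge0 ?mulr_ge0 ?powR_ge0//.
by apply: powR_mono; rewrite ?subr_ge0// ltW.
Qed.

Lemma in_BC_weight mu nu T v : mu <= nu -> 0 <= T -> in_BC nu T v -> in_BC mu T v.
Proof.
move=> mn T0 [h1 [M h2] h3]; split => //.
  by exists (T `^ (nu - mu) * M); apply: wbound_weight.
move=> e e0.
have q0 : 0 < T `^ (nu - mu) + 1 by rewrite ltr_wpDl ?powR_ge0.
have [r r0 hr] := h3 (e / (T `^ (nu - mu) + 1)) ltac:(by rewrite divr_gt0).
exists r => // t /[dup] tT /andP[t0 t1] tr; rewrite (weight_mono _ mn t0).
have -> : e = (T `^ (nu - mu) + 1) * (e / (T `^ (nu - mu) + 1)).
  by rewrite mulrC divfK ?gt_eqF.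
rewrite ler_pM ?hr ?powR_ge0 ?mulr_ge0 ?powR_ge0//.
by apply: (@le_trans _ _ (T `^ (nu - mu))); [apply: powR_mono; lra | lra].
Qed.

Lemma mean_on_increments nu T v d N : nu <= 1 -> 0 <= N -> mean_on T v d ->
  wbound nu T d N -> forall s t : R, 0 < s -> s <= t -> t <= T ->
  `|v t - v s| <= N * s `^ (nu - 1) * (t - s).
Proof.
move=> n1 N0 hm hd s t s0 st tT.
have := hm s t 0 (N * s `^ (nu - 1)) s0 st tT.
rewrite scaler0 subr0; apply => r /andP[sr rt]; rewrite subr0.
have r0 : 0 < r by lra.
have := hd r ltac:(lra); rewrite weight_le// => /le_trans; apply.
by rewrite ler_wpM2l// powR_anti//; lra.
Qed.

Lemma starts_at_bound nu T v d x N : 0 < nu <= 1 -> 0 <= N -> mean_on T v d ->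
  wbound nu T d N -> starts_at T v x ->
  forall t : R, 0 < t <= T -> `|v t - x| <= dyadic_const nu * N * t `^ nu.
Proof.
move=> /andP[n0 n1] N0 hm hd hx; apply: increments_from_start => //.
exact: mean_on_increments hd.
Qed.

Lemma power_starts_at nu T v x c : 0 < nu ->
  (forall t : R, 0 < t <= T -> `|v t - x| <= c * t `^ nu) -> starts_at T v x.
Proof.
move=> n0 h e e0.
have M0 : 0 < `|c| + 1 by rewrite ltr_wpDl.
have [r r0 hr] := @powR_small R nu (e / (`|c| + 1)) n0 ltac:(by rewrite divr_gt0).
exists r => // t tT tr; apply: (le_trans (h t tT)).
apply: (@le_trans _ _ ((`|c| + 1) * (e / (`|c| + 1)))); last first.
  by rewrite mulrC divfK ?gt_eqF.
have h1 := hr t ltac:(lra); have h2 := powR_ge0 t nu; have h3 := ler_norm c.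
apply: (@le_trans _ _ ((`|c| + 1) * t `^ nu)).
  by rewrite ler_wpM2r//; lra.
by rewrite ler_wpM2l// ltW.
Qed.

Lemma wbound_lim nu T f : (forall e : R, 0 < e -> exists g, in_BC nu T g /\
  wbound nu T (fun t => f t - g t) e) -> in_BC nu T f.
Proof.
move=> h; split.
- move=> t e /[dup] tT /andP[t0 t1] e0.
  pose w := (t / 2) `^ (1 - nu).
  have w0 : 0 < w by apply: powR_gt0; lra.
  pose w' := Num.min w ((2 * t) `^ (1 - nu)).
  have w'0 : 0 < w' by rewrite lt_min w0 powR_gt0//; lra.
  have [g [[gc _ _] hg]] := h (e / 3 * w') ltac:(by rewrite mulr_gt0// divr_gt0).
  have loc s : 0 < s <= T -> t / 2 <= s -> s <= 2 * t -> `|f s - g s| <= e / 3.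
    move=> sT s1 s2.
    have ws : w' <= s `^ (1 - nu).
      rewrite /w' ge_min; have [n1|n1] := leP nu 1.
        by rewrite powR_mono//; lra.
      by rewrite [X in _ || X]powR_anti ?orbT//; lra.
    have s0 : 0 < s by case/andP: sT.
    have := hg s sT; rewrite mulrC -ler_pdivlMr ?powR_gt0// => /le_trans; apply.
    by rewrite ler_pdivrMr ?powR_gt0// ler_wpM2l// divr_ge0// ltW.
  have [r r0 hr] := gc t (e / 3) tT ltac:(by rewrite divr_gt0).
  exists (Num.min r (t / 2)); first by rewrite lt_min r0; lra.
  move=> s sT; rewrite lt_min => /andP[sr]; rewrite ltr_distl => st.
  have -> : f s - f t = (f s - g s) + (g s - g t) - (f t - g t) by module_ring R.
  apply: (le_trans (ler_normB _ _)).
  have a1 := loc s sT ltac:(lra) ltac:(lra); have a2 := loc t tT ltac:(lra) ltac:(lra).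
  have a3 := hr s sT sr; have a4 := ler_normD (f s - g s) (g s - g t).
  by apply: (le_trans (lerD a4 a2)); lra.
- have [g [[_ [M hM] _] hg]] := h 1 ltr01.
  exists (1 + M) => t tT.
  have -> : f t = (f t - g t) + 1 *: g t by module_ring R.
  apply: (le_trans (wnorm_lin _ _ _ _ _)).
  by rewrite normr1 mul1r lerD ?hM ?hg.
- move=> e e0; have [g [[_ _ g0] hg]] := h (e / 2) ltac:(by rewrite divr_gt0).
  have [r r0 hr] := g0 (e / 2) ltac:(by rewrite divr_gt0).
  exists r => // t tT tr.
  have -> : f t = (f t - g t) + 1 *: g t by module_ring R.
  apply: (le_trans (wnorm_lin _ _ _ _ _)).
  by rewrite normr1 mul1r; have := hg t tT; have := hr t tT tr; lra.
Qed.

End Weighted.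

(** * Antiderivatives of functions with an integrable singularity *)

(** Let c be the supremum of the right ends of the intervals [a, c] on which a
    uniform modulus exists; continuity at c extends the modulus past c. *)
Lemma cont_on_uniform {R : realType} {E : normedModType R} (T a : R) (w : R -> E) :
  0 < a -> cont_on T w -> forall e : R, 0 < e -> exists2 r : R, 0 < r &
    forall s t : R, a <= s <= T -> a <= t <= T -> `|s - t| < r ->
      `|w s - w t| <= e.
Proof.
move=> a0 hw e e0.
have [Ta|aT] := ltP T a; first by exists 1 => // s t; lra.
pose P (c r : R) := forall s t : R, a <= s <= c -> a <= t <= c ->
  `|s - t| < r -> `|w s - w t| <= e.
pose S := [set c | a <= c <= T /\ exists2 r, 0 < r & P c r].
have Sa : S a.
  split; first by lra.
  exists 1 => // s t hs ht _; have -> : s = a by lra.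
  by have -> : t = a by [lra]; rewrite subrr normr0 ltW.
have hS : has_sup S by split; [exists a | exists T => c [/andP[]]].
set c := sup S.
have ac : a <= c by apply: ub_le_sup => //; case: hS.
have cT : c <= T by apply: ge_sup; [exists a | move=> t [/andP[]]].
have [r r0 hr] := hw c (e / 2) ltac:(lra) ltac:(lra).
have [c' [/andP[ac' c'T] [r' r'0 hr']] cc'] := sup_adherent (divr_gt0 r0 (ltr0Sn R 1)) hS.
rewrite -/c in cc'.
pose q := Num.min r' (r / 2).
have q0 : 0 < q by rewrite lt_min r'0; lra.
pose c1 := Num.min T (c + r / 2).
have Pc1 : P c1 q.
  move=> s t; rewrite /c1 !le_min => /and3P[s1 s2 s3] /and3P[t1 t2 t3].
  rewrite lt_min => /andP[st]; rewrite ltr_distl => st2.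
  have [/andP[sc tc]|h] := boolP ((s <= c') && (t <= c')).
    by apply: hr' => //; lra.
  have {}h : c' < s \/ c' < t by move: h; rewrite negb_and -!ltNge => /orP.
  have h1 : `|w s - w c| <= e / 2.
    by apply: hr; rewrite ?ltr_distl; case: h; lra.
  have h2 : `|w t - w c| <= e / 2.
    by apply: hr; rewrite ?ltr_distl; case: h; lra.
  have -> : w s - w t = (w s - w c) - (w t - w c) by module_ring R.
  by apply: (le_trans (ler_normB _ _)); lra.
have Sc1 : S c1.
  split; last by exists q.
  by rewrite /c1 le_min ge_min lexx /=; lra.
have : c1 <= c by apply: ub_le_sup => //; case: hS.
rewrite /c1 ge_min => /orP[Tc|]; last by lra.
exists q => // s t hs ht; apply: Pc1.
  by rewrite /c1 le_min; lra.
by rewrite /c1 le_min; lra.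
Qed.

(** Riemann sums with right endpoints: near 0, where the integrand may blow
    up like t^(mu-1), the right endpoint underestimates the weight. *)
Section RightSums.
Context {R : realType} {E : normedModType R}.
Variables (h : R) (w : R -> E).
Hypothesis h0 : 0 < h.

(** Length of [0, t] within the cell [h j, h (j + 1)]. *)
Definition cell (j : nat) (t : R) : R := Num.min (Num.max (t - h * j%:R) 0) h.

Definition right_sum (n : nat) (t : R) : E :=
  \sum_(j < n) cell j t *: w (h * j.+1%:R).

Lemma cell_mono j (s t : R) : s <= t -> cell j s <= cell j t.
Proof.
move=> st; rewrite /cell le_min !ge_min lexx orbT andbT; apply/orP; left.
by rewrite ge_max !le_max lerD2r st lexx orbT.
Qed.

Lemma cell_const j (s t : R) : s <= t -> 
  (t <= h * j%:R) || (h * j.+1%:R <= s) -> cell j s = cell j t.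
Proof.
move=> st; rewrite -natr1 mulrDr mulr1 => /orP[ht|hs].
  by rewrite /cell !max_r//; lra.
rewrite /cell !min_r//; rewrite le_max; apply/orP; left; lra.
Qed.

Lemma cell0 j : cell j 0 = 0.
Proof.
rewrite /cell max_r; first by rewrite min_l// ltW.
by rewrite sub0r oppr_le0 mulr_ge0// ltW.
Qed.

Lemma sum_cell n (t : R) : 0 <= t -> \sum_(j < n) cell j t = Num.min t (h * n%:R).
Proof.
move=> t0; elim: n => [|n IH]; first by rewrite big_ord0 mulr0 min_r.
rewrite big_ord_recr /= IH /cell -natr1 mulrDr mulr1.
have [tn|nt] := leP t (h * n%:R).
  rewrite (max_r (_ : t - _ <= 0)) ?subr_le0// (min_l (ltW h0)) addr0 min_l//.
  by apply: (le_trans tn); rewrite lerDl ltW.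
rewrite max_l; last by rewrite subr_ge0 ltW.
by rewrite addr_minr addrC subrK.
Qed.

(** Only the cells meeting [s, t] contribute to the increment; their parts in
    [s, t] add up to t - s, and their right endpoints lie in [s, t + h]. *)
Lemma right_sum_mean n (s t : R) (e : E) (om : R) :
  0 <= s -> s <= t -> t <= h * n%:R ->
  (forall r, s <= r <= t + h -> r <= h * n%:R -> `|w r - e| <= om) ->
  `|right_sum n t - right_sum n s - (t - s) *: e| <= om * (t - s).
Proof.
move=> s0 st tn hw.
have sumE : t - s = \sum_(j < n) (cell j t - cell j s).
  rewrite sumrB !sum_cell//; last exact: le_trans st.
  by rewrite !min_l//; exact: le_trans tn.
rewrite [in leLHS]sumE scaler_suml -!sumrB.
have -> : \sum_(j < n) (cell j t *: w (h * j.+1%:R) - cell j s *: w (h * j.+1%:R)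
     - (cell j t - cell j s) *: e)
   = \sum_(j < n) (cell j t - cell j s) *: (w (h * j.+1%:R) - e).
  by apply: eq_bigr => j _; module_ring R.
rewrite sumE mulr_sumr; apply: (le_trans (ler_norm_sum _ _ _)).
apply: ler_sum => j _; rewrite normrZ.
have c0 : 0 <= cell j t - cell j s by rewrite subr_ge0 cell_mono.
rewrite (ger0_norm c0).
have [jj|] := boolP ((t <= h * j%:R) || (h * j.+1%:R <= s)).
  by rewrite (cell_const st jj) subrr mul0r mulr0.
rewrite negb_or -!ltNge => /andP[j1 j2].
rewrite mulrC ler_wpM2r//; apply: hw; last first.
  by rewrite ler_pM2l// ler_nat.
by move: j2; rewrite -natr1 mulrDr mulr1; lra.
Qed.

Lemma right_sum_starts n T : starts_at T (right_sum n) 0.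
Proof.
move=> e e0.
pose M := \sum_(j < n) `|w (h * j.+1%:R)|.
have M0 : 0 < M + 1 by rewrite ltr_wpDl// sumr_ge0.
exists (e / (M + 1)); first by rewrite divr_gt0.
move=> t /andP[t0 _] te; rewrite subr0.
apply: (@le_trans _ _ (t * M)); last first.
  by move: te; rewrite ler_pdivlMr//; nra.
rewrite mulr_sumr; apply: (le_trans (ler_norm_sum _ _ _)).
apply: ler_sum => j _; rewrite normrZ ler_wpM2r//.
have c0 : 0 <= cell j t by rewrite -(cell0 j) cell_mono// ltW.
rewrite ger0_norm// /cell ge_min ge_max; apply/orP; left.
by rewrite (ltW t0) andbT lerBlDr lerDl mulr_ge0// ltW.
Qed.

End RightSums.

(** Right Riemann sums are Cauchy: away from 0 by uniform continuity, and near 0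
    because they are uniformly O(t^mu).  Their limit inherits the estimate of
    right_sum_mean, hence is an antiderivative.  This replaces a vector-valued
    improper integral. *)
Lemma antiderivative {R : realType} {E : completeNormedModType R}
    (mu T : R) (w : R -> E) : 0 < mu <= 1 -> in_BC mu T w ->
  exists W : R -> E, mean_on T W w /\ starts_at T W 0.
Proof.
move=> /andP[mu0 mu1] [hc [N0 hN0] _].
pose N := `|N0|; have N_ge0 : 0 <= N := normr_ge0 _.
have hN : wbound mu T w N by apply: wboundW hN0; exact: ler_norm.
have [T0|T0] := leP T 0.
  exists (fun=> 0); split; last exact: starts_at_cst.
  by move=> s t e om s0 st tT; exfalso; lra.
pose h n : R := T / n.+1%:R.
have h0 n : 0 < h n by rewrite divr_gt0.
have hT n : h n * n.+1%:R = T by rewrite divfK// pnatr_eq0.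
pose F n := right_sum (h n) w n.+1.
have Finc n : forall s t : R, 0 < s -> s <= t -> t <= T ->
    `|F n t - F n s| <= N * s `^ (mu - 1) * (t - s).
  move=> s t s0 st tT.
  have := @right_sum_mean _ _ (h n) w (h0 n) n.+1 s t 0 (N * s `^ (mu - 1)) (ltW s0) st.
  rewrite hT scaler0 subr0; apply => // r /andP[sr _] rT; rewrite subr0.
  have r0 : 0 < r by lra.
  have := hN r ltac:(lra); rewrite weight_le// => /le_trans; apply.
  by rewrite ler_wpM2l// powR_anti//; lra.
pose c := dyadic_const mu.
have Fb n : forall t : R, 0 < t <= T -> `|F n t| <= c * N * t `^ mu.
  move=> t tT; rewrite -[F n t]subr0.
  have st0 : starts_at T (F n) 0 by apply: right_sum_starts.
  exact: (increments_from_start mu0 N_ge0 st0 (Finc n)).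
have hsmall (r : R) : 0 < r -> exists n, forall m, (n <= m)%N -> h m < r.
  move=> r0; exists (Num.truncn (T / r)) => m nm.
  rewrite ltr_pdivrMr// mulrC -ltr_pdivrMr//.
  by apply: (lt_le_trans (truncnS_gt _)); rewrite ler_nat.
have lim t : exists l, 0 < t <= T -> forall e : R, 0 < e ->
    exists n, forall m, (n <= m)%N -> `|l - F m t| <= e.
  have [tT|] := boolP (0 < t <= T); last by exists 0.
  suff [l hl] : exists l, forall e : R, 0 < e ->
    exists n, forall m, (n <= m)%N -> `|l - F m t| <= e by exists l.
  apply: cauchy_limit => e e0.
  have K0 : 0 < 2 * (c * N) + 1.
    by rewrite ltr_wpDl// mulr_ge0// mulr_ge0// ltW// dyadic_const_gt0.
  have [a a0 ha] := @powR_small R mu (e / 2 / (2 * (c * N) + 1)) mu0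
     ltac:(by rewrite divr_gt0// divr_gt0).
  pose d := Num.min a t.
  have d0 : 0 < d by rewrite lt_min a0; case/andP: tT.
  have da : d <= a by rewrite ge_min lexx.
  have dt : d <= t by rewrite ge_min lexx orbT.
  pose om := e / 4 / T.
  have om0 : 0 < om by rewrite !divr_gt0.
  have [r r0 hr] := cont_on_uniform d0 hc om0.
  have [n hn] := hsmall (r / 2) ltac:(lra).
  exists n => m nm.
  have small k : `|F k d| <= c * N * d `^ mu by apply: Fb; lra.
  have dmu := ha d ltac:(lra).
  have far : `|(F m t - F n t) - (F m d - F n d)| <= (om + om) * (t - d).
    apply: (@local_lipschitz_global _ _ (fun s => F m s - F n s)) => // q qq.
    exists (r / 2); first by lra.
    move=> s ss; rewrite ltr_distl => sq.
    have main k : (n <= k)%N -> `|F k s - F k q - (s - q) *: w q| <= om * `|s - q|.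
      move=> nk; have hk := hn k nk.
      have [sq1|qs1] := leP s q.
        have := @right_sum_mean _ _ (h k) w (h0 k) k.+1 s q (w q) om
          ltac:(lra) sq1; rewrite hT => /(_ ltac:(lra)) hh.
        have -> : F k s - F k q - (s - q) *: w q = - (F k q - F k s - (q - s) *: w q).
          by module_ring R.
        have -> : `|s - q| = q - s by rewrite distrC ger0_norm// subr_ge0.
        by rewrite normrN; apply: hh => x xx xT; apply: hr; rewrite ?ltr_distl; lra.
      have := @right_sum_mean _ _ (h k) w (h0 k) k.+1 q s (w q) om
        ltac:(lra) (ltW qs1); rewrite hT => /(_ ltac:(lra)) hh.
      have -> : `|s - q| = s - q by rewrite ger0_norm// subr_ge0 ltW.
      by apply: hh => x xx xT; apply: hr; rewrite ?ltr_distl; lra.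
    have -> : F m s - F n s - (F m q - F n q) =
      (F m s - F m q - (s - q) *: w q) - (F n s - F n q - (s - q) *: w q).
      by module_ring R.
    by apply: (le_trans (ler_normB _ _)); rewrite mulrDl lerD ?main.
  have -> : F m t - F n t = ((F m t - F n t) - (F m d - F n d)) + (F m d - F n d).
    by module_ring R.
  apply: (le_trans (ler_normD _ _)).
  have far2 : (om + om) * (t - d) <= e / 2.
    have -> : e / 2 = (om + om) * T by rewrite /om; field; rewrite gt_eqF.
    by rewrite ler_wpM2l//; lra.
  have near2 : `|F m d - F n d| <= e / 2.
    apply: (le_trans (ler_normB _ _)); apply: (le_trans (lerD (small m) (small n))).
    move: dmu; rewrite ler_pdivlMr// => dmu.
    by have := powR_ge0 d mu; lra.
  by apply: (le_trans (lerD (le_trans far far2) near2)); lra.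
have [W hW] := choice lim.
exists W; split.
  move=> s t e om s0 st tT hw; apply: ler_eps_pos => eps eps0.
  pose k := eps / (3 * (T + 1)).
  have T1 : 0 < 3 * (T + 1) by lra.
  have k0 : 0 < k by rewrite divr_gt0.
  have kT : k * (t - s) + k + k <= eps.
    have -> : eps = k * (3 * (T + 1)) by rewrite /k divfK// gt_eqF.
    nra.
  have [r r0 hr] := hc t k ltac:(lra) k0.
  have [n1 hn1] := hsmall r r0.
  have [n2 hn2] := hW t ltac:(lra) k k0.
  have [n3 hn3] := hW s ltac:(lra) k k0.
  pose n := maxn n1 (maxn n2 n3).
  have g1 : h n < r by apply: hn1; rewrite leq_maxl.
  have g2 : `|W t - F n t| <= k.
    by apply: hn2; apply: leq_trans (leq_maxr _ _); rewrite leq_maxl.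
  have g3 : `|W s - F n s| <= k.
    by apply: hn3; apply: leq_trans (leq_maxr _ _); rewrite leq_maxr.
  have g4 : `|F n t - F n s - (t - s) *: e| <= (om + k) * (t - s).
    apply: (@right_sum_mean _ _ (h n) w (h0 n) n.+1); rewrite ?hT//; first exact: ltW.
    move=> x xx xT; have [xt|tx] := leP x t.
      by apply: (le_trans (hw x _)); lra.
    have -> : w x - e = (w x - w t) + (w t - e) by module_ring R.
    apply: (le_trans (ler_normD _ _)); rewrite addrC lerD ?hw ?lexx ?st//.
    by apply: hr; rewrite ?ltr_distl; lra.
  have -> : W t - W s - (t - s) *: e =
    (F n t - F n s - (t - s) *: e) + ((W t - F n t) - (W s - F n s)).
    by module_ring R.
  apply: (le_trans (ler_normD _ _)).
  have g5 := le_trans (ler_normB _ _) (lerD g2 g3).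
  by apply: (le_trans (lerD g4 g5)); lra.
apply: (@power_starts_at _ _ mu T W 0 (c * N)) => // t tT; rewrite subr0.
apply: ler_eps_pos => e e0; have [n hn] := hW t tT e e0.
have -> : W t = F n t + (W t - F n t) by module_ring R.
by apply: (le_trans (ler_normD _ _)); rewrite lerD ?Fb ?hn.
Qed.

(** * Epsilon-delta form of the function spaces *)

Section EpsilonDelta.
Context {R : realType} {E : normedModType R}.
Implicit Types (v d : R -> E) (T nu : R) (e : R).

Lemma near_withinP (A P : set R) (t : R) :
  (\forall s \near within A (nbhs t), P s) <->
  exists2 r : R, 0 < r & forall s : R, A s -> `|s - t| < r -> P s.
Proof.
rewrite near_withinE; split.
  move=> /nbhs_ballP[r /= r0 h]; exists r => // s As st; apply: h => //.
  by rewrite /ball/= distrC.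
case=> r r0 h; apply/nbhs_ballP; exists r => // s.
by rewrite /ball/= distrC => st As; exact: h.
Qed.

Lemma within_continuousP T v :
  {within `]0, T], continuous v} <-> cont_on T v.
Proof.
split.
  move=> /subspace_continuousP h t e tT e0.
  have /cvgrPdist_le/(_ e e0)/near_withinP[r r0 hr] := h t ltac:(by rewrite /= in_itv/=).
  exists r => // s sT st; rewrite distrC; apply: hr => //.
move=> h; apply/subspace_continuousP => t; rewrite /= in_itv/= => tT.
apply/cvgrPdist_le => e e0; apply/near_withinP.
have [r r0 hr] := h t e tT e0; exists r => // s; rewrite /= in_itv/= => sT st.
by rewrite distrC hr.
Qed.

Lemma at_right0P (f : R -> E) (x : E) :
  f t @[t --> 0^'+] --> x <-> forall e : R, 0 < e ->
   exists2 r : R, 0 < r & forall t : R, 0 < t -> t <= r -> `|f t - x| <= e.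
Proof.
split.
  move=> /cvgrPdist_le h e e0; have /near_withinP[r r0 hr] := h e e0.
  exists (r / 2); first by lra.
  move=> t t0 tr; rewrite distrC; apply: hr => //.
  by rewrite subr0 gtr0_norm//; lra.
move=> h; apply/cvgrPdist_le => e e0; apply/near_withinP.
have [r r0 hr] := h e e0; exists r => // t /= t0; rewrite subr0 gtr0_norm// => tr.
by rewrite distrC hr// ltW.
Qed.

Lemma starts_atP T v x : 0 < T -> 
  (v t @[t --> 0^'+] --> x) <-> starts_at T v x.
Proof.
move=> T0; split=> [/at_right0P h e e0|h].
  by have [r r0 hr] := h e e0; exists r => // t /andP[t0 _]; exact: hr.
apply/at_right0P => e e0; have [r r0 hr] := h e e0.
exists (Num.min r T); first by rewrite lt_min r0.
by move=> t t0; rewrite le_min => /andP[tr tT]; apply: hr; rewrite ?t0.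
Qed.

End EpsilonDelta.

Section EpsilonDelta2.
Context {R : realType} {E : normedModType R}.
Implicit Types (v d : R -> E) (T nu : R) (e : R).

Lemma BCwP nu T v : 0 < T -> BCw nu T v <-> in_BC nu T v.
Proof.
move=> T0.
have wE t : `|t `^ (1 - nu) *: v t| = t `^ (1 - nu) * `|v t|.
  by rewrite normrZ ger0_norm ?powR_ge0.
have null : (`|t `^ (1 - nu) *: v t| @[t --> 0^'+] --> (0 : R)) <-> wnull nu T v.
  split=> [/(@at_right0P R R)/= h e e0|h].
    have [r r0 hr] := h e e0; exists r => // t /andP[t0 _] tr.
    by have := hr t t0 tr; rewrite subr0 normr_id wE.
  apply/(@at_right0P R R) => e e0; have [r r0 hr] := h e e0.
  exists (Num.min r T); first by rewrite lt_min r0.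
  move=> t t0; rewrite le_min => /andP[tr tT].
  by rewrite subr0 normr_id wE hr// t0.
have bnd : [bounded t `^ (1 - nu) *: v t | t in `]0, T]%classic] <->
    exists M, wbound nu T v M.
  have AT : (`]0, T]%classic : set R) T by rewrite /= in_itv/= T0 lexx.
  have PF := globally_properfilter AT.
  split.
    move=> /ex_bound[M hM]; exists M => t tT; rewrite -wE; exact: hM.
  move=> [M hM]; apply/ex_bound; exists M => t; rewrite /= in_itv/= => tT.
  by rewrite wE hM.
split=> -[/within_continuousP h1 /bnd h2 /null h3]; split=> //.
Qed.

Lemma diff_quotE v t s (d : E) : s != t ->
  diff_quot v t s - d = (s - t)^-1 *: (v s - v t - (s - t) *: d).
Proof.
move=> st; rewrite /diff_quot.
by rewrite [in RHS]scalerBr scalerA mulVf ?scale1r// subr_eq0.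
Qed.

Lemma diff_quot_cvgP T v t (d : E) : 
  (diff_quot v t s @[s --> within `]0, T]%classic t^'] --> d) <->
  forall e : R, 0 < e -> exists2 r : R, 0 < r &
    forall s : R, 0 < s <= T -> `|s - t| < r ->
      `|v s - v t - (s - t) *: d| <= e * `|s - t|.
Proof.
have key s e : s != t -> (`|d - diff_quot v t s| <= e) =
    (`|v s - v t - (s - t) *: d| <= e * `|s - t|).
  move=> st; rewrite distrC diff_quotE// normrZ normfV mulrC ler_pdivrMr//.
  by rewrite normr_gt0 subr_eq0.
have wE : within `]0, T]%classic t^' = within (`]0, T] `&` [set s | s != t]) (nbhs t).
  rewrite predeqE => P; rewrite /dnbhs /within /=.
  split=> /nbhs_ballP[r r0 h]; apply/nbhs_ballP; exists r => // s /h /=.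
    by move=> {}h [? ?]; apply: h.
  by move=> {}h ? ?; apply: h.
rewrite wE; split.
  move=> /cvgrPdist_le h e e0; have /near_withinP[r r0 hr] := h e e0.
  exists r => // s sT st; have [->|nst] := eqVneq s t.
    by rewrite !subrr scale0r subr0 !normr0 mulr0.
  by rewrite -key//; apply: hr => //; split; rewrite //= in_itv.
move=> h; apply/cvgrPdist_le => e e0; apply/near_withinP.
have [r r0 hr] := h e e0; exists r => // s [/=]; rewrite in_itv/= => sT nst st.
by rewrite key// hr.
Qed.

Lemma within_itv_proper T t : 0 < t <= T -> ProperFilter (within `]0, T]%classic t^').
Proof.
move=> /andP[t0 tT]; apply: Build_ProperFilter_ex => P; rewrite /dnbhs /within /=.
move=> /nbhs_ballP[r /= r0 hr].
pose s := Num.max (t / 2) (t - r / 2).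
have st : s < t by rewrite gt_max; lra.
have s2 : t / 2 <= s by rewrite le_max lexx.
have s3 : t - r / 2 <= s by rewrite le_max lexx orbT.
exists s; apply: (hr s); last by rewrite in_itv/=; lra.
  by rewrite /ball/= ltr_distl; lra.
by rewrite lt_eqF.
Qed.

Lemma der_on_derive T v d : der_on T v d ->
  derivable_on T v /\ forall t : R, 0 < t <= T -> derive_on T v t = d t.
Proof.
move=> h; have c t : 0 < t <= T ->
    diff_quot v t s @[s --> within `]0, T]%classic t^'] --> d t.
  by move=> tT; apply/diff_quot_cvgP => e e0; exact: h.
split=> t.
  by rewrite in_itv/= => tT; apply/cvg_ex; exists (d t); exact: c.
move=> tT; have := within_itv_proper tT => ?; apply: cvg_lim => //.
exact: c.
Qed.

Lemma derivable_on_der T v : derivable_on T v -> der_on T v (derive_on T v).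
Proof.
move=> h t e tT e0; have ht : cvg (diff_quot v t s @[s --> within `]0, T]%classic t^']).
  by apply: h; rewrite in_itv.
exact: (diff_quot_cvgP T v t (derive_on T v t)).1 ht e e0.
Qed.

End EpsilonDelta2.

(** * The linear problem *)

(** Completeness of BC_{1-nu}([0, T], E), for rapidly converging sequences. *)
Lemma weighted_complete {R : realType} {E : completeNormedModType R}
    (nu T a : R) (g : nat -> R -> E) :
  (forall n, in_BC nu T (g n)) ->
  (forall n, wbound nu T (fun t => g n.+1 t - g n t) (a / 2 ^+ n)) ->
  exists f, in_BC nu T f /\
    forall n, wbound nu T (fun t => f t - g n t) (2 * a / 2 ^+ n).
Proof.
move=> hg hd.
have lim t : exists l, 0 < t <= T ->
    forall n, t `^ (1 - nu) * `|l - g n t| <= 2 * a / 2 ^+ n.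
  have [tT|] := boolP (0 < t <= T); last by exists 0.
  have t0 : 0 < t by case/andP: tT.
  have hn n : `|g n.+1 t - g n t| <= a * t `^ (nu - 1) / 2 ^+ n.
    by have := hd n t tT; rewrite weight_le// => /le_trans; apply; rewrite mulrAC.
  have [l hl] := geometric_cauchy hn.
  exists l => _ n; rewrite weight_le//; apply: (le_trans (hl n)).
  by rewrite mulrA mulrAC.
have [f hf] := choice lim.
have bound n : wbound nu T (fun t => f t - g n t) (2 * a / 2 ^+ n).
  by move=> t tT; apply: hf.
exists f; split=> //; apply: wbound_lim => e e0.
have [n hn] := geometric_small (2 * a) e0.
by exists (g n); split=> //; apply: wboundW hn (bound n).
Qed.

Section BoundedLinear.
Context {R : realType} {E F : normedModType R}.
Variables (f : {linear E -> F}) (k : R).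
Hypothesis fk : forall x, `|f x| <= k * `|x|.
Implicit Types (T nu : R) (w d : R -> E).

Lemma bounded_abs x : `|f x| <= `|k| * `|x|.
Proof. by apply: (le_trans (fk x)); rewrite ler_wpM2r// ler_norm. Qed.

Lemma cont_on_bounded T w : cont_on T w -> cont_on T (fun t => f (w t)).
Proof.
move=> hw; apply: (cont_on_dom hw hw) => t tT.
exists `|k|, 1; split=> // s sT _; rewrite -linearB.
apply: (le_trans (bounded_abs _)); rewrite ler_wpM2l//.
by rewrite lerDl.
Qed.

Lemma der_on_bounded T w d : der_on T w d ->
  der_on T (fun t => f (w t)) (fun t => f (d t)).
Proof.
move=> hw t e tT e0.
have k0 : 0 < `|k| + 1 by rewrite ltr_wpDl.
have [r r0 hr] := hw t (e / (`|k| + 1)) tT ltac:(by rewrite divr_gt0).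
exists r => // s sT sr; rewrite -linearB -linearZ -linearB.
apply: (le_trans (bounded_abs _)).
have h := hr s sT sr.
apply: (@le_trans _ _ ((`|k| + 1) * (e / (`|k| + 1) * `|s - t|))).
  by rewrite ler_pM// lerDl.
by rewrite mulrA [_ * (e / _)]mulrC divfK// gt_eqF.
Qed.

Lemma starts_at_bounded T w x : starts_at T w x ->
  starts_at T (fun t => f (w t)) (f x).
Proof.
move=> hw e e0.
have k0 : 0 < `|k| + 1 by rewrite ltr_wpDl.
have [r r0 hr] := hw (e / (`|k| + 1)) ltac:(by rewrite divr_gt0).
exists r => // t tT tr; rewrite -linearB; apply: (le_trans (bounded_abs _)).
have h := hr t tT tr.
apply: (@le_trans _ _ ((`|k| + 1) * (e / (`|k| + 1)))).
  by rewrite ler_pM// lerDl.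
by rewrite mulrC divfK// gt_eqF.
Qed.

Lemma wbound_bounded nu T w M : wbound nu T w M ->
  wbound nu T (fun t => f (w t)) (`|k| * M).
Proof.
move=> hw t tT; apply: (@le_trans _ _ (`|k| * (t `^ (1 - nu) * `|w t|))).
  by rewrite mulrCA ler_wpM2l ?powR_ge0// bounded_abs.
by rewrite ler_wpM2l// hw.
Qed.

Lemma in_BC_bounded_linear nu T w : in_BC nu T w -> in_BC nu T (fun t => f (w t)).
Proof.
move=> [h1 [M h2] h3]; split; first exact: cont_on_bounded.
  by exists (`|k| * M); apply: wbound_bounded.
move=> e e0.
have k0 : 0 < `|k| + 1 by rewrite ltr_wpDl.
have [r r0 hr] := h3 (e / (`|k| + 1)) ltac:(by rewrite divr_gt0).
exists r => // t tT tr; have h := hr t tT tr.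
apply: (@le_trans _ _ (`|k| * (t `^ (1 - nu) * `|w t|))).
  by rewrite mulrCA ler_wpM2l ?powR_ge0// bounded_abs.
apply: (@le_trans _ _ ((`|k| + 1) * (e / (`|k| + 1)))).
  by rewrite ler_pM// ?mulr_ge0 ?powR_ge0// lerDl.
by rewrite mulrC divfK// gt_eqF.
Qed.

End BoundedLinear.

Lemma continuous_linear_bound {R : realType} {E F : normedModType R}
    (f : {linear E -> F}) : continuous f ->
  exists2 k : R, 0 < k & forall x, `|f x| <= k * `|x|.
Proof.
move=> /(linear_bounded_continuous f)/linear_boundedP/pinfty_ex_gt0.
by move=> [k k0 hk]; exists k.
Qed.

Section LinearProblem.
Context {R : realType} {E0 E1 : completeNormedModType R}.
Variables (i B : {linear E1 -> E0}) (ki kB : R).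
Hypothesis hi : forall b, `|i b| <= ki * `|b|.
Hypothesis hB : forall b, `|B b| <= kB * `|b|.
Implicit Types (nu T : R) (f g : R -> E0) (u v : R -> E1) (x y : E0).

(** The derivative of i u is recorded as f - B u, so that its regularity and its
    bounds are those of f and u. *)
Definition solves nu T f x u :=
  [/\ in_BC nu T u, der_on T (fun t => i (u t)) (fun t => f t - B (u t))
    & starts_at T (fun t => i (u t)) x].

Lemma solves_lin nu T f g x y u v k : solves nu T f x u -> solves nu T g y v ->
  solves nu T (fun t => f t + k *: g t) (x + k *: y) (fun t => u t + k *: v t).
Proof.
move=> [h1 h2 h3] [h1' h2' h3']; split; first exact: in_BC_lin.
  apply: der_on_eq (der_on_lin k h2 h2') => t _.
    by rewrite linearD linearZ.
  have -> : B (u t + k *: v t) = B (u t) + k *: B (v t) by rewrite linearD linearZ.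
  by module_ring R.
apply: starts_at_eq (starts_at_lin k h3 h3') => t _.
by rewrite linearD linearZ.
Qed.

Lemma solves_eq nu T f g x u : (forall t, 0 < t <= T -> f t = g t) ->
  solves nu T f x u -> solves nu T g x u.
Proof.
by move=> h [h1 h2 h3]; split=> //; apply: der_on_eq h2 => // t tT; rewrite h.
Qed.

Lemma solves_sol_eq nu T f x u v : (forall t, 0 < t <= T -> u t = v t) ->
  solves nu T f x u -> solves nu T f x v.
Proof.
move=> h [h1 h2 h3]; split; first exact: in_BC_eq h1.
  by apply: der_on_eq h2 => t tT; rewrite h.
by apply: starts_at_eq h3 => t tT; rewrite h.
Qed.

Lemma solvesB nu T f g x y u v : solves nu T f x u -> solves nu T g y v ->
  solves nu T (fun t => f t - g t) (x - y) (fun t => u t - v t).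
Proof.
move=> h h'; have h1 := solves_lin (-1) h h'; rewrite scaleN1r in h1.
by apply: (solves_sol_eq _ (solves_eq _ h1)) => t _; rewrite scaleN1r.
Qed.

Lemma solvesD nu T f g x y u v : solves nu T f x u -> solves nu T g y v ->
  solves nu T (fun t => f t + g t) (x + y) (fun t => u t + v t).
Proof.
move=> h h'; have h1 := solves_lin 1 h h'; rewrite scale1r in h1.
by apply: (solves_sol_eq _ (solves_eq _ h1)) => t _; rewrite scale1r.
Qed.

Lemma solves0 nu T : nu < 1 -> solves nu T (fun=> 0) 0 (fun=> 0).
Proof.
move=> n1; split.
- exact: in_BC_cst.
- apply: (@der_on_eq _ _ _ (fun=> 0) _ (fun=> 0)); last exact: der_on_cst.
    by move=> t _; rewrite linear0.
  by move=> t _; rewrite linear0 subr0.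
- apply: (@starts_at_eq _ _ _ (fun=> 0)); last exact: starts_at_cst.
  by move=> t _; rewrite linear0.
Qed.

Lemma solves_cst nu T b : nu < 1 -> solves nu T (fun=> B b) (i b) (fun=> b).
Proof.
move=> n1; split; first exact: in_BC_cst.
- apply: (@der_on_eq _ _ _ (fun=> i b) _ (fun=> 0)); last exact: der_on_cst.
    by [].
  by move=> s _; rewrite subrr.
- exact: starts_at_cst.
Qed.

Lemma solvesZ nu T f x u k : nu < 1 -> solves nu T f x u ->
  solves nu T (fun t => k *: f t) (k *: x) (fun t => k *: u t).
Proof.
move=> n1 h; have h1 := solves_lin k (solves0 T n1) h; rewrite add0r in h1.
by apply: (solves_sol_eq _ (solves_eq _ h1)) => t _; rewrite add0r.
Qed.

Lemma solves_sub nu T T' f x u : T' <= T -> solves nu T f x u ->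
  solves nu T' f x u.
Proof.
move=> TT [h1 h2 h3]; split.
- exact: in_BC_sub h1.
- exact: der_onW h2.
- exact: starts_atW h3.
Qed.

Lemma solves_weight mu nu T f x u : mu <= nu -> 0 <= T -> solves nu T f x u ->
  solves mu T f x u.
Proof. by move=> mn T0 [h1 h2 h3]; split=> //; apply: in_BC_weight h1. Qed.

Lemma solves_derBC nu T f x u : in_BC nu T f -> solves nu T f x u ->
  in_BC nu T (fun t => f t - B (u t)).
Proof.
move=> hf [hu _ _].
apply: in_BC_eq (in_BC_lin (-1) hf (in_BC_bounded_linear hB hu)) => t _.
by rewrite scaleN1r.
Qed.

Lemma solves_derbound nu T f u M N : wbound nu T f M -> wbound nu T u N ->
  wbound nu T (fun t => f t - B (u t)) (M + `|kB| * N).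
Proof.
move=> hf hu t tT.
have := wbound_lin (-1) hf (wbound_bounded hB hu) tT.
by rewrite normrN1 mul1r scaleN1r.
Qed.

(** Differentiability passes to the limit because it can be restated in
    integrated form, and the initial value because the weighted bound on the
    derivative controls the distance to it uniformly. *)
Lemma solves_closed nu T f x u : 0 < nu <= 1 -> in_BC nu T f ->
  (forall e : R, 0 < e -> exists g v, [/\ solves nu T g x v,
     wbound nu T (fun t => f t - g t) e & wbound nu T (fun t => u t - v t) e]) ->
  solves nu T f x u.
Proof.
move=> /andP[n0 n1] hf happ.
have hu : in_BC nu T u.
  by apply: wbound_lim => e e0; have [g [v [[hv _ _] _ h]]] := happ e e0; exists v.
have hd : cont_on T (fun t => f t - B (u t)).
  case: hf hu => [hf _ _] [hu _ _].
  apply: cont_on_eq (cont_on_lin (-1) hf (cont_on_bounded hB hu)) => t _.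
  by rewrite scaleN1r.
split=> //.
  apply: mean_der_on => // s t e w s0 st tT hw.
  apply: ler_eps_pos => eps eps0.
  pose K := s `^ (nu - 1) * (1 + `|kB|) * (t - s) + 2 * `|ki| * s `^ (nu - 1).
  have sg := powR_ge0 s (nu - 1).
  have K0 : 0 < K + 1.
    have ts : 0 <= t - s by rewrite subr_ge0.
    have k1 : 0 <= 1 + `|kB| by rewrite addr_ge0.
    by rewrite ltr_wpDl// addr_ge0 ?mulr_ge0.
  pose q := eps / (K + 1).
  have q0 : 0 < q by rewrite divr_gt0.
  have [g [v [[_ gv _] fg uv]]] := happ q q0.
  have near r : s <= r <= t -> `|u r - v r| <= q * s `^ (nu - 1)
      /\ `|f r - g r| <= q * s `^ (nu - 1).
    move=> /andP[sr rt]; have r0 : 0 < r by lra.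
    have rs : q * r `^ (nu - 1) <= q * s `^ (nu - 1).
      by rewrite ler_wpM2l ?(ltW q0)// powR_anti//; lra.
    have := uv r ltac:(lra); have := fg r ltac:(lra).
    by rewrite !weight_le// => a b; split; lra.
  have dist r : s <= r <= t -> `|g r - B (v r) - e| <= w + q * s `^ (nu - 1) * (1 + `|kB|).
    move=> rr; have [a b] := near r rr.
    have -> : g r - B (v r) - e =
      (f r - B (u r) - e) - ((f r - g r) - (B (u r) - B (v r))) by module_ring R.
    apply: (le_trans (ler_normB _ _)); rewrite lerD ?hw//.
    apply: (le_trans (ler_normB _ _)); rewrite -linearB mulrDr mulr1 lerD//.
    apply: (le_trans (bounded_abs hB _)).
    by rewrite [leRHS]mulrC ler_wpM2l.
  have m := der_on_mean gv s0 st tT dist.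
  have idist r : s <= r <= t -> `|i (u r) - i (v r)| <= `|ki| * (q * s `^ (nu - 1)).
    move=> rr; have [a b] := near r rr; rewrite -linearB.
    by apply: (le_trans (bounded_abs hi _)); rewrite ler_wpM2l.
  have -> : i (u t) - i (u s) - (t - s) *: e =
    (i (v t) - i (v s) - (t - s) *: e) + ((i (u t) - i (v t)) - (i (u s) - i (v s))).
    by module_ring R.
  apply: (le_trans (ler_normD _ _)); apply: (le_trans (lerD m (ler_normB _ _))).
  have h1 := idist t ltac:(by rewrite st lexx).
  have h2 := idist s ltac:(by rewrite st lexx).
  have qe : q * K <= eps.
    by have -> : eps = q * (K + 1) by [rewrite /q divfK// gt_eqF]; rewrite ler_pM2l// lerDl.
  apply: (@le_trans _ _ (w * (t - s) + q * K)); last by rewrite lerD2l.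
  rewrite /K; set p := s `^ (nu - 1) in h1 h2 *; lra.
have [_ [Mf hMf] _] := hf; have [_ [Mu hMu] _] := hu.
pose N := (`|Mf| + 1) + `|kB| * (`|Mu| + 1).
have N0 : 0 <= N by rewrite !addr_ge0// mulr_ge0// addr_ge0.
apply: (@power_starts_at _ _ nu _ _ _ (dyadic_const nu * N)) => // t tT.
apply: ler_eps_pos => e e0.
have t0 : 0 < t by case/andP: tT.
pose q := Num.min 1 (e / (`|ki| * t `^ (nu - 1) + 1)).
have p0 : 0 < `|ki| * t `^ (nu - 1) + 1 by rewrite ltr_wpDl// mulr_ge0// powR_ge0.
have q0 : 0 < q by rewrite lt_min ltr01 divr_gt0.
have q1 : q <= 1 by rewrite ge_min lexx.
have qe : q <= e / (`|ki| * t `^ (nu - 1) + 1) by rewrite ge_min lexx orbT.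
have [g [v [[hv gv hx] fg uv]]] := happ q q0.
have gb : wbound nu T g (`|Mf| + 1).
  move=> s sT; have h1 := hMf s sT; have h2 := fg s sT.
  have -> : g s = f s + (-1) *: (f s - g s) by module_ring R.
  apply: (le_trans (wnorm_lin _ _ _ _ _)); rewrite normrN1 mul1r.
  by have := ler_norm Mf; lra.
have vb : wbound nu T v (`|Mu| + 1).
  move=> s sT; have h1 := hMu s sT; have h2 := uv s sT.
  have -> : v s = u s + (-1) *: (u s - v s) by module_ring R.
  apply: (le_trans (wnorm_lin _ _ _ _ _)); rewrite normrN1 mul1r.
  by have := ler_norm Mu; lra.
have := starts_at_bound (introT andP (conj n0 n1)) N0 (der_on_mean gv)
  (solves_derbound gb vb) hx tT.
move=> h1.
have -> : i (u t) - x = (i (v t) - x) + i (u t - v t).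
  have -> : i (u t - v t) = i (u t) - i (v t) by rewrite linearB.
  by module_ring R.
apply: (le_trans (ler_normD _ _)); rewrite lerD//.
apply: (le_trans (bounded_abs hi _)).
have := uv t tT; rewrite weight_le// => h2.
apply: (@le_trans _ _ (`|ki| * (q * t `^ (nu - 1)))); first by rewrite ler_wpM2l.
move: qe; rewrite ler_pdivlMr// => qe.
lra.
Qed.

End LinearProblem.

(** * Boundedness of the solution operator *)

Section Shift.
Context {R : realType} {E : normedModType R}.
Implicit Types (v d : R -> E) (T c e : R).

Lemma cont_on_lipschitz T v L : 
  (forall s t : R, 0 < s <= T -> 0 < t <= T -> `|v s - v t| <= L * `|s - t|) ->
  cont_on T v.
Proof.
move=> h t e tT e0.
have L0 : 0 < `|L| + 1 by rewrite ltr_wpDl.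
exists (e / (`|L| + 1)); first by rewrite divr_gt0.
move=> s sT; rewrite ltr_pdivlMr// => st; apply: (le_trans (h s t sT tT)).
have := ler_norm L; have := normr_ge0 (s - t); nra.
Qed.

(** This is the uniqueness of antiderivatives. *)
Lemma der0_cst T v x : der_on T v (fun=> 0) -> starts_at T v x ->
  forall t : R, 0 < t <= T -> v t = x.
Proof.
move=> hv hx t tT.
have h0 : wbound 1 T (fun=> 0 : E) 0 by move=> s _; rewrite normr0 mulr0.
have h1 : (0 : R) < 1 <= (1 : R) by lra.
have := starts_at_bound h1 (lexx 0) (der_on_mean hv) h0 hx tT.
by rewrite mulr0 mul0r normr_le0 subr_eq0 => /eqP.
Qed.

Lemma der_on_zero T v d : der_on T v d -> (forall t : R, 0 < t <= T -> v t = 0) ->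
  forall t : R, 0 < t <= T -> d t = 0.
Proof.
move=> hv h0 t tT; apply/eqP; rewrite -normr_le0; apply: ler_eps_pos => e e0.
have [r r0 hr] := hv t e tT e0; have t0 : 0 < t by case/andP: tT.
pose q := Num.min (r / 2) (t / 2).
have q0 : 0 < q by rewrite lt_min; lra.
have [q1 q2] : q <= r / 2 /\ q <= t / 2 by rewrite /q !ge_min !lexx orbT.
have sT : 0 < t - q <= T by lra.
have := hr (t - q) sT; rewrite !h0// subrr sub0r normrN normrZ.
have -> : `|t - q - t| = q by rewrite addrAC subrr sub0r normrN gtr0_norm.
by rewrite mulrC add0r => /(_ ltac:(lra)); rewrite ler_pM2r.
Qed.

Definition delay c v (t : R) : E := if t <= c then 0 else v (t - c).

Lemma delay_cont T c v : 0 <= c -> cont_on (T - c) v -> starts_at (T - c) v 0 ->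
  cont_on T (delay c v).
Proof.
move=> c0 hv h0 t e tT e0; rewrite /delay.
case: (ltgtP t c) => tc.
- exists (c - t); first by lra.
  move=> s sT; rewrite ltr_distl => sc.
  by have -> : s <= c by [lra]; rewrite subrr normr0 ltW.
- have [r r0 hr] := hv (t - c) e ltac:(lra) e0.
  exists (Num.min r (t - c)); first by rewrite lt_min r0; lra.
  move=> s sT; rewrite lt_min => /andP[sr]; rewrite ltr_distl => sc.
  have [|sc2] := leP s c; first by lra.
  by apply: hr; [lra | rewrite opprB addrA subrK].
- have [r r0 hr] := h0 e e0; exists r => // s sT; rewrite ltr_distl => sr.
  have [sc|sc] := leP s c; first by rewrite subrr normr0 ltW.
  by apply: hr; lra.
Qed.

Lemma delay_der T c v d : 0 <= c -> der_on (T - c) v d ->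
  starts_at (T - c) v 0 -> starts_at (T - c) d 0 ->
  der_on T (delay c v) (delay c d).
Proof.
move=> c0 hv h0 d0 t e tT e0; rewrite /delay.
case: (ltgtP t c) => tc.
- exists (c - t); first by lra.
  move=> s sT; rewrite ltr_distl => sc.
  have -> : s <= c by lra.
  by rewrite scaler0 !subrr normr0 mulr_ge0// ltW.
- have [r r0 hr] := hv (t - c) e ltac:(lra) e0.
  exists (Num.min r (t - c)); first by rewrite lt_min r0; lra.
  move=> s sT; rewrite lt_min => /andP[sr]; rewrite ltr_distl => sc.
  have [|sc2] := leP s c; first by lra.
  have -> : s - t = (s - c) - (t - c) by ring.
  by apply: hr; [lra | rewrite opprB addrA subrK].
- have [r r0 hr] := d0 e e0; exists r => // s sT; rewrite ltr_distl => sr.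
  rewrite scaler0 !subr0.
  have [sc|sc] := leP s c; first by rewrite normr0 mulr_ge0// ltW.
  have -> : `|s - t| = s - c by rewrite tc ger0_norm// subr_ge0 ltW.
  apply: ler_eps_pos => q q0; have [r' r'0 hr'] := h0 q q0.
  pose p := Num.min r' ((s - c) / 2).
  have p0 : 0 < p by rewrite lt_min r'0; lra.
  have [p1 p2] : p <= r' /\ p <= (s - c) / 2 by rewrite /p !ge_min !lexx orbT.
  have hp := hr' p ltac:(lra) p1; rewrite subr0 in hp.
  have := der_on_mean hv p0 (_ : p <= s - c) (_ : s - c <= T - c) (e := 0) (w := e).
  rewrite scaler0 subr0 => /(_ ltac:(lra) ltac:(lra)) => h.
  have {}h : `|v (s - c) - v p| <= e * (s - c - p).
    by apply: h => x xx; apply: hr; lra.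
  have -> : v (s - c) = (v (s - c) - v p) + v p by rewrite subrK.
  by apply: (le_trans (ler_normD _ _)); nra.
Qed.

End Shift.

Section ClosedGraph.
Context {R : realType} {E0 E1 : completeNormedModType R}.
Variables (i B : {linear E1 -> E0}) (ki kB : R).
Hypothesis hi : forall b, `|i b| <= ki * `|b|.
Hypothesis hB : forall b, `|B b| <= kB * `|b|.
Variables (mu T : R).
Hypothesis hmu : 0 < mu < 1.
Hypothesis solvable : forall f, in_BC mu T f -> exists u, solves i B mu T f 0 u.
Hypothesis uniqueness : forall u, solves i B mu T (fun=> 0) 0 u ->
  forall t : R, 0 < t <= T -> u t = 0.

Let mu1 : mu < 1. Proof. by case/andP: hmu. Qed.

Definition bounded_data (M : R) (f : R -> E0) :=
  in_BC mu T f /\ exists u, solves i B mu T f 0 u /\ wbound mu T u M.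

Lemma in_BCB (E : normedModType R) (f g : R -> E) : in_BC mu T f -> in_BC mu T g ->
  in_BC mu T (fun t => f t - g t).
Proof.
move=> hf hg; apply: in_BC_eq (in_BC_lin (-1) hf hg) => t _.
by rewrite scaleN1r.
Qed.

Lemma wboundB (E : normedModType R) (f g : R -> E) M N : wbound mu T f M -> wbound mu T g N ->
  wbound mu T (fun t => f t - g t) (M + N).
Proof.
move=> hf hg t tT; have := wbound_lin (-1) hf hg tT.
by rewrite normrN1 mul1r scaleN1r.
Qed.

Lemma wboundD (E : normedModType R) (f g : R -> E) M N : wbound mu T f M -> wbound mu T g N ->
  wbound mu T (fun t => f t + g t) (M + N).
Proof.
move=> hf hg t tT; have := wbound_lin 1 hf hg tT.
by rewrite normr1 mul1r scale1r.
Qed.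

Lemma wbound_eq (E : normedModType R) (f g : R -> E) M : (forall t, f t = g t) ->
  wbound mu T f M -> wbound mu T g M.
Proof. by move=> h hf t tT; rewrite -h; apply: hf. Qed.

(** Baire's argument: otherwise one could choose nested balls, the n-th one
    avoiding all data whose solutions are bounded by n, and the solution for the
    common point of these balls would have no finite bound. *)
Lemma bounded_data_dense : exists (n : nat) (f0 : R -> E0) (r : R),
  [/\ in_BC mu T f0, 0 < r & forall f, in_BC mu T f ->
      wbound mu T (fun t => f t - f0 t) r -> forall e : R, 0 < e ->
      exists g, bounded_data n%:R g /\ wbound mu T (fun t => f t - g t) e].
Proof.
apply: contrapT => neg.
have next : forall p : nat * ((R -> E0) * R), exists q : (R -> E0) * R,
    in_BC mu T p.2.1 -> 0 < p.2.2 ->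
    [/\ in_BC mu T q.1, 0 < q.2, q.2 <= p.2.2 / 2,
        wbound mu T (fun t => q.1 t - p.2.1 t) (p.2.2 / 2) &
        forall g, bounded_data p.1%:R g -> ~ wbound mu T (fun t => q.1 t - g t) q.2].
  move=> [n [f0 r]] /=.
  have [[hf0 r0]|nh] := pselect (in_BC mu T f0 /\ 0 < r); last first.
    by exists (f0, r) => h1 h2; case: nh.
  have [f [hf [ff [e [e0 he]]]]] : exists f, in_BC mu T f /\
      (wbound mu T (fun t => f t - f0 t) (r / 2) /\ exists e : R, 0 < e /\
      forall g, bounded_data n%:R g -> ~ wbound mu T (fun t => f t - g t) e).
    apply: contrapT => nf; apply: neg; exists n, f0, (r / 2); split=> //.
      by lra.
    move=> f hf ff e e0; apply: contrapT => ng; apply: nf.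
    exists f; split=> //; split=> //; exists e; split=> // g hg hw.
    by apply: ng; exists g.
  exists (f, Num.min e (r / 2)) => _ _ /=; split=> //.
  - by rewrite lt_min e0; lra.
  - by rewrite ge_min lexx orbT.
  - move=> g /he h hw; apply: h; apply: wboundW hw; by rewrite ge_min lexx.
have [step hstep] := choice next.
pose s := fix s n := if n is n'.+1 then step (n', s n') else ((fun=> 0) : R -> E0, 1 : R).
have inv n : in_BC mu T (s n).1 /\ 0 < (s n).2.
  elim: n => [|n [h1 h2]] /=; last by have [] := hstep (n, s n) h1 h2.
  by split=> //; exact: in_BC_cst.
have st n : [/\ (s n.+1).2 <= (s n).2 / 2,
      wbound mu T (fun t => (s n.+1).1 t - (s n).1 t) ((s n).2 / 2) &
      forall g, bounded_data n%:R g -> ~ wbound mu T (fun t => (s n.+1).1 t - g t) (s n.+1).2].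
  by have [h1 h2] := inv n; have [] := hstep (n, s n) h1 h2.
have rn n : (s n).2 <= 1 / 2 ^+ n.
  elim: n => [|n IH]; first by rewrite expr0 divr1.
  have [h _ _] := st n; apply: (le_trans h); rewrite exprS invfM mulrCA [leRHS]mulrC.
  by rewrite ler_pM2r.
have [f [hf lim]] : exists f, in_BC mu T f /\
    forall n, wbound mu T (fun t => f t - (s n).1 t) (2 * (1 / 2) / 2 ^+ n).
  apply: weighted_complete => n; first by have [] := inv n.
  have [_ h _] := st n; apply: wboundW h.
  by rewrite [leLHS]mulrC mulrAC mulrC [leRHS]mulrC mul1r mulrC ler_pM2l ?invr_gt0//;
     have := rn n; rewrite mul1r.
have nest n k : wbound mu T (fun t => (s (n + k)%N).1 t - (s n).1 t) ((s n).2 - (s (n + k)%N).2).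
  elim: k => [|k IH].
    by move=> t tT; rewrite addn0 !subrr normr0 mulr0.
  rewrite addnS; have [h1 h2 _] := st (n + k)%N.
  apply: (@wboundW _ _ _ _ _ ((s (n + k)%N).2 / 2 + ((s n).2 - (s (n + k)%N).2))); first by lra.
  by apply: wbound_eq (wboundD h2 IH) => t; module_ring R.
have ball n : wbound mu T (fun t => f t - (s n).1 t) (s n).2.
  move=> t tT; apply: ler_eps_pos => e e0.
  have [k hk] := geometric_small (2 * (1 / 2)) e0.
  have ek : 2 * (1 / 2) / 2 ^+ (n + k) <= e.
    have a0 : (0 : R) < 2 * (1 / 2) by lra.
    apply: le_trans hk; rewrite ler_pM2l// lef_pV2 ?posrE ?exprn_gt0//.
    by rewrite ler_weXn2l ?leq_addl// ler1n.
  have := wboundD (lim (n + k)%N) (nest n k) tT.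
  have -> : f t - (s (n + k)%N).1 t + ((s (n + k)%N).1 t - (s n).1 t) = f t - (s n).1 t.
    by module_ring R.
  by have [_ h] := inv (n + k)%N; lra.
have [u hu] := solvable hf; have [_ [M hM] _] := let: And3 a b c := hu in a.
pose n := (Num.truncn M).+1.
have [_ _ h] := st n; apply: (h f).
  by split=> //; exists u; split=> //; apply: wboundW hM; apply: ltW; apply: truncnS_gt.
move=> t tT; have := ball n.+1 t tT; rewrite -[in X in X -> _]normrN.
by rewrite opprB.
Qed.

(** The closed graph theorem for the solution operator.  By bounded_data_dense
    all data are approximated, up to half of their norm, by data with controlled
    solutions; iterating on the remainders gives a convergent series of
    solutions, whose sum is the solution by closedness and uniqueness. *)
Lemma solution_bound : exists2 C : R, 0 < C & forall f u M,
  solves i B mu T f 0 u -> in_BC mu T f -> wbound mu T f M -> wbound mu T u (C * M).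
Proof.
have [n0 [f0 [r [hf0 r0 dens]]]] := bounded_data_dense.
pose c : R := (2 * (n0%:R + 1)) / r.
have c0 : 0 < c by rewrite divr_gt0// mulr_gt0// ltr_wpDl.
(* differences of two approximable data fill a ball around 0 *)
have small f M : 0 < M -> in_BC mu T f -> wbound mu T f M ->
    exists p : (R -> E0) * (R -> E1), [/\ in_BC mu T p.1, solves i B mu T p.1 0 p.2,
      wbound mu T p.2 (c * M) & wbound mu T (fun t => f t - p.1 t) (M / 2)].
  move=> M0 hf fM.
  pose k := r / M; have k0 : 0 < k by rewrite divr_gt0.
  pose f1 t := f0 t + k *: f t.
  have e0 : 0 < k * M / 4 by rewrite divr_gt0// mulr_gt0.
  have f1r : wbound mu T (fun t => f1 t - f0 t) r.
    move=> t tT; rewrite /f1 addrAC subrr add0r normrZ gtr0_norm// mulrCA.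
    apply: (@le_trans _ _ (k * M)); first by rewrite ler_pM2l// fM.
    by rewrite /k divfK// gt_eqF.
  have [g1 [[hg1 [u1 [s1 b1]]] d1]] := dens f1 (in_BC_lin k hf0 hf) f1r _ e0.
  have f0r : wbound mu T (fun t => f0 t - f0 t) r.
    by move=> t tT; rewrite subrr normr0 mulr0 ltW.
  have [g2 [[hg2 [u2 [s2 b2]]] d2]] := dens f0 hf0 f0r _ e0.
  exists (fun t => k^-1 *: (g1 t - g2 t), fun t => k^-1 *: (u1 t - u2 t)); split=> /=.
  - apply: in_BC_eq (in_BC_lin k^-1 (in_BCB hf0 hf0) (in_BCB hg1 hg2)) => t _.
    by rewrite subrr add0r.
  - have := solvesZ k^-1 mu1 (solvesB s1 s2).
    by rewrite subr0 scaler0.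
  - move=> t tT; rewrite normrZ gtr0_norm ?invr_gt0// mulrCA.
    have := wboundB b1 b2 tT.
    have -> : c * M = k^-1 * (2 * (n0%:R + 1)) by rewrite /c /k; field; rewrite !gt_eqF.
    rewrite ler_pM2l ?invr_gt0// => /le_trans; apply; lra.
  - move=> t tT.
    have -> : f t - k^-1 *: (g1 t - g2 t) = k^-1 *: ((f1 t - g1 t) - (f0 t - g2 t)).
      rewrite /f1 -[f t in LHS]scale1r -(mulVf (lt0r_neq0 k0)).
      by module_ring R.
    rewrite normrZ gtr0_norm ?invr_gt0// mulrCA.
    have := wboundB d1 d2 tT.
    have -> : k * M / 4 + k * M / 4 = k * (M / 2) by field.
    by rewrite ler_pdivrMl.
exists (2 * c); first by rewrite mulr_gt0.
move=> f u M hu hf fM.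
suff main N : M <= N -> 0 < N -> wbound mu T u (2 * c * N).
  move=> t tT; have M0 : 0 <= M.
    by apply: le_trans (fM t tT); rewrite mulr_ge0// powR_ge0.
  apply: ler_eps_pos => e e0.
  have e1 : 0 < e / (2 * c) by rewrite divr_gt0// mulr_gt0.
  have := main (M + e / (2 * c)) ltac:(lra) ltac:(lra) t tT.
  suff -> : 2 * c * (M + e / (2 * c)) = 2 * c * M + e by [].
  by field; rewrite gt_eqF.
move=> MN N0.
have next : forall p : R * (R -> E0), exists q : (R -> E0) * (R -> E1),
   0 < p.1 -> in_BC mu T p.2 -> wbound mu T p.2 p.1 ->
   [/\ in_BC mu T q.1, solves i B mu T q.1 0 q.2,
      wbound mu T q.2 (c * p.1) & wbound mu T (fun t => p.2 t - q.1 t) (p.1 / 2)].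
  move=> [m g] /=; have [[m0 hg gm]|nh] := pselect [/\ 0 < m, in_BC mu T g & wbound mu T g m].
    by have [q hq] := small g m m0 hg gm; exists q.
  by exists (g, fun=> 0) => h1 h2 h3; case: nh.
have [step hstep] := choice next.
(* s n = (g, v) where v solves the problem with data g, and g --> f *)
pose s := fix s n : (R -> E0) * (R -> E1) := if n is n'.+1 then
    let q := step (N / 2 ^+ n', fun t => f t - (s n').1 t) in
    (fun t => (s n').1 t + q.1 t, fun t => (s n').2 t + q.2 t)
  else (fun=> 0, fun=> 0).
have Nn n : 0 < N / 2 ^+ n by rewrite divr_gt0// exprn_gt0.
have zero_BC : in_BC mu T (fun=> 0 : E0).
  by apply: in_BC_eq (in_BCB hf hf) => t _; rewrite subrr.
have inv n : [/\ in_BC mu T (s n).1, solves i B mu T (s n).1 0 (s n).2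
     & wbound mu T (fun t => f t - (s n).1 t) (N / 2 ^+ n)].
  elim: n => [|n [h1 h2 h3]] /=.
    split=> //; first exact: solves0.
    by move=> t tT; rewrite subr0 expr0 divr1; apply: (le_trans (fM t tT)).
  have [q1 q2 q3 q4] := hstep (N / 2 ^+ n, fun t => f t - (s n).1 t) (Nn n) (in_BCB hf h1) h3.
  move: q1 q2 q4; set q := step _ => /= q1 q2 q4; split.
  - by apply: in_BC_eq (in_BC_lin 1 h1 q1) => t _; rewrite scale1r.
  - by have := solvesD h2 q2; rewrite addr0.
  - rewrite exprS invfM mulrA [N / 2 / _]mulrAC; apply: wbound_eq q4 => t.
    by module_ring R.
have incr n : wbound mu T (fun t => (s n.+1).2 t - (s n).2 t) (c * N / 2 ^+ n).
  have [h1 h2 h3] := inv n.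
  have [q1 q2 q3 q4] := hstep (N / 2 ^+ n, fun t => f t - (s n).1 t) (Nn n) (in_BCB hf h1) h3.
  by rewrite -mulrA; apply: wbound_eq q3 => t /=; rewrite addrAC subrr add0r.
have [v [hv lim]] : exists v, in_BC mu T v /\
    forall n, wbound mu T (fun t => v t - (s n).2 t) (2 * (c * N) / 2 ^+ n).
  by apply: weighted_complete => // n; have [_ []] := inv n.
have hmu' : 0 < mu <= 1 by move: hmu; lra.
have fv : solves i B mu T f 0 v.
  apply: (solves_closed hi hB hmu' hf) => e e0.
  have [n hn] := geometric_small (2 * (c * N) + N) e0.
  have cN : 0 < c * N by rewrite mulr_gt0.
  have [h1 h2 h3] := inv n; exists (s n).1, (s n).2; split=> //.
    apply: wboundW h3; apply: le_trans hn.
    by rewrite ler_pM2r ?invr_gt0 ?exprn_gt0// lerDr mulr_ge0// ltW.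
  apply: wboundW (lim n); apply: le_trans hn.
  by rewrite ler_pM2r ?invr_gt0 ?exprn_gt0// lerDl ltW.
have uv t : 0 < t <= T -> u t = v t.
  move=> tT; apply/eqP; rewrite -subr_eq0; apply/eqP.
  apply: (uniqueness (u := fun t => u t - v t)) tT.
  have := solvesB hu fv; rewrite subrr; apply: solves_eq => s' _.
  by rewrite subrr.
move=> t tT; rewrite uv//; have := lim 0%N t tT.
by rewrite subr0 expr0 divr1 mulrA.
Qed.

End ClosedGraph.

(** * Causality and smoothing *)

Lemma min_dist {R : realType} (a b t : R) :
  `|Num.min a t - Num.min b t| <= `|a - b|.
Proof.
have := ler_norm (a - b); have := ler_norm (b - a); rewrite (distrC b a).
set d := `|a - b|; rewrite ler_distl.
by case: (leP a t); case: (leP b t) => *; lra.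
Qed.

Lemma max_dist {R : realType} (a b t : R) :
  `|Num.max a t - Num.max b t| <= `|a - b|.
Proof.
have := ler_norm (a - b); have := ler_norm (b - a); rewrite (distrC b a).
set d := `|a - b|; rewrite ler_distl.
by case: (leP a t); case: (leP b t) => *; lra.
Qed.

Section Causality.
Context {R : realType} {E0 E1 : completeNormedModType R}.
Variables (i B : {linear E1 -> E0}) (ki kB : R).
Hypothesis hi : forall b, `|i b| <= ki * `|b|.
Hypothesis hB : forall b, `|B b| <= kB * `|b|.
Variables (mu T : R).
Hypothesis hmu : 0 < mu < 1.
Hypothesis T0 : 0 < T.
Hypothesis solvable : forall f, in_BC mu T f -> exists u, solves i B mu T f 0 u.
Hypothesis uniqueness : forall u, solves i B mu T (fun=> 0) 0 u ->
  forall t : R, 0 < t <= T -> u t = 0.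

Let mu1 : mu < 1. Proof. by case/andP: hmu. Qed.
Let mu01 : 0 < mu <= 1. Proof. by move: hmu; lra. Qed.

(** Integrating (i u)' + B u = 0 shows that i u + B W is constant, where W is the
    primitive of u. *)
Lemma solution_primitive t x u : 0 < t -> solves i B mu t (fun=> 0) x u ->
  exists W, [/\ der_on t W u, starts_at t W 0, exists M, wbound mu t u M
    & forall s : R, 0 < s <= t -> i (u s) = x - B (W s)].
Proof.
move=> t0 [hu du xu].
have [W [hW W0]] := antiderivative mu01 hu.
have dW : der_on t W u by apply: mean_der_on => //; case: hu.
exists W; split=> //; first by case: hu.
have d : der_on t (fun s => i (u s) + B (W s)) (fun=> 0).
  apply: der_on_eq (der_on_lin 1 du (der_on_bounded hB dW)) => s _.
    by rewrite scale1r.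
  by rewrite scale1r sub0r addrC subrr.
have st : starts_at t (fun s => i (u s) + B (W s)) x.
  have := starts_at_lin 1 xu (starts_at_bounded hB W0).
  rewrite linear0 scaler0 addr0; apply: starts_at_eq => s _.
  by rewrite scale1r.
by move=> s sT; rewrite -(der0_cst d st sT) addrK.
Qed.

Lemma primitive_bound t (W u : R -> E1) M : 0 < t -> der_on t W u -> starts_at t W 0 ->
  wbound mu t u M -> forall s : R, 0 < s <= t -> `|W s| <= dyadic_const mu * `|M| * t `^ mu.
Proof.
move=> t0 dW W0 uM s st.
have uM' : wbound mu t u `|M| by apply: wboundW uM; exact: ler_norm.
have := starts_at_bound mu01 (normr_ge0 M) (der_on_mean dW) uM' W0 st.
rewrite subr0 => /le_trans; apply; rewrite ler_wpM2l ?powR_mono//; try lra.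
  by rewrite mulr_ge0// ltW// dyadic_const_gt0//; move: hmu; lra.
by move: hmu; lra.
Qed.

(** A solution with zero data on a short interval may not extend to ]0, T],
    but its primitive W, delayed by T - t, does so by zero on the left. *)
Lemma uniqueness_sub t u : 0 < t <= T -> solves i B mu t (fun=> 0) 0 u ->
  forall s : R, 0 < s <= t -> u s = 0.
Proof.
move=> /andP[t0 tT] hu; have [_ _ u0] := hu.
have [W [dW W0 [M uM] iu]] := solution_primitive t0 hu.
pose c := T - t.
have cT : T - c = t by rewrite /c; ring.
have c0 : 0 <= c by rewrite subr_ge0.
have iu' s : 0 < s <= t -> i (u s) = - B (W s) by move=> st; rewrite iu// sub0r.
have hZ : solves i B mu T (fun=> 0) 0 (delay c W).
  split.
  - apply: (@in_BC_bounded _ _ _ _ _ (dyadic_const mu * `|M| * t `^ mu)) => //.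
      by apply: delay_cont; rewrite ?cT//; apply: der_on_cont dW.
    move=> s sT; rewrite /delay; have [sc|sc] := leP s c.
      rewrite normr0 !mulr_ge0 ?powR_ge0// ?invr_ge0 ?subr_ge0//.
      by apply: ltW; apply: half_powR_lt1; move: hmu; lra.
    by apply: (primitive_bound t0 dW W0 uM); lra.
  - have := @delay_der _ _ T c (fun s => i (W s)) (fun s => i (u s)) c0.
    rewrite cT => /(_ (der_on_bounded hi dW)).
    have := starts_at_bounded hi W0; rewrite linear0 => iW0 /(_ iW0 u0).
    apply: der_on_eq => s sT; rewrite /delay; have [sc|sc] := leP s c.
    + by rewrite linear0.
    + by [].
    + by rewrite linear0 subr0.
    + by rewrite iu' ?sub0r// -cT; lra.
  - move=> e e0; have [r r0 hr] := starts_at_bounded hi W0 e0.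
    rewrite linear0 in hr.
    exists r => // s sT sr; rewrite /delay; have [sc|sc] := leP s c.
      by rewrite linear0 subrr normr0 ltW.
    by apply: hr; rewrite -?cT; lra.
have Z0 := uniqueness hZ.
have Wz s : 0 < s <= t -> W s = 0.
  move=> st; have sc : 0 < s + c <= T by rewrite /c; lra.
  have := Z0 (s + c) sc.
  have -> : delay c W (s + c) = W s.
    rewrite /delay addrK; have -> // : (s + c <= c) = false.
    by apply/negbTE; rewrite -ltNge; lra.
  by [].
exact: der_on_zero dW Wz.
Qed.

(** The factor t / s past t keeps the weighted norm from growing, and writing it
    with min and max makes the function visibly continuous. *)
Definition extend_data (t : R) (f : R -> E0) (s : R) : E0 :=
  f (Num.min s t) + (t / Num.max s t - 1) *: f t.

Lemma extend_dataE t f s : s <= t -> 0 < t -> extend_data t f s = f s.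
Proof.
move=> st t0; rewrite /extend_data min_l// max_r// mulfV ?gt_eqF//.
by rewrite subrr scale0r addr0.
Qed.

Lemma extend_dataE2 t f s : t <= s -> extend_data t f s = (t / s) *: f t.
Proof.
move=> ts; rewrite /extend_data min_r// max_l//; by module_ring R.
Qed.

Lemma extend_data_wbound t f M : 0 < t <= T -> wbound mu t f M ->
  wbound mu T (extend_data t f) M.
Proof.
move=> /andP[t0 tT] fM s /andP[s0 sT]; have [st|ts] := leP s t.
  by rewrite extend_dataE//; apply: fM; rewrite s0.
rewrite extend_dataE2 ?(ltW ts)// normrZ gtr0_norm ?divr_gt0//.
have -> : s `^ (1 - mu) = s * s `^ (- mu).
  by rewrite -[X in _ = X * _]powRr1 ?(ltW s0)// -powR_split.
have -> : s * s `^ (- mu) * (t / s * `|f t|) = s `^ (- mu) * t * `|f t|.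
  by field; rewrite gt_eqF.
apply: (@le_trans _ _ (t `^ (1 - mu) * `|f t|)); last by apply: fM; rewrite t0 lexx.
rewrite ler_wpM2r//.
have -> : t `^ (1 - mu) = t `^ (- mu) * t.
  by rewrite -[X in _ = _ * X]powRr1 ?(ltW t0)// -powR_split// addrC.
rewrite ler_pM2r//; apply: powR_anti => //; last exact: ltW.
by move: hmu; lra.
Qed.

Lemma extend_data_BC t f : 0 < t <= T -> in_BC mu t f -> in_BC mu T (extend_data t f).
Proof.
move=> tT' [fc [M fM] f0]; have /andP[t0 tT] := tT'; split.
- apply: (@cont_on_eq _ _ _ (fun s => f (Num.min s t) + 1 *: ((t / Num.max s t - 1) *: f t))).
    by move=> s _; rewrite scale1r.
  apply: cont_on_lin.
    move=> s e /andP[s0 sT] e0.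
    have mint q : 0 < q -> 0 < Num.min q t <= t.
      by move=> q0; rewrite lt_min q0 t0 ge_min lexx orbT.
    have [r r0 hr] := fc (Num.min s t) e (mint s s0) e0.
    exists r => // q /andP[q0 qT] qs; apply: hr; first exact: mint.
    apply: le_lt_trans qs.
    exact: min_dist.
  apply: (@cont_on_lipschitz _ _ _ _ (t^-1 * `|f t|)) => s q /andP[s0 sT] /andP[q0 qT].
  have -> : (t / Num.max s t - 1) *: f t - (t / Num.max q t - 1) *: f t
      = (t / Num.max s t - t / Num.max q t) *: f t by module_ring R.
  rewrite normrZ mulrAC ler_wpM2r//.
  set a := Num.max s t; set b := Num.max q t.
  have ta : t <= a by rewrite le_max lexx orbT.
  have tb : t <= b by rewrite le_max lexx orbT.
  have a0 : 0 < a by lra.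
  have b0 : 0 < b by lra.
  have -> : t / a - t / b = (b - a) * (t / (a * b)) by field; rewrite !gt_eqF.
  have ab : `|b - a| <= `|s - q|.
    by rewrite distrC; exact: max_dist.
  have tab : 0 < t / (a * b) by rewrite divr_gt0// mulr_gt0.
  rewrite normrM mulrC (gtr0_norm tab); apply: ler_pM => //; first exact: ltW.
  rewrite ler_pdivrMr ?mulr_gt0// ler_pdivlMl//.
  by apply: ler_pM => //; exact: ltW.
- by exists M; apply: extend_data_wbound.
- move=> e e0; have [r r0 hr] := f0 e e0.
  exists (Num.min r t); first by rewrite lt_min r0.
  move=> s /andP[s0 sT]; rewrite le_min => /andP[sr st].
  by rewrite extend_dataE// hr// s0.
Qed.

Lemma solvable_sub t f : 0 < t <= T -> in_BC mu t f ->
  exists u, solves i B mu t f 0 u.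
Proof.
move=> tT hf; have [u hu] := solvable (extend_data_BC tT hf).
have /andP[t0 tT'] := tT.
exists u; apply: solves_eq (solves_sub tT' hu) => s /andP[s0 st].
by rewrite extend_dataE.
Qed.

(** Replace the data after t by a continuation of the same norm; by uniqueness
    on ]0, t] the solution does not change there. *)
Lemma causal_bound : exists2 C : R, 0 < C & forall t f u M, 0 < t <= T ->
  solves i B mu t f 0 u -> in_BC mu t f -> wbound mu t f M -> wbound mu t u (C * M).
Proof.
have [C C0 hC] := solution_bound hi hB hmu solvable uniqueness.
exists C => // t f u M tT hu hf fM; have /andP[t0 tT'] := tT.
have [v hv] := solvable (extend_data_BC tT hf).
have vM := hC _ _ _ hv (extend_data_BC tT hf) (extend_data_wbound tT fM).
have uv : solves i B mu t (fun=> 0) 0 (fun s => u s - v s).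
  have := solvesB hu (solves_sub tT' hv); rewrite subrr; apply: solves_eq => s /andP[s0 st].
  by rewrite extend_dataE// subrr.
move=> s st; have /eqP := uniqueness_sub tT uv st; rewrite subr_eq0 => /eqP ->.
by apply: vM; lra.
Qed.

(** A smaller blow-up rate nu - 1 > mu - 1 of the data is inherited by the
    solution, since s^(nu-mu) is increasing: apply the bound on ]0, s]. *)
Lemma causal_bound_weight : exists2 C : R, 0 < C & forall nu t f u, mu <= nu < 1 ->
  0 < t <= T -> solves i B mu t f 0 u -> in_BC nu t f ->
  solves i B nu t f 0 u /\ forall M, wbound nu t f M -> wbound nu t u (C * M).
Proof.
have [C C0 hC] := causal_bound; exists C => // nu t f u /andP[mn n1] /andP[t0 tT] hu hf.
have hf' : in_BC mu t f by apply: in_BC_weight hf => //; lra.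
have pt M s : 0 < s <= t -> (forall r : R, 0 < r <= s -> r `^ (1 - nu) * `|f r| <= M) ->
    s `^ (1 - nu) * `|u s| <= C * M.
  move=> /andP[s0 st] fM.
  have h := hC s f u (s `^ (nu - mu) * M) ltac:(lra) (solves_sub st hu)
    (in_BC_sub st hf') (wbound_weight mn (ltW s0) fM) s ltac:(lra).
  by move: h; rewrite (weight_mono _ mn s0) [leRHS]mulrCA ler_pM2l// powR_gt0.
have bd M : wbound nu t f M -> wbound nu t u (C * M).
  by move=> fM s st; apply: pt => // r rs; apply: fM; lra.
split=> //; have [[uc _ _] du u0] := hu; split=> //; split=> //.
  by have [_ [M fM] _] := hf; exists (C * M); apply: bd.
move=> e e0; have [_ _ f0] := hf; have [r r0 hr] := f0 (e / C) ltac:(by rewrite divr_gt0).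
exists r => // s st sr; have -> : e = C * (e / C) by rewrite mulrC divfK// gt_eqF.
by apply: pt => // q qs; apply: hr; lra.
Qed.

(** The primitive W of u solves W' + B W = x, W(0) = 0, which bounds i u = W' by
    |x|; then t u solves the problem with data i u and zero initial value, which
    bounds t u in E1 by |x|.  For semigroups this is analyticity. *)
Lemma homogeneous_bound0 : exists2 C : R, 0 < C & forall x u,
  solves i B mu T (fun=> 0) x u -> forall t : R, 0 < t <= T ->
  `|i (u t)| <= C * `|x| /\ t * `|u t| <= C * `|x|.
Proof.
have [C C0 hC] := causal_bound.
pose K := 1 + `|kB| * C.
have K1 : 1 <= K by rewrite lerDl mulr_ge0// ltW.
exists (K + C * K) => [|x u hu t /andP[t0 tT]].
  by have : 0 < C * K by [apply: mulr_gt0 => //; lra]; lra.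
have [W [dW W0 [M uM] iu]] := solution_primitive T0 hu.
have cstBC s (y : E0) : in_BC mu s (fun=> y) by exact: in_BC_cst.
have hW : solves i B mu T (fun=> x) 0 W.
  split.
  - apply: (@in_BC_bounded _ _ _ _ _ (dyadic_const mu * `|M| * T `^ mu)) => //.
      exact: der_on_cont dW.
    exact: (primitive_bound T0 dW W0 uM).
  - by apply: der_on_eq (der_on_bounded hi dW) => // s sT; apply: iu.
  - by have := starts_at_bounded hi W0; rewrite linear0.
have Wb s : 0 < s <= T -> `|W s| <= C * `|x|.
  move=> /andP[s0 sT].
  have xb : wbound mu s (fun=> x) (s `^ (1 - mu) * `|x|).
    move=> r rs; rewrite ler_wpM2r// powR_mono//; last by lra.
      by move: hmu; lra.
    by lra.
  have := hC s (fun=> x) W _ ltac:(lra) (solves_sub sT hW) (cstBC _ _) xb s ltac:(lra).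
  by rewrite [leRHS]mulrCA ler_pM2l// powR_gt0.
have ib s : 0 < s <= T -> `|i (u s)| <= K * `|x|.
  move=> sT; rewrite iu//; apply: (le_trans (ler_normB _ _)).
  rewrite /K mulrDl mul1r lerD2l -mulrA; apply: (le_trans (bounded_abs hB _)).
  by rewrite ler_wpM2l// Wb.
have K0 : 0 <= K * `|x| by rewrite mulr_ge0//; lra.
split; first by apply: (le_trans (ib t _)); [lra | rewrite ler_wpM2r// lerDl mulr_ge0; lra].
have [[uc [N uN] u0] du xu] := hu.
have htu : solves i B mu T (fun s => i (u s)) 0 (fun s => s *: u s).
  split.
  - split.
    + have idc : cont_on T (fun s : R => s : R^o).
        by apply: (@cont_on_lipschitz _ _ _ _ 1) => *; rewrite mul1r.
      apply: (cont_on_dom uc idc) => s /andP[s0 sT].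
      exists (T + `|u s|), 1; split=> // q /andP[q0 qT] _.
      have -> : q *: u q - s *: u s = q *: (u q - u s) + (q - s) *: u s by module_ring R.
      apply: (le_trans (ler_normD _ _)); rewrite !normrZ (gtr0_norm q0).
      rewrite mulrDr; apply: lerD.
        by rewrite ler_wpM2r// ler_wpDr.
      by rewrite mulrC ler_wpM2r// lerDr ltW.
    + exists (T * N) => s sT; rewrite normrZ mulrCA gtr0_norm; last by lra.
      apply: ler_pM; rewrite ?mulr_ge0 ?powR_ge0 ?uN//; lra.
    + move=> e e0; have [r r0 hr] := u0 (e / T) ltac:(by rewrite divr_gt0).
      exists r => // s sT sr; rewrite normrZ mulrCA gtr0_norm; last by lra.
      have -> : e = T * (e / T) by rewrite mulrC divfK// gt_eqF.
      by apply: ler_pM; rewrite ?mulr_ge0 ?powR_ge0 ?hr//; lra.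
  - apply: der_on_eq (der_on_mulid du) => s _; first by rewrite linearZ.
    have -> : B (s *: u s) = s *: B (u s) by rewrite linearZ.
    by module_ring R.
  - move=> e e0; have K2 : 0 < K * `|x| + 1 by lra.
    exists (e / (K * `|x| + 1)); first by rewrite divr_gt0.
    move=> s sT; rewrite ler_pdivlMr// => sr.
    rewrite subr0 linearZ normrZ gtr0_norm; last by lra.
    by apply: le_trans sr; rewrite ler_wpM2l; [| lra |]; have := ib s sT; lra.
have iuBC : in_BC mu T (fun s => i (u s)).
  by apply: (in_BC_bounded_linear hi); case: hu.
have iub : wbound mu t (fun s => i (u s)) (t `^ (1 - mu) * (K * `|x|)).
  move=> s st; apply: ler_pM; rewrite ?powR_ge0 ?ib//; last by lra.
  by apply: powR_mono; move: hmu; lra.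
have := hC t _ _ _ ltac:(lra) (solves_sub tT htu) (in_BC_sub tT iuBC) iub t ltac:(lra).
rewrite [leRHS]mulrCA ler_pM2l ?powR_gt0// normrZ gtr0_norm// => /le_trans; apply.
by rewrite mulrA ler_wpM2r//; lra.
Qed.

(** Here u - b solves the problem with data - B b and zero initial value. *)
Lemma homogeneous_bound1 : exists2 C : R, 0 < C & forall b u,
  solves i B mu T (fun=> 0) (i b) u -> forall t : R, 0 < t <= T ->
  `|u t| <= C * `|b|.
Proof.
have [C C0 hC] := causal_bound.
exists (1 + C * `|kB|) => [|b u hu t /andP[t0 tT]].
  by rewrite ltr_wpDr// mulr_ge0// ltW.
have hb := solves_cst i B T b mu1.
have hd : solves i B mu T (fun=> - B b) 0 (fun s => u s - b).
  have := solvesB hu hb; rewrite subrr; apply: solves_eq => s _.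
  by rewrite sub0r.
have hc : in_BC mu t (fun=> - B b) by exact: in_BC_cst.
have hw : wbound mu t (fun=> - B b) (t `^ (1 - mu) * (`|kB| * `|b|)).
  move=> s st; apply: ler_pM; rewrite ?powR_ge0// ?normrN ?(bounded_abs hB)//.
  by apply: powR_mono; move: hmu; lra.
have := hC t _ _ _ ltac:(lra) (solves_sub tT hd) hc hw t ltac:(lra).
rewrite [leRHS]mulrCA ler_pM2l ?powR_gt0// => h.
have -> : u t = b + (u t - b) by module_ring R.
apply: (le_trans (ler_normD _ _)); rewrite mulrDl mul1r lerD2l.
by rewrite -mulrA.
Qed.

(** Splitting x = (x - i b) + i b, each part at its own rate, bounds the
    solution by the K-functional of x. *)
Lemma homogeneous_split : exists2 C : R, 0 < C & forall x u b,
  solves i B mu T (fun=> 0) x u -> forall t : R, 0 < t <= T ->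
  t * `|u t| <= C * (`|x - i b| + t * `|b|).
Proof.
have [C C0 hC] := homogeneous_bound0; have [D D0 hD] := homogeneous_bound1.
exists (C + D) => [|x u b hu t tT]; first exact: addr_gt0.
have t0 : 0 < t by case/andP: tT.
have cBC : in_BC mu T (fun=> - B b) by exact: in_BC_cst.
have [z hz] := solvable cBC.
have hb := solves_cst i B T b mu1.
have hv : solves i B mu T (fun=> 0) (i b) (fun s => b + z s).
  have := solvesD hb hz; rewrite addr0; apply: solves_eq => s _.
  by rewrite subrr.
have hd : solves i B mu T (fun=> 0) (x - i b) (fun s => u s - (b + z s)).
  by have := solvesB hu hv; apply: solves_eq => s _; rewrite subrr.
have [_ h1] := hC _ _ hd t tT; have h2 := hD _ _ hv t tT.
have -> : u t = (u t - (b + z t)) + (b + z t) by module_ring R.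
apply: (@le_trans _ _ (t * (`|u t - (b + z t)| + `|b + z t|))).
  by rewrite ler_pM2l// ler_normD.
rewrite mulrDr; apply: (le_trans (lerD h1 (ler_wpM2l (ltW t0) h2))).
have a1 : 0 <= D * `|x - i b| by rewrite mulr_ge0// ltW.
have a2 : 0 <= C * (t * `|b|) by rewrite !mulr_ge0// ltW.
lra.
Qed.

End Causality.

(** * The K-functional and change of weight *)

Section KFunctional.
Context {R : realType} {E0 E1 : completeNormedModType R}.
Variables (i : {linear E1 -> E0}) (ki : R).
Hypothesis hi : forall b, `|i b| <= ki * `|b|.
Implicit Types (t th nu m : R) (x y : E0) (b : E1).

Lemma Kfun_le t x b : 0 <= t -> Kfun i t x <= `|x - i b| + t * `|b|.
Proof.
move=> t0; apply: ge_inf; last by exists b.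
by exists 0 => _ [c _ <-]; rewrite addr_ge0// mulr_ge0.
Qed.

Lemma Kfun_ge0 t x : 0 <= t -> 0 <= Kfun i t x.
Proof.
move=> t0; apply: lb_le_inf; first by exists (`|x - i 0| + t * `|0 : E1|); exists 0.
by move=> _ [c _ <-]; rewrite addr_ge0// mulr_ge0.
Qed.

Lemma Kfun_split t x m : 0 <= t -> Kfun i t x < m ->
  exists b, `|x - i b| + t * `|b| < m.
Proof.
move=> t0 h.
have ne : has_inf [set `|x - i b| + t * `|b| | b in [set: E1]].
  split; first by exists (`|x - i 0| + t * `|0 : E1|); exists 0.
  by exists 0 => _ [c _ <-]; rewrite addr_ge0// mulr_ge0.
have [_ [b _ <-] hb] := inf_adherent (eps := m - Kfun i t x) ltac:(by rewrite subr_gt0) ne.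
by exists b; move: hb; rewrite -/(Kfun i t x); lra.
Qed.

Lemma KfunD t x y : 0 <= t -> Kfun i t (x + y) <= Kfun i t x + Kfun i t y.
Proof.
move=> t0; apply: ler_eps_pos => e e0.
have [b hb] := @Kfun_split t x (Kfun i t x + e / 2) t0 ltac:(lra).
have [c hc] := @Kfun_split t y (Kfun i t y + e / 2) t0 ltac:(lra).
apply: (le_trans (Kfun_le (x + y) (b + c) t0)).
have -> : x + y - i (b + c) = (x - i b) + (y - i c).
  by rewrite linearD opprD addrACA.
have h1 := ler_normD (x - i b) (y - i c).
have h2 := ler_wpM2l t0 (ler_normD b c).
lra.
Qed.

Lemma KfunN t x : 0 <= t -> Kfun i t (- x) <= Kfun i t x.
Proof.
move=> t0; apply: ler_eps_pos => e e0.
have [b hb] := @Kfun_split t x (Kfun i t x + e) t0 ltac:(lra).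
apply: (le_trans (Kfun_le (- x) (- b) t0)).
have -> : - x - i (- b) = - (x - i b) by rewrite linearN opprD.
by rewrite !normrN ltW.
Qed.

(** This says that the norm in (E0, E1)_{theta, oo} is at most m; unlike
    interp_norm it has no default value outside that space. *)
Definition interp_le th x m := forall t, 0 < t -> Kfun i t x <= m * t `^ th.

Lemma interp_enorm_le th x m :
  interp_le th x m <-> (interp_enorm i th x <= m%:E)%E.
Proof.
split=> [h|h t t0].
  apply: ge_ereal_sup => _ [t tt <-].
  have t0 : 0 < t by move: tt; rewrite /= in_itv/= andbT.
  rewrite lee_fin powRN mulrC ler_pdivrMr ?powR_gt0//; exact: h.
have : ((t `^ (- th) * Kfun i t x)%:E <= m%:E)%E.
  apply: le_trans h; apply: ereal_sup_ubound; exists t => //=.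
  by rewrite in_itv/= andbT.
by rewrite lee_fin powRN mulrC ler_pdivrMr ?powR_gt0.
Qed.

Lemma interp_enorm_ge0 th x : (0 <= interp_enorm i th x)%E.
Proof.
apply: (@le_trans _ _ ((1 `^ (- th) * Kfun i 1 x)%:E)).
  by rewrite lee_fin mulr_ge0 ?powR_ge0// Kfun_ge0.
apply: ereal_sup_ubound; exists 1 => //=.
by rewrite in_itv/= ltr01.
Qed.

Lemma real_interpP th x : real_interp i th x <-> exists m, interp_le th x m.
Proof.
rewrite /real_interp /=; split=> [h|[m /interp_enorm_le h]]; last first.
  by apply: le_lt_trans h _; rewrite ltry.
have fin : interp_enorm i th x \is a fin_num.
  by rewrite ge0_fin_numE// interp_enorm_ge0.
by exists (fine (interp_enorm i th x)); apply/interp_enorm_le; rewrite fineK.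
Qed.

Lemma interp_le_norm th x : real_interp i th x -> interp_le th x (interp_norm i th x).
Proof.
move=> h; apply/interp_enorm_le; rewrite fineK// ge0_fin_numE//.
exact: interp_enorm_ge0.
Qed.

Lemma interp_norm_le th x m : interp_le th x m -> interp_norm i th x <= m.
Proof.
move=> /interp_enorm_le hm.
rewrite -lee_fin fineK// ge0_fin_numE ?interp_enorm_ge0//.
exact: le_lt_trans hm (ltry _).
Qed.

Lemma cont_interpP th x : cont_interp i th x <->
  (exists m, interp_le th x m) /\
  forall e : R, 0 < e -> exists b, interp_le th (x - i b) e.
Proof.
rewrite /cont_interp/=; split=> [[/real_interpP h1 h2]|[/real_interpP h1 h2]].
  split=> // e e0; have [b hb] := h2 e e0; exists b.
  by apply/interp_enorm_le; exact: ltW.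
split=> // e e0; have [b /interp_enorm_le hb] := h2 (e / 2) ltac:(by rewrite divr_gt0).
by exists b; apply: le_lt_trans hb _; rewrite lte_fin; lra.
Qed.

Lemma interp_leD th x y m m' : interp_le th x m -> interp_le th y m' ->
  interp_le th (x + y) (m + m').
Proof.
move=> h h' t t0; apply: (le_trans (KfunD x y (ltW t0))).
by rewrite mulrDl lerD ?h ?h'.
Qed.

Lemma interp_leN th x m : interp_le th x m -> interp_le th (- x) m.
Proof. by move=> h t t0; apply: (le_trans (KfunN x (ltW t0))); apply: h. Qed.

Lemma interp_leB th x y m m' : interp_le th x m -> interp_le th y m' ->
  interp_le th (x - y) (m + m').
Proof. by move=> h /interp_leN; exact: interp_leD. Qed.

Lemma interp_leW th x m m' : m <= m' -> interp_le th x m -> interp_le th x m'.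
Proof.
by move=> mm h t t0; apply: (le_trans (h t t0)); rewrite ler_wpM2r ?powR_ge0.
Qed.

Lemma interp_le0 th m : 0 <= m -> interp_le th 0 m.
Proof.
move=> m0 t t0; apply: (le_trans (Kfun_le 0 0 (ltW t0))).
by rewrite linear0 subrr !normr0 mulr0 addr0 mulr_ge0// powR_ge0.
Qed.

Lemma interp_le_ge0 th x m : interp_le th x m -> 0 <= m.
Proof.
move=> h; have := le_trans (Kfun_ge0 x ler01) (h 1 ltr01).
by rewrite powR1 mulr1.
Qed.

(** Split x at t = 1. *)
Lemma interp_le_norm0 th x m : interp_le th x m -> `|x| <= (1 + `|ki|) * m.
Proof.
move=> h; apply: ler_eps_pos => e e0.
have k0 : 0 < 1 + `|ki| by rewrite ltr_pwDl.
have := h 1 ltr01; rewrite powR1 mulr1 => h1.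
have h2 : Kfun i 1 x < m + e / (1 + `|ki|).
  by apply: le_lt_trans h1 _; rewrite ltrDl divr_gt0.
have [b hb] := Kfun_split ler01 h2.
have -> : x = (x - i b) + i b by rewrite subrK.
apply: (le_trans (ler_normD _ _)).
have -> : (1 + `|ki|) * m + e = (1 + `|ki|) * (m + e / (1 + `|ki|)).
  by field; rewrite gt_eqF.
apply: (@le_trans _ _ ((1 + `|ki|) * (`|x - i b| + 1 * `|b|))); last first.
  by rewrite ler_pM2l// ltW.
have := bounded_abs hi b; have := normr_ge0 (x - i b); have := normr_ge0 b.
have := normr_ge0 ki; nra.
Qed.

Lemma interp_le_E1 th b : 0 <= th <= 1 -> interp_le th (i b) ((1 + `|ki|) * `|b|).
Proof.
move=> /andP[th0 th1] t t0; have [t1|t1] := leP t 1.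
  apply: (le_trans (Kfun_le (i b) b (ltW t0))); rewrite subrr normr0 add0r.
  apply: (@le_trans _ _ (`|b| * t `^ th)).
    rewrite mulrC ler_wpM2l// -[leLHS]powRr1 ?(ltW t0)//.
    by apply: ger_powR; rewrite ?t0.
  by rewrite ler_wpM2r ?powR_ge0// mulrDl mul1r lerDl mulr_ge0.
apply: (le_trans (Kfun_le (i b) 0 (ltW t0))).
rewrite linear0 subr0 normr0 mulr0 addr0.
apply: (le_trans (bounded_abs hi b)).
apply: (@le_trans _ _ ((1 + `|ki|) * `|b|)); first by rewrite ler_wpM2r// lerDr.
rewrite ler_peMr ?mulr_ge0 ?addr_ge0//.
by rewrite -[leLHS](powRr0 t); apply: ler_powR => //; exact: ltW.
Qed.

Lemma cont_interp_E1 th b : 0 <= th <= 1 -> cont_interp i th (i b).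
Proof.
move=> hth; apply/cont_interpP; split.
  by exists ((1 + `|ki|) * `|b|); exact: interp_le_E1.
by move=> e e0; exists b; rewrite subrr; apply: interp_le0; exact: ltW.
Qed.

Lemma cont_interpB th x y : cont_interp i th x -> cont_interp i th y ->
  cont_interp i th (x - y).
Proof.
move=> /cont_interpP[[m hm] h] /cont_interpP[[m' hm'] h'].
apply/cont_interpP; split; first by exists (m + m'); exact: interp_leB.
move=> e e0; have [b hb] := h (e / 2) ltac:(by rewrite divr_gt0).
have [c hc] := h' (e / 2) ltac:(by rewrite divr_gt0).
exists (b - c).
have -> : x - y - i (b - c) = (x - i b) - (y - i c).
  have -> : i (b - c) = i b - i c by rewrite linearB.
  by module_ring R.
by apply: interp_leW (interp_leB hb hc); lra.
Qed.

Lemma interp_le_weaken mu nu x m : 0 <= mu -> mu <= nu -> interp_le nu x m ->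
  interp_le mu x ((2 + `|ki|) * m).
Proof.
move=> mu0 mn h t t0; have m0 := interp_le_ge0 h.
have k0 : 0 <= `|ki| * m by rewrite mulr_ge0.
have [t1|t1] := leP t 1.
  apply: (le_trans (h t t0)); apply: ler_pM; rewrite ?powR_ge0//; first by lra.
  by apply: ger_powR; rewrite ?t0.
apply: (le_trans (Kfun_le x 0 (ltW t0))).
rewrite linear0 subr0 normr0 mulr0 addr0.
apply: (le_trans (interp_le_norm0 h)).
apply: (@le_trans _ _ ((2 + `|ki|) * m)); first by rewrite ler_wpM2r//; lra.
rewrite ler_peMr; [| by rewrite mulr_ge0// addr_ge0 |] => //.
by rewrite -[leLHS](powRr0 t); apply: ler_powR => //; exact: ltW.
Qed.

Lemma cont_interp_weaken mu nu x : 0 <= mu -> mu <= nu -> 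
  cont_interp i nu x -> cont_interp i mu x.
Proof.
move=> mu0 mn /cont_interpP[[m hm] h]; apply/cont_interpP; split.
  by exists ((2 + `|ki|) * m); exact: interp_le_weaken hm.
move=> e e0; have k0 : 0 < 2 + `|ki| by rewrite ltr_pwDl.
have [b hb] := h (e / (2 + `|ki|)) ltac:(by rewrite divr_gt0).
exists b; apply: interp_leW (interp_le_weaken mu0 mn hb).
by rewrite mulrC divfK// gt_eqF.
Qed.

(** Density of E1 reduces this to K(t, i b) <= t |b| = o(t^nu). *)
Lemma Kfun_small nu x : nu < 1 -> cont_interp i nu x -> forall e : R, 0 < e ->
  exists2 r : R, 0 < r & forall t, 0 < t -> t <= r -> Kfun i t x <= e * t `^ nu.
Proof.
move=> n1 /cont_interpP[_ h] e e0.
have [b hb] := h (e / 2) ltac:(by rewrite divr_gt0).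
have b0 : 0 < `|b| + 1 by rewrite ltr_wpDl.
have [r r0 hr] := @powR_small R (1 - nu) (e / 2 / (`|b| + 1)) ltac:(lra)
  ltac:(by rewrite !divr_gt0).
exists r => // t t0 tr.
have -> : x = (x - i b) + i b by rewrite subrK.
apply: (le_trans (KfunD _ _ (ltW t0))).
have h1 := hb t t0; have h2 := Kfun_le (i b) b (ltW t0).
rewrite subrr normr0 add0r in h2.
have h3 : t * `|b| <= e / 2 * t `^ nu.
  have tE : t = t `^ (1 - nu) * t `^ nu by rewrite -powR_split// subrK powRr1// ltW.
  rewrite [X in X * _ <= _]tE mulrAC ler_wpM2r ?powR_ge0//.
  apply: (@le_trans _ _ (e / 2 / (`|b| + 1) * (`|b| + 1))); last by rewrite divfK ?gt_eqF.
  apply: ler_pM; rewrite ?powR_ge0//; first by apply: hr; lra.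
  by rewrite lerDl.
by apply: (le_trans (lerD h1 (le_trans h2 h3))); lra.
Qed.

(** Trace estimate: test K(s, u(t) - x) with b = u(t) - u(s) if s < t and
    with b = 0 otherwise. *)
Lemma trace_bound nu th t x (u : R -> E1) c N : 0 <= th <= nu -> nu <= 1 ->
  0 < t -> 0 <= c -> 0 <= N ->
  (forall s : R, 0 < s <= t -> `|i (u s) - x| <= c * N * s `^ nu) ->
  wbound nu t u N ->
  interp_le th (i (u t) - x) ((c + 2) * N * t `^ (nu - th)).
Proof.
move=> /andP[th0 thn] n1 t0 c0 N0 hx hu s s0.
have cN : 0 <= c * N by rewrite mulr_ge0.
have cN2 : 0 <= (c + 2) * N by rewrite mulr_ge0// addr_ge0.
have pow r : 0 < r -> r `^ nu = r `^ (nu - th) * r `^ th.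
  by move=> r0; rewrite -powR_split// subrK.
have [ts|st] := leP t s.
  apply: (le_trans (Kfun_le _ 0 (ltW s0))).
  rewrite linear0 subr0 normr0 mulr0 addr0.
  apply: (le_trans (hx t ltac:(by rewrite t0 lexx))); rewrite pow// mulrA.
  apply: ler_pM; rewrite ?mulr_ge0 ?powR_ge0//.
    by rewrite ler_wpM2r ?powR_ge0// ler_wpM2r//; lra.
  by apply: powR_mono => //; exact: ltW.
apply: (le_trans (Kfun_le _ (u t - u s) (ltW s0))).
have -> : i (u t) - x - i (u t - u s) = i (u s) - x.
  have -> : i (u t - u s) = i (u t) - i (u s) by rewrite linearB.
  by module_ring R.
have h1 := hx s ltac:(lra).
have sn : s `^ nu = s `^ (nu - 1) * s.
  by rewrite -[X in _ = _ * X]powRr1 ?(ltW s0)// -powR_split// subrK.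
have h2 : `|u s| <= N * s `^ (nu - 1) by rewrite -weight_le//; apply: hu; lra.
have h3 : `|u t| <= N * s `^ (nu - 1).
  have : `|u t| <= N * t `^ (nu - 1) by rewrite -weight_le//; apply: hu; lra.
  by move/le_trans; apply; rewrite ler_wpM2l// powR_anti//; lra.
have h4 : s * `|u t - u s| <= 2 * N * s `^ nu.
  rewrite sn; apply: (@le_trans _ _ (s * (N * s `^ (nu - 1) + N * s `^ (nu - 1)))).
    by rewrite ler_pM2l//; apply: (le_trans (ler_normB _ _)); exact: lerD.
  by rewrite le_eqVlt; apply/orP; left; apply/eqP; ring.
apply: (@le_trans _ _ ((c + 2) * N * s `^ nu)); first by lra.
rewrite pow// mulrA ler_wpM2r ?powR_ge0// ler_wpM2l//.
by apply: powR_mono; lra.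
Qed.

End KFunctional.

Section MaxReg.
Context {R : realType} {E0 E1 : completeNormedModType R}.
Variables (i : {linear E1 -> E0}) (ki : R).
Hypothesis hi : forall b, `|i b| <= ki * `|b|.

Lemma EE1P (nu T : R) (u : R -> E1) d : 0 < T -> der_on T (fun t => i (u t)) d ->
  EE1 i nu T u <-> in_BC nu T u /\ in_BC nu T d.
Proof.
move=> T0 hd; have [h1 h2] := der_on_derive hd; split.
  move=> [[_ _ /(BCwP _ _ T0) h] /(BCwP _ _ T0) h']; split=> //.
  by apply: in_BC_eq h.
move=> [hu hdd]; split; last exact/BCwP.
split=> //; apply/BCwP => //; first exact: (in_BC_bounded_linear hi hu).
by apply: in_BC_eq hdd => t tT; rewrite h2.
Qed.

Lemma EE1_der (nu T : R) (u : R -> E1) : EE1 i nu T u ->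
  der_on T (fun t => i (u t)) (derive_on T (i \o u)).
Proof. by move=> [[h _ _] _]; apply: derivable_on_der. Qed.

Lemma solvesP (nu T : R) (B : {linear E1 -> E0}) kB (f : R -> E0) x u :
  (forall b, `|B b| <= kB * `|b|) -> 0 < T -> in_BC nu T f ->
  solves i B nu T f x u <->
  [/\ EE1 i nu T u,
      forall t, t \in `]0, T] -> derive_on T (i \o u) t + B (u t) = f t
    & initial_value i u x].
Proof.
move=> hB T0 hf; split.
  move=> h; have [hu du xu] := h; have [h1 h2] := der_on_derive du; split.
  - apply/(EE1P nu T0 du); split=> //; exact: (solves_derBC hB hf h).
  - by move=> t; rewrite in_itv/= => tT; rewrite h2// subrK.
  - exact/(starts_atP _ _ T0).
move=> [he eq hx]; have du := EE1_der he.
have [hu hd] := (EE1P nu T0 du).1 he; split=> //.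
- by apply: der_on_eq du => // t tT; rewrite -eq ?in_itv// addrK.
- exact/(starts_atP _ _ T0).
Qed.

(** For data g the change of weight from mu to nu is causal_bound_weight.  For
    an initial value x it is homogeneous_split: t |u(t)| is bounded by K(t, x),
    whose growth t^nu is what the norm of E_nu measures. *)
Lemma max_reg_package (mu nu : R) (B : {linear E1 -> E0}) : 0 < mu -> mu <= nu < 1 ->
  max_reg i mu B ->
  exists kB T C : R, [/\ forall b, `|B b| <= kB * `|b|, 0 < T, 0 < C,
    forall t g x, 0 < t <= T -> in_BC nu t g -> cont_interp i nu x ->
      exists u, solves i B nu t g x u &
    forall t g x u M m, 0 < t <= T -> in_BC nu t g -> cont_interp i nu x ->
      solves i B nu t g x u -> wbound nu t g M -> interp_le i nu x m ->
      wbound nu t u (C * (M + m))].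
Proof.
move=> mu0 /andP[mn n1] [/continuous_linear_bound[kB _ hB] [T T0 reg]].
have hmu : 0 < mu < 1 by lra.
have mu1 : mu < 1 by lra.
have zero_interp : cont_interp i mu 0.
  by rewrite -(linear0 i); apply: (cont_interp_E1 hi); lra.
have zeroBC : in_BC mu T (fun=> 0 : E0) by exact: in_BC_cst.
have solvable f x : in_BC mu T f -> cont_interp i mu x ->
    exists u, solves i B mu T f x u.
  move=> hf hx; have [u [hu _]] := reg f x ((BCwP _ _ T0).2 hf) hx.
  by exists u; apply/(solvesP _ _ hB T0 hf).
have uniq u : solves i B mu T (fun=> 0) 0 u -> forall t : R, 0 < t <= T -> u t = 0.
  move=> hu t tT.
  have [w [_ hw]] := reg _ 0 ((BCwP _ _ T0).2 zeroBC) zero_interp.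
  have h1 := hw _ ((solvesP _ _ hB T0 zeroBC).1 hu) t ltac:(by rewrite in_itv).
  have h2 := hw _ ((solvesP _ _ hB T0 zeroBC).1 (solves0 i B T mu1)) t ltac:(by rewrite in_itv).
  by rewrite h1 h2.
have solvable0 f : in_BC mu T f -> exists u, solves i B mu T f 0 u.
  by move=> hf; apply: solvable.
have [C1 C10 h1] := causal_bound_weight hi hB hmu solvable0 uniq.
have [C2 C20 h2] := homogeneous_split hi hB hmu T0 solvable0 uniq.
have homog x : cont_interp i nu x -> exists e, solves i B nu T (fun=> 0) x e /\
    forall m, interp_le i nu x m -> wbound nu T e (C2 * m).
  move=> hx; have hx' := cont_interp_weaken hi (ltW mu0) mn hx.
  have [e he] := solvable _ _ zeroBC hx'.
  have bK t : 0 < t <= T -> t * `|e t| <= C2 * Kfun i t x.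
    move=> tT; apply: ler_eps_pos => eps eps0.
    have t0 : 0 <= t by lra.
    have hk : Kfun i t x < Kfun i t x + eps / C2 by rewrite ltrDl divr_gt0.
    have [b hb] := Kfun_split t0 hk.
    have := h2 x e b he t tT.
    move/le_trans; apply.
    have -> : C2 * Kfun i t x + eps = C2 * (Kfun i t x + eps / C2).
      by field; rewrite gt_eqF.
    by rewrite ler_pM2l// ltW.
  have pt t m : 0 < t <= T -> Kfun i t x <= m * t `^ nu ->
      t `^ (1 - nu) * `|e t| <= C2 * m.
    move=> tT hK; have t0 : 0 < t by case/andP: tT.
    have hp : 0 < t `^ nu by exact: powR_gt0.
    rewrite -(ler_pM2l hp) mulrA -powR_split// [nu + _]addrC subrK powRr1; last by lra.
    by apply: (le_trans (bK t tT)); rewrite mulrCA ler_pM2l// mulrC.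
  have bd m : interp_le i nu x m -> wbound nu T e (C2 * m).
    by move=> hm t tT; apply: pt => //; apply: hm; lra.
  exists e; split=> //; have [[ec _ _] de xe] := he; split=> //; split=> //.
    by have /cont_interpP[[m hm] _] := hx; exists (C2 * m); apply: bd.
  move=> eps eps0.
  have [r r0 hr] := Kfun_small n1 hx (divr_gt0 eps0 C20).
  exists r => // t tT tr; have -> : eps = C2 * (eps / C2) by rewrite mulrC divfK ?gt_eqF.
  by apply: pt => //; apply: hr; lra.
have unique t x u v g : 0 < t <= T -> in_BC nu t g -> solves i B nu t g x u ->
    solves i B nu t g x v -> forall s, 0 < s <= t -> u s = v s.
  move=> tT hg hu hv s st; have t0 : 0 <= t by lra.
  apply/eqP; rewrite -subr_eq0; apply/eqP.
  apply: (uniqueness_sub hi hB hmu uniq tT (u := fun s => u s - v s)) st.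
  have := solvesB (solves_weight mn t0 hu) (solves_weight mn t0 hv).
  by rewrite subrr; apply: solves_eq => r _; rewrite subrr.
have exist t g x : 0 < t <= T -> in_BC nu t g -> cont_interp i nu x ->
    exists u, solves i B nu t g x u /\ forall M m, wbound nu t g M ->
      interp_le i nu x m -> wbound nu t u (C1 * M + C2 * m).
  move=> tT hg hx; have [e [he eb]] := homog x hx.
  have t0 : 0 <= t by lra.
  have hg' : in_BC mu t g by apply: in_BC_weight hg.
  have [v hv] := solvable_sub hmu solvable0 tT hg'.
  have [hv' vb] := h1 nu t g v ltac:(lra) tT hv hg.
  have tT' : t <= T by lra.
  exists (fun s => v s + e s); split.
    have := solvesD hv' (solves_sub tT' he); rewrite add0r.
    by apply: solves_eq => s _; rewrite addr0.
  move=> M m gM xm s st.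
  have := wbound_lin 1 (vb M gM) (wbound_sub tT' (eb m xm)) st.
  by rewrite normr1 mul1r scale1r.
exists kB, T, (C1 + C2); split=> //; first exact: addr_gt0.
  by move=> t g x tT hg hx; have [u [hu _]] := exist t g x tT hg hx; exists u.
move=> t g x u M m tT hg hx hu gM xm.
have [v [hv vb]] := exist t g x tT hg hx.
move=> s st; rewrite (unique t x u v g tT hg hu hv s st).
apply: (le_trans (vb M m gM xm s st)).
have m0 := interp_le_ge0 xm.
have M0 : 0 <= M by apply: le_trans (gM s st); rewrite mulr_ge0 ?powR_ge0.
have := mulr_ge0 (ltW C10) m0; have := mulr_ge0 (ltW C20) M0; lra.
Qed.

End MaxReg.

(** * Lipschitz continuity of the coefficients *)

Section OperatorNorm.
Context {R : realType} {E0 E1 : completeNormedModType R}.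
Variables (f g : {linear E1 -> E0}).
Hypotheses (cf : continuous f) (cg : continuous g).

Lemma opnormB_has_sup : has_sup [set `|f b - g b| | b in [set b : E1 | `|b| <= 1]].
Proof.
have [k k0 hk] := continuous_linear_bound cf.
have [l l0 hl] := continuous_linear_bound cg.
split; first by exists `|f 0 - g 0|; exists 0 => //=; rewrite normr0.
exists (k + l) => _ [b /= b1 <-]; apply: (le_trans (ler_normB _ _)).
apply: (le_trans (lerD (hk b) (hl b))); have := normr_ge0 b; nra.
Qed.

Lemma opnormB_ge0 : 0 <= opnorm (fun b => f b - g b).
Proof.
apply: (@le_trans _ _ `|f 0 - g 0|) => //.
apply: ub_le_sup; first by have [] := opnormB_has_sup.
by exists 0 => //=; rewrite normr0.
Qed.

(** Scale b to norm 1. *)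
Lemma opnormB_le b : `|f b - g b| <= opnorm (fun b => f b - g b) * `|b|.
Proof.
have [->|b0] := eqVneq b 0; first by rewrite (linear0 f) (linear0 g) subrr !normr0 mulr0.
have nb : 0 < `|b| by rewrite normr_gt0.
rewrite -ler_pdivrMr//.
have -> : `|f b - g b| / `|b| = `|f (`|b|^-1 *: b) - g (`|b|^-1 *: b)|.
  have -> : f (`|b|^-1 *: b) = `|b|^-1 *: f b by rewrite linearZ.
  have -> : g (`|b|^-1 *: b) = `|b|^-1 *: g b by rewrite linearZ.
  by rewrite -scalerBr normrZ gtr0_norm ?invr_gt0// mulrC.
apply: ub_le_sup; first by have [] := opnormB_has_sup.
exists (`|b|^-1 *: b) => //=.
by rewrite normrZ gtr0_norm ?invr_gt0// mulVf// gt_eqF.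
Qed.

End OperatorNorm.

(** Trajectories that start in E_nu with nu >= beta stay bounded in E_beta, say
    by Q; the polynomial growth of F2 then only enters the constant L, and all
    differences are measured by a common bound p in the spaces between E_mu and
    E_beta. *)
Definition lipschitz_near {R : realType} {E0 E1 : completeNormedModType R}
    (i : {linear E1 -> E0}) (mu beta : R) (V : set E0)
    (A : E0 -> {linear E1 -> E0}) (F1 F2 : E0 -> E0) (x0 : E0) (r Q L : R) :=
  forall y y' p, cont_interp i beta y -> cont_interp i beta y' ->
    interp_le i mu (y - x0) r -> interp_le i mu (y' - x0) r ->
    interp_le i beta y Q -> interp_le i beta y' Q ->
    (forall th : R, mu <= th <= beta -> interp_le i th (y - y') p) ->
    [/\ V y, `|F1 y - F1 y'| <= L * p, `|F2 y - F2 y'| <= L * p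
      & forall b, `|A y b - A y' b| <= L * p * `|b|].

Lemma lipschitz_near_exists {R : realType} {E0 E1 : completeNormedModType R}
  (i : {linear E1 -> E0}) (ki : R) (hi : forall b, `|i b| <= ki * `|b|)
  (mu beta : R) (hmu : 0 < mu) (hbeta : mu <= beta)
  (V : set E0) (hV : open_in_interp i mu V)
  (A : E0 -> {linear E1 -> E0}) (F1 F2 : E0 -> E0)
  (hA : forall x, V x -> continuous (A x))
  (hAF1 : locally_lipschitz i mu V A F1)
  (m : nat) (betaj rho : 'I_m -> R)
  (hbetaj : forall j, mu <= betaj j <= beta)
  (hrho : forall j, 0 <= rho j)
  (hF2 : forall x0 r, V x0 -> 0 < r -> exists2 C : R, 0 < C &
    forall x1 x2,
      (interp_closed_ball i mu x0 r `&` (V `&` cont_interp i beta)) x1 ->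
      (interp_closed_ball i mu x0 r `&` (V `&` cont_interp i beta)) x2 ->
      `|F2 x1 - F2 x2| <=
        C * \sum_(j < m)
              (1 + interp_norm i beta x1 `^ rho j
                 + interp_norm i beta x2 `^ rho j)
              * interp_norm i (betaj j) (x1 - x2))
  (x0 : E0) : V x0 ->
  exists2 r : R, 0 < r & forall Q, exists2 L, 0 <= L &
    lipschitz_near i mu beta V A F1 F2 x0 r Q L.
Proof.
move=> Vx0; have [Vsub Vopen] := hV.
have [r1 r10 hr1] := Vopen x0 Vx0.
have [r2 [L0 [r20 hL0]]] := hAF1 x0 Vx0.
pose r := Num.min r1 r2 / 2.
have rm : 0 < Num.min r1 r2 by rewrite lt_min r10.
have r0 : 0 < r by rewrite /r; lra.
have [rr1 rr2] : r < r1 /\ r < r2.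
  have : Num.min r1 r2 <= r1 by rewrite ge_min lexx.
  have : Num.min r1 r2 <= r2 by rewrite ge_min lexx orbT.
  by rewrite /r; lra.
have [C C0 hC] := hF2 x0 r Vx0 r0.
exists r => // Q.
pose P := \sum_(j < m) (1 + Q `^ rho j + Q `^ rho j).
have P0 : 0 <= P by rewrite sumr_ge0// => j _; rewrite !addr_ge0 ?powR_ge0.
exists (`|L0| + C * P); first by rewrite addr_ge0// mulr_ge0// ltW.
move=> y y' p hy hy' yr yr' yQ yQ' hp.
have near z : cont_interp i beta z -> interp_le i mu (z - x0) r ->
    [/\ cont_interp i mu z, V z & interp_norm i mu (x0 - z) <= r].
  move=> hz zr; have zmu := cont_interp_weaken hi (ltW hmu) hbeta hz.
  have h : interp_norm i mu (x0 - z) <= r.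
    by apply: interp_norm_le; rewrite -opprB; exact: interp_leN.
  split=> //; apply: hr1; split=> //.
  by rewrite /ball_/=; apply: le_lt_trans h rr1.
have [ymu Vy yn] := near y hy yr; have [ymu' Vy' yn'] := near y' hy' yr'.
have p0 : 0 <= p by apply: (interp_le_ge0 (hp mu _)); rewrite lexx.
have CPp : 0 <= C * P * p by rewrite !mulr_ge0// ltW.
have L0p : 0 <= `|L0| * p by rewrite mulr_ge0.
have pmu : interp_norm i mu (y - y') <= p.
  by apply: interp_norm_le; apply: hp; rewrite lexx.
have pmu0 : 0 <= interp_norm i mu (y - y') by rewrite fine_ge0// interp_enorm_ge0.
have hL := hL0 y y' (conj Vy (le_lt_trans yn rr2)) (conj Vy' (le_lt_trans yn' rr2)).
have cA := hA y Vy; have cA' := hA y' Vy'.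
have op0 := opnormB_ge0 cA cA'.
have Lp : L0 * interp_norm i mu (y - y') <= `|L0| * p.
  apply: (@le_trans _ _ (`|L0| * interp_norm i mu (y - y'))).
    by rewrite ler_wpM2r// ler_norm.
  by rewrite ler_wpM2l.
have F1n := normr_ge0 (F1 y - F1 y').
split=> //.
- by rewrite mulrDl; lra.
- rewrite mulrDl.
  have := hC y y' (conj (conj ymu yn) (conj Vy hy)) (conj (conj ymu' yn') (conj Vy' hy')).
  move/le_trans; apply; apply: (@le_trans _ _ (C * (P * p))); last by lra.
  rewrite ler_pM2l// /P mulr_suml; apply: ler_sum => j _.
  have Qj z : interp_le i beta z Q -> interp_norm i beta z `^ rho j <= Q `^ rho j.
    move=> zQ; apply: powR_mono => //; first by rewrite fine_ge0// interp_enorm_ge0.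
    exact: interp_norm_le.
  apply: ler_pM.
  + by rewrite !addr_ge0 ?powR_ge0.
  + by rewrite fine_ge0// interp_enorm_ge0.
  + by rewrite !lerD ?Qj.
  + by apply: interp_norm_le; apply: hp.
- move=> b; apply: (le_trans (opnormB_le cA cA' b)).
  by rewrite ler_wpM2r// mulrDl; lra.
Qed.

(** * The quasilinear problem near the initial value *)

(** Room between delta / 2 and delta lets a weighted bound persist past c. *)
Lemma wbound_extend {R : realType} {E : normedModType R} (nu tau c delta : R)
    (f : R -> E) : 0 <= nu <= 1 -> 0 < c <= tau -> 0 < delta -> cont_on tau f ->
  wbound nu c f (delta / 2) -> exists2 a : R, 0 < a &
  forall s : R, 0 < s <= tau -> s <= c + a -> s `^ (1 - nu) * `|f s| <= delta.
Proof.
move=> hnu cc d0 fc fb; have c0 : 0 < c by lra.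
have w0 : 0 < c `^ (1 - nu) by exact: powR_gt0.
have [a a0 ha] := fc c (delta / 4 / c `^ (1 - nu)) cc ltac:(by rewrite !divr_gt0).
(* for s <= 4 c / 3 the weight grows at most by the factor 4 / 3, and
   4 / 3 (delta / 2 + delta / 4) = delta *)
exists (Num.min (a / 2) (c / 3)); first by rewrite lt_min; lra.
move=> s st sa; have [sc|cs] := leP s c.
  by apply: (le_trans (fb s _)); lra.
have [sa1 sa2] : s <= c + a / 2 /\ s <= c + c / 3.
  by split; apply: (le_trans sa); rewrite lerD2l ge_min lexx ?orbT.
have h1 : `|f s| <= `|f c| + delta / 4 / c `^ (1 - nu).
  have -> : f s = (f c) + (f s - f c) by module_ring R.
  apply: (le_trans (ler_normD _ _)); rewrite lerD2l; apply: ha => //.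
  by rewrite ltr_distl; lra.
have h2 : s `^ (1 - nu) <= 4 / 3 * c `^ (1 - nu).
  have -> : s = s / c * c by rewrite divfK// gt_eqF.
  rewrite powRM; [| by rewrite divr_ge0; lra | by lra].
  rewrite ler_pM2r//; apply: (@le_trans _ _ (s / c)).
    by apply: ler1_powR; [rewrite ler_pdivlMr// mul1r ltW | lra].
  by rewrite ler_pdivrMr//; lra.
apply: (@le_trans _ _ (4 / 3 * c `^ (1 - nu) * (`|f c| + delta / 4 / c `^ (1 - nu)))).
  by apply: ler_pM; rewrite ?powR_ge0.
have h3 := fb c ltac:(lra).
have -> : 4 / 3 * c `^ (1 - nu) * (`|f c| + delta / 4 / c `^ (1 - nu))
   = 4 / 3 * (c `^ (1 - nu) * `|f c|) + delta / 3.
  by field; rewrite gt_eqF.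
lra.
Qed.

Section Quasilinear.
Context {R : realType} {E0 E1 : completeNormedModType R}.
Variables (i : {linear E1 -> E0}) (ki : R).
Hypothesis hi : forall b, `|i b| <= ki * `|b|.
Variables (mu beta nu : R).
Hypotheses (mu0 : 0 < mu) (mubeta : mu <= beta) (betanu : beta <= nu) (nu1 : nu < 1).
Variables (V : set E0) (A : E0 -> {linear E1 -> E0}) (F1 F2 : E0 -> E0) (x0 : E0).
Hypothesis hx0 : cont_interp i nu x0.

Ltac slra := move: mu0 mubeta betanu nu1; lra.

Definition trace_const : R := dyadic_const nu + 4 + `|ki|.
Local Notation c3 := trace_const.

Lemma trace_const_ge1 : 1 <= c3.
Proof.
have n0 : 0 < nu by slra.
by have := dyadic_const_gt0 n0; have := normr_ge0 ki; rewrite /c3; slra.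
Qed.

Definition beta_radius : R := c3 + interp_norm i beta x0.

Variables (r L : R).
Hypotheses (r0 : 0 < r) (L0 : 0 <= L).
Hypothesis lip : lipschitz_near i mu beta V A F1 F2 x0 r beta_radius L.

Local Notation B := (A x0).
Variables (kB T C : R).
Hypothesis hB : forall b, `|B b| <= kB * `|b|.
Hypotheses (T0 : 0 < T) (C0 : 0 < C).
Hypothesis solvable : forall t g x, 0 < t <= T -> in_BC nu t g ->
  cont_interp i nu x -> exists u, solves i B nu t g x u.
Hypothesis bound : forall t g x u M m, 0 < t <= T -> in_BC nu t g ->
  cont_interp i nu x -> solves i B nu t g x u -> wbound nu t g M ->
  interp_le i nu x m -> wbound nu t u (C * (M + m)).

(** The problem reads u' + B u = rhs u, where B = A x0. *)
Definition rhs (b : E1) : E0 := (B b - A (i b) b) + (F1 (i b) + F2 (i b)).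

Definition near_x0 (q : R) (b : E1) :=
  forall th : R, mu <= th <= beta -> interp_le i th (i b - x0) q.

Lemma near_x0_beta q b : q <= c3 -> near_x0 q b -> interp_le i beta (i b) beta_radius.
Proof.
move=> qc hb; have -> : i b = (i b - x0) + x0 by rewrite subrK.
have h := hb beta ltac:(slra).
have hx : interp_le i beta x0 (interp_norm i beta x0).
  apply: interp_le_norm; have b0 : 0 <= beta by slra.
  by have [] := cont_interp_weaken hi b0 betanu hx0.
by apply: interp_leW (interp_leD h hx); rewrite /beta_radius lerD2r.
Qed.

Lemma x0_beta : interp_le i beta x0 beta_radius.
Proof.
have hx : interp_le i beta x0 (interp_norm i beta x0).
  apply: interp_le_norm; have b0 : 0 <= beta by slra.
  by have [] := cont_interp_weaken hi b0 betanu hx0.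
by apply: interp_leW hx; rewrite /beta_radius lerDr; have := trace_const_ge1; slra.
Qed.

Lemma cont_beta_E1 b : cont_interp i beta (i b).
Proof. by apply: (cont_interp_E1 hi); slra. Qed.

Lemma near_lip q b b' p : q <= r -> q <= c3 -> near_x0 q b -> near_x0 q b' ->
  (forall th : R, mu <= th <= beta -> interp_le i th (i b - i b') p) ->
  [/\ V (i b), `|F1 (i b) - F1 (i b')| <= L * p, `|F2 (i b) - F2 (i b')| <= L * p
      & forall e, `|A (i b) e - A (i b') e| <= L * p * `|e|].
Proof.
move=> qr qc hb hb' hp.
have mm : mu <= mu <= beta by rewrite lexx.
have yr : interp_le i mu (i b - x0) r by apply: interp_leW qr _; exact: hb.
have yr' : interp_le i mu (i b' - x0) r by apply: interp_leW qr _; exact: hb'.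
exact: (lip (cont_beta_E1 b) (cont_beta_E1 b') yr yr'
  (near_x0_beta qc hb) (near_x0_beta qc hb') hp).
Qed.

Lemma near_lip_x0 q b : q <= r -> q <= c3 -> near_x0 q b ->
  [/\ V (i b), `|F1 (i b) - F1 x0| <= L * q, `|F2 (i b) - F2 x0| <= L * q
      & forall e, `|A (i b) e - B e| <= L * q * `|e|].
Proof.
move=> qr qc hb.
have mm : mu <= mu <= beta by rewrite lexx.
apply: lip => //.
- exact: cont_beta_E1.
- by apply: (cont_interp_weaken hi _ betanu hx0); slra.
- by apply: interp_leW qr _; exact: hb.
- by rewrite subrr; apply: interp_le0; exact: ltW.
- exact: near_x0_beta qc hb.
- exact: x0_beta.
Qed.

(** Freezing the operator at x0 leaves the small factor q in front of the only
    term with the norm of b - b' in E1. *)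
Lemma rhs_lip q b b' p : q <= r -> q <= c3 -> near_x0 q b -> near_x0 q b' ->
  (forall th : R, mu <= th <= beta -> interp_le i th (i b - i b') p) ->
  `|rhs b - rhs b'| <= L * q * `|b - b'| + L * p * `|b'| + 2 * (L * p).
Proof.
move=> qr qc hb hb' hp.
have [_ h1 h2 h3] := near_lip qr qc hb hb' hp.
have [_ _ _ h4] := near_lip_x0 qr qc hb.
have -> : rhs b - rhs b' = - (A (i b) (b - b') - B (b - b'))
   - (A (i b) b' - A (i b') b')
   + ((F1 (i b) - F1 (i b')) + (F2 (i b) - F2 (i b'))).
  have -> : A (i b) (b - b') = A (i b) b - A (i b) b' by rewrite linearB.
  have -> : B (b - b') = B b - B b' by rewrite linearB.
  by rewrite /rhs; module_ring R.
apply: (le_trans (ler_normD _ _)); apply: lerD.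
  apply: (le_trans (ler_normB _ _)); rewrite normrN; apply: lerD; last exact: h3.
  exact: h4.
apply: (le_trans (ler_normD _ _)); apply: (le_trans (lerD h1 h2)); slra.
Qed.

Lemma rhs_size q b : q <= r -> q <= c3 -> near_x0 q b ->
  `|rhs b| <= L * q * `|b| + (2 * (L * q) + (`|F1 x0| + `|F2 x0|)).
Proof.
move=> qr qc hb; have [_ h1 h2 h4] := near_lip_x0 qr qc hb.
have -> : rhs b = - (A (i b) b - B b) +
  ((F1 (i b) - F1 x0) + (F2 (i b) - F2 x0) + (F1 x0 + F2 x0)).
  by rewrite /rhs; module_ring R.
apply: (le_trans (ler_normD _ _)); apply: lerD; first by rewrite normrN h4.
apply: (le_trans (ler_normD _ _)); apply: lerD; last exact: ler_normD.
by apply: (le_trans (ler_normD _ _)); apply: (le_trans (lerD h1 h2)); slra.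
Qed.

(** The second bound is on the derivative; together they bound the norm in
    E_{1, nu}([0, t]). *)
Definition trajectory t M f x u :=
  [/\ solves i B nu t f x u, wbound nu t u M
    & wbound nu t (fun s => f s - B (u s)) M].

Lemma trajectoryW t M M' f x u : M <= M' -> trajectory t M f x u ->
  trajectory t M' f x u.
Proof. by move=> MM [h1 h2 h3]; split=> //; apply: wboundW MM _. Qed.

Lemma trajectory_sub t t' M f x u : t' <= t -> trajectory t M f x u ->
  trajectory t' M f x u.
Proof.
move=> tt [h1 h2 h3]; split.
- exact: solves_sub h1.
- exact: wbound_sub h2.
- exact: wbound_sub h3.
Qed.

Lemma trajectoryB t M M' f f' x x' u u' : trajectory t M f x u ->
  trajectory t M' f' x' u' ->
  trajectory t (M + M') (fun s => f s - f' s) (x - x') (fun s => u s - u' s).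
Proof.
move=> [h1 h2 h3] [h1' h2' h3']; split; first exact: solvesB.
  exact: wboundB.
apply: wbound_eq (wboundB h3 h3') => s.
have -> : B (u s - u' s) = B (u s) - B (u' s) by rewrite linearB.
by module_ring R.
Qed.

Lemma trajectoryD t M M' f f' x x' u u' : trajectory t M f x u ->
  trajectory t M' f' x' u' ->
  trajectory t (M + M') (fun s => f s + f' s) (x + x') (fun s => u s + u' s).
Proof.
move=> [h1 h2 h3] [h1' h2' h3']; split; first exact: solvesD.
  exact: wboundD.
apply: wbound_eq (wboundD h3 h3') => s.
have -> : B (u s + u' s) = B (u s) + B (u' s) by rewrite linearD.
by module_ring R.
Qed.

Definition reg_const : R := C + (1 + `|kB| * C).
Local Notation C' := reg_const.

Lemma reg_const_ge1 : 1 <= C'.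
Proof.
have : 0 <= `|kB| * C by rewrite mulr_ge0// ltW.
by have := C0; rewrite /C'; slra.
Qed.

Lemma solves_trajectory t f x u M m : 0 < t <= T -> in_BC nu t f ->
  cont_interp i nu x -> solves i B nu t f x u -> wbound nu t f M ->
  interp_le i nu x m -> trajectory t (C' * (M + m)) f x u.
Proof.
move=> tT hf hx hu fM xm; have ub := bound tT hf hx hu fM xm.
have m0 := interp_le_ge0 xm.
have M0 : 0 <= M.
  by apply: le_trans (fM t _); [rewrite mulr_ge0 ?powR_ge0 | slra].
have CM : 0 <= C * (M + m) by rewrite mulr_ge0 ?addr_ge0 ?(ltW C0).
have kCM : 0 <= `|kB| * (C * (M + m)) by rewrite mulr_ge0.
split=> //; first by apply: wboundW ub; rewrite /C'; slra.
by apply: wboundW (solves_derbound hB fM ub); rewrite /C'; slra.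
Qed.

Lemma trajectory_trace t M f x u th s : t <= 1 -> trajectory t M f x u ->
  0 <= th <= nu -> 0 < s <= t -> interp_le i th (i (u s) - x) ((dyadic_const nu + 2) * M).
Proof.
move=> t1 [[_ du xu] uM dM] hth st.
have M0 : 0 <= M by apply: le_trans (uM s st); rewrite mulr_ge0 ?powR_ge0.
have nu0 : 0 < nu by slra.
have c0 := dyadic_const_gt0 nu0.
have nu01 : 0 < nu <= 1 by slra.
have hx : forall q : R, 0 < q <= s -> `|i (u q) - x| <= dyadic_const nu * M * q `^ nu.
  by move=> q qs; apply: (starts_at_bound nu01 M0 (der_on_mean du) dM xu); slra.
have uM' : wbound nu s u M by apply: wbound_sub uM; slra.
have st' : 0 < s by slra.
have := trace_bound hth (ltW nu1) st' (ltW c0) M0 hx uM'.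
apply: interp_leW; rewrite ler_piMr ?mulr_ge0//; first by slra.
have : s `^ (nu - th) <= 1 `^ (nu - th) by apply: powR_mono; slra.
by rewrite powR1.
Qed.

(** Meant for differences of trajectories: their initial value is controlled in
    E_nu only, hence the deviation from it is added to a fixed term. *)
Lemma trajectory_interp t M m f x u th s : t <= 1 -> trajectory t M f x u ->
  interp_le i nu x m -> mu <= th <= beta -> 0 < s <= t ->
  interp_le i th (i (u s)) (c3 * (M + m)).
Proof.
move=> t1 hu xm hth st.
have M0 : 0 <= M by case: hu => _ uM _; apply: le_trans (uM s st); rewrite mulr_ge0 ?powR_ge0.
have m0 := interp_le_ge0 xm.
have th0 : 0 <= th by slra.
have thn : th <= nu by slra.
have h1 := trajectory_trace t1 hu (introT andP (conj th0 thn)) st.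
have h2 := interp_le_weaken hi th0 thn xm.
have -> : i (u s) = (i (u s) - x) + x by rewrite subrK.
apply: interp_leW (interp_leD h1 h2).
have n0 : 0 < nu by slra.
have c0 := dyadic_const_gt0 n0; have k0 := normr_ge0 ki.
have := mulr_ge0 (ltW c0) m0; have := mulr_ge0 k0 M0.
by rewrite /trace_const; nra.
Qed.

(** Uniform in s: for a small norm and a nearby start the trajectory stays close
    to x0, although its initial value x is not in E1. *)
Lemma near_start t M f x u s : t <= 1 -> trajectory t M f x u ->
  interp_le i nu (x - x0) M -> 0 < s <= t -> near_x0 (c3 * M) (u s).
Proof.
move=> t1 hu xm st th hth.
have M0 := interp_le_ge0 xm.
have th0 : 0 <= th by slra.
have thn : th <= nu by slra.
have h1 := trajectory_trace t1 hu (introT andP (conj th0 thn)) st.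
have h2 := interp_le_weaken hi th0 thn xm.
have -> : i (u s) - x0 = (i (u s) - x) + (x - x0) by module_ring R.
by apply: interp_leW (interp_leD h1 h2); rewrite /trace_const; nra.
Qed.

Section Ball.
Variable delta : R.
Hypotheses (d0 : 0 < delta) (d1 : delta <= 1) (dr : c3 * delta <= r).
Ltac slra ::= move: mu0 mubeta betanu nu1 d0 d1; lra.

Let dc : c3 * delta <= c3.
Proof. by rewrite ler_piMr//; have := trace_const_ge1; slra. Qed.

Lemma trajectory_V t f x u s : t <= 1 -> trajectory t delta f x u ->
  interp_le i nu (x - x0) delta -> 0 < s <= t -> V (i (u s)).
Proof.
move=> t1 hu hx st.
by have [] := near_lip_x0 dr dc (near_start t1 hu hx st).
Qed.

(** At time 0 the trace estimate is replaced by the embeddings of E_nu. *)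
Lemma start_V x : cont_interp i nu x -> interp_le i nu (x - x0) delta -> V x.
Proof.
move=> cx xd.
have nuk : (2 + `|ki|) * delta <= c3 * delta.
  have n0 : 0 < nu by slra.
  by rewrite ler_wpM2r ?(ltW d0)// /trace_const; have := dyadic_const_gt0 n0; slra.
have h th : mu <= th <= beta -> interp_le i th (x - x0) (c3 * delta).
  move=> hth; have th0 : 0 <= th by slra.
  have thn : th <= nu by slra.
  exact: interp_leW nuk (interp_le_weaken hi th0 thn xd).
have hmm : mu <= mu <= beta by rewrite lexx.
have hbb : mu <= beta <= beta by rewrite lexx andbT.
have b0 : 0 <= beta by slra.
have xr := interp_leW dr (h mu hmm).
have x0r : interp_le i mu (x0 - x0) r by rewrite subrr; apply: interp_le0; exact: ltW.
have xQ : interp_le i beta x beta_radius.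
  have -> : x = (x - x0) + x0 by rewrite subrK.
  have [h0 _] := cont_interp_weaken hi b0 betanu hx0.
  apply: interp_leW (interp_leD (h beta hbb) (interp_le_norm h0)).
  by rewrite /beta_radius lerD2r.
have [] := lip (cont_interp_weaken hi b0 betanu cx)
  (cont_interp_weaken hi b0 betanu hx0) xr x0r xQ x0_beta h.
by [].
Qed.

Lemma rhs_cont t f x u : t <= 1 -> trajectory t delta f x u ->
  interp_le i nu (x - x0) delta -> cont_on t (fun s => rhs (u s)).
Proof.
move=> t1 hu hx; have [[[uc _ _] _ _] _ _] := hu.
apply: (cont_on_dom uc uc) => s st.
have k0 : 0 < 1 + `|ki| by rewrite ltr_pwDl.
exists (L * (c3 * delta) + L * (1 + `|ki|) * `|u s| + 2 * (L * (1 + `|ki|))), 1.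
split=> // q qt _.
have hp th : mu <= th <= beta ->
    interp_le i th (i (u q) - i (u s)) ((1 + `|ki|) * `|u q - u s|).
  move=> hth; rewrite -linearB; apply: interp_le_E1 => //; slra.
apply: (le_trans (rhs_lip dr dc (near_start t1 hu hx qt) (near_start t1 hu hx st) hp)).
have n0 := normr_ge0 (u q - u s).
set X := L * (c3 * delta) + _ + _.
have X0 : 0 <= X.
  have c1 := trace_const_ge1.
  have c0 : 0 <= c3 by slra.
  by rewrite /X !addr_ge0 ?mulr_ge0 ?(ltW d0) ?(ltW k0).
apply: (@le_trans _ _ (X * `|u q - u s|)); last by rewrite ler_wpM2l// lerDl.
by rewrite /X le_eqVlt; apply/orP; left; apply/eqP; ring.
Qed.

Definition rhs_const : R := 2 * (L * (c3 * delta)) + (`|F1 x0| + `|F2 x0|).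

Lemma rhs_const_ge0 : 0 <= rhs_const.
Proof.
have c1 := trace_const_ge1.
by rewrite /rhs_const !addr_ge0 ?mulr_ge0//; slra.
Qed.

(** The first term is quadratic in delta; the rest is bounded in E0, so the
    weight makes it small on short intervals. *)
Lemma rhs_BC t f x u : t <= 1 -> trajectory t delta f x u ->
  interp_le i nu (x - x0) delta -> in_BC nu t (fun s => rhs (u s)) /\
  wbound nu t (fun s => rhs (u s))
     (L * (c3 * delta) * delta + t `^ (1 - nu) * rhs_const).
Proof.
move=> t1 hu hx; have c1 := trace_const_ge1; have K0 := rhs_const_ge0.
have Lc : 0 <= L * (c3 * delta) by rewrite !mulr_ge0//; slra.
have pt s : 0 < s <= t -> s `^ (1 - nu) * `|rhs (u s)| <=
    L * (c3 * delta) * (s `^ (1 - nu) * `|u s|) + s `^ (1 - nu) * rhs_const.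
  move=> st; have := rhs_size dr dc (near_start t1 hu hx st).
  move/(ler_wpM2l (powR_ge0 s (1 - nu)))/le_trans; apply.
  by rewrite -/rhs_const mulrDr [s `^ _ * (_ * `|u s|)]mulrCA.
have [[[uc ub u0] _ _] uM _] := hu.
have bd : wbound nu t (fun s => rhs (u s))
     (L * (c3 * delta) * delta + t `^ (1 - nu) * rhs_const).
  move=> s st; apply: (le_trans (pt s st)); apply: lerD.
    by rewrite ler_wpM2l// uM.
  by rewrite ler_wpM2r// powR_mono//; slra.
split=> //; split.
- exact: rhs_cont hu hx.
- by exists (L * (c3 * delta) * delta + t `^ (1 - nu) * rhs_const).
- move=> e e0.
  have X0 : 0 < L * (c3 * delta) + 1 by slra.
  have Y0 : 0 < rhs_const + 1 by slra.
  have [p p0 hp] := u0 (e / 2 / (L * (c3 * delta) + 1)) ltac:(by rewrite !divr_gt0).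
  have n1 : 0 < 1 - nu by slra.
  have e2 : 0 < e / 2 / (rhs_const + 1) by rewrite !divr_gt0.
  have [q q0 hq] := powR_small n1 e2.
  exists (Num.min p q); first by rewrite lt_min p0.
  move=> s st; rewrite le_min => /andP[sp sq].
  have h1 := hp s st sp; have h2 := hq s ltac:(slra).
  rewrite ler_pdivlMr// in h1; rewrite ler_pdivlMr// in h2.
  have a1 : 0 <= s `^ (1 - nu) * `|u s| by rewrite mulr_ge0 ?powR_ge0.
  have a2 := powR_ge0 s (1 - nu).
  by apply: (le_trans (pt s st)); slra.
Qed.

Lemma rhs_diff t f f' x x' u u' M m : t <= 1 ->
  trajectory t delta f x u -> interp_le i nu (x - x0) delta ->
  trajectory t delta f' x' u' -> interp_le i nu (x' - x0) delta ->
  trajectory t M (fun s => f s - f' s) (x - x') (fun s => u s - u' s) ->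
  interp_le i nu (x - x') m ->
  wbound nu t (fun s => rhs (u s) - rhs (u' s))
    (2 * (L * c3) * (delta + t `^ (1 - nu)) * (M + m)).
Proof.
move=> t1 hu hx hu' hx' hw xm s st.
have hp th : mu <= th <= beta -> interp_le i th (i (u s) - i (u' s)) (c3 * (M + m)).
  by move=> hth; rewrite -linearB; apply: trajectory_interp hw xm hth st.
have := rhs_lip dr dc (near_start t1 hu hx st) (near_start t1 hu' hx' st) hp.
move/(ler_wpM2l (powR_ge0 s (1 - nu)))/le_trans; apply.
have [_ wM _] := hw; have [_ uM' _] := hu'.
have h1 := wM s st; have h2 := uM' s st.
have m0 := interp_le_ge0 xm.
have M0 : 0 <= M by apply: le_trans h1; rewrite mulr_ge0 ?powR_ge0.
have c1 := trace_const_ge1.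
have Lc : 0 <= L * c3 by rewrite mulr_ge0//; slra.
have LcMm : 0 <= L * c3 * (M + m) by rewrite mulr_ge0 ?addr_ge0.
have Lcd : 0 <= L * c3 * delta by rewrite mulr_ge0// ltW.
have p1 := ler_wpM2l Lcd h1.
have p2 := ler_wpM2l LcMm h2.
have p3 : s `^ (1 - nu) <= t `^ (1 - nu) by apply: powR_mono; slra.
have p4 := ler_wpM2l LcMm p3.
have p5 : 0 <= L * c3 * delta * m by rewrite mulr_ge0.
slra.
Qed.

Section Contraction.
Variable tau : R.
Hypotheses (tau0 : 0 < tau) (tau1 : tau <= 1) (tauT : tau <= T).
Ltac slra ::= move: mu0 mubeta betanu nu1 d0 d1 tau0 tau1 tauT; lra.
Hypothesis contract : C' * (2 * (L * c3) * (delta + tau `^ (1 - nu))) <= 2^-1.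

Lemma contract_sub t M : 0 < t <= tau -> 0 <= M ->
  C' * (2 * (L * c3) * (delta + t `^ (1 - nu)) * M) <= 2^-1 * M.
Proof.
move=> /andP[t0 tt] M0; rewrite mulrA ler_wpM2r//.
have c1 := trace_const_ge1; have c2 := reg_const_ge1.
apply: le_trans contract; rewrite ler_wpM2l//; first by slra.
rewrite ler_wpM2l ?mulr_ge0//; first by slra.
by rewrite lerD2l powR_mono//; slra.
Qed.

(** Two solutions in the ball differ by at most a multiple of the difference
    of their initial values: each pass through the linear problem halves the
    distance up to that multiple. *)
Lemma stability t x x' u u' m : 0 < t <= tau ->
  cont_interp i nu x -> cont_interp i nu x' ->
  trajectory t delta (fun s => rhs (u s)) x u -> interp_le i nu (x - x0) delta ->
  trajectory t delta (fun s => rhs (u' s)) x' u' -> interp_le i nu (x' - x0) delta ->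
  interp_le i nu (x - x') m ->
  trajectory t ((1 + 2 * C') * m) (fun s => rhs (u s) - rhs (u' s)) (x - x')
     (fun s => u s - u' s).
Proof.
move=> tt cx cx' hu hx hu' hx' xm.
have t1 : t <= 1 by slra.
have tT : 0 < t <= T by slra.
have m0 := interp_le_ge0 xm; have c2 := reg_const_ge1.
have [b1 _] := rhs_BC t1 hu hx; have [b2 _] := rhs_BC t1 hu' hx'.
have hb := in_BCB b1 b2.
have cxx := cont_interpB cx cx'.
have step n : trajectory t ((delta + delta) / 2 ^+ n + (1 + 2 * C') * m)
    (fun s => rhs (u s) - rhs (u' s)) (x - x') (fun s => u s - u' s).
  elim: n => [|n IH].
    apply: trajectoryW (trajectoryB hu hu').
    by rewrite expr0 divr1 lerDl mulr_ge0//; slra.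
  have hs : solves i B nu t (fun s => rhs (u s) - rhs (u' s)) (x - x') (fun s => u s - u' s).
    by case: IH.
  have h := rhs_diff t1 hu hx hu' hx' IH xm.
  apply: trajectoryW (solves_trajectory tT hb cxx hs h xm).
  set M := (delta + delta) / 2 ^+ n + (1 + 2 * C') * m.
  have M0 : 0 <= M.
    by rewrite /M addr_ge0// ?divr_ge0 ?exprn_ge0 ?mulr_ge0//; slra.
  have Mm : 0 <= M + m by slra.
  have hc := contract_sub tt Mm.
  rewrite mulrDr; apply: (le_trans (lerD hc (lexx _))).
  rewrite exprS invfM /M.
  set D := (delta + delta) / 2 ^+ n.
  have -> : (delta + delta) * (2^-1 / 2 ^+ n) = D / 2 by rewrite /D; ring.
  slra.
have [hs _ _] := step 0%N; split=> // s st.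
  by apply: geometric_le => n; have [_ h _] := step n; apply: h.
by apply: geometric_le => n; have [_ _ h] := step n; apply: h.
Qed.

Section Existence.
Variables (gamma eps eta : R) (e0 : R -> E1).
Hypotheses (g0 : 0 < gamma) (epsd : eps <= delta).
Hypothesis he0 : trajectory tau eta (fun=> 0) x0 e0.
Hypothesis base : C' * (gamma + eps) + eta <= delta / 2.
Hypothesis selfmap :
  L * (c3 * delta) * delta + tau `^ (1 - nu) * rhs_const <= gamma.

Lemma ball_trajectory x g u : cont_interp i nu x -> interp_le i nu (x - x0) eps ->
  in_BC nu tau g -> wbound nu tau g gamma -> solves i B nu tau g x u ->
  trajectory tau (delta / 2) g x u.
Proof.
move=> cx xe hg gb hu; have [he _ _] := he0.
have hd : solves i B nu tau g (x - x0) (fun s => u s - e0 s).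
  by have := solvesB hu he; apply: solves_eq => s _; rewrite subr0.
have tT : 0 < tau <= T by slra.
have := trajectoryD (solves_trajectory tT hg (cont_interpB cx hx0) hd gb xe) he0.
move/(trajectoryW base) => [_ h1 h2]; split=> //.
  by apply: wbound_eq h1 => s; rewrite subrK.
by apply: wbound_eq h2 => s; rewrite addr0 subrK.
Qed.

(** The fixed point is sought among the data g = rhs u: the linear problem then
    provides u, and only functions with values in E0 have to converge. *)
Lemma fixed_point x : cont_interp i nu x -> interp_le i nu (x - x0) eps ->
  exists u, trajectory tau (delta / 2) (fun s => rhs (u s)) x u.
Proof.
move=> cx xe; have tT : 0 < tau <= T by slra.
have xd : interp_le i nu (x - x0) delta by apply: interp_leW epsd xe.
have c2 := reg_const_ge1.
have [S hS] : exists S : (R -> E0) -> R -> E1, forall g, in_BC nu tau g ->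
    solves i B nu tau g x (S g).
  have h g : exists u, in_BC nu tau g -> solves i B nu tau g x u.
    have [hg|ng] := pselect (in_BC nu tau g); last by exists (fun=> 0).
    by have [u hu] := solvable tT hg cx; exists u.
  by have [S hS] := choice h; exists S.
have good g : in_BC nu tau g -> wbound nu tau g gamma ->
    trajectory tau (delta / 2) g x (S g).
  by move=> hg gb; apply: ball_trajectory => //; apply: hS.
have goodd g : in_BC nu tau g -> wbound nu tau g gamma -> trajectory tau delta g x (S g).
  by move=> hg gb; apply: trajectoryW (good g hg gb); slra.
pose Phi g s := rhs (S g s).
have self g : in_BC nu tau g -> wbound nu tau g gamma ->
    in_BC nu tau (Phi g) /\ wbound nu tau (Phi g) gamma.
  move=> hg gb; have [h1 h2] := rhs_BC tau1 (goodd g hg gb) xd.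
  by split=> //; apply: wboundW selfmap h2.
have xx : interp_le i nu (x - x) 0 by rewrite subrr; exact: interp_le0.
have cxx := cont_interpB cx cx.
have half g g' a : in_BC nu tau g -> wbound nu tau g gamma -> in_BC nu tau g' ->
    wbound nu tau g' gamma -> wbound nu tau (fun s => g s - g' s) a ->
    wbound nu tau (fun s => Phi g s - Phi g' s) (2^-1 * a).
  move=> hg gb hg' gb' ha.
  have hs := solvesB (hS g hg) (hS g' hg').
  have h1 := solves_trajectory tT (in_BCB hg hg') cxx hs ha xx.
  have := rhs_diff tau1 (goodd g hg gb) xd (goodd g' hg' gb') xd h1 xx.
  apply: wboundW; rewrite !addr0.
  have a0 : 0 <= a.
    by apply: le_trans (ha tau _); [rewrite mulr_ge0 ?powR_ge0 | slra].
  have tt : 0 < tau <= tau by slra.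
  by have := contract_sub tt a0; rewrite mulrCA mulrC -mulrA => h; slra.
pose g_ := fix g_ n : R -> E0 := if n is n'.+1 then Phi (g_ n') else fun=> 0.
have inv n : in_BC nu tau (g_ n) /\ wbound nu tau (g_ n) gamma.
  elim: n => [|n [h1 h2]]; last exact: self.
  split; last by move=> s _; rewrite normr0 mulr0 ltW.
  exact: in_BC_cst.
have incr n : wbound nu tau (fun s => g_ n.+1 s - g_ n s) (gamma / 2 ^+ n).
  elim: n => [|n IH].
    rewrite expr0 divr1; have [_ h] := inv 1%N.
    by apply: wbound_eq h => s /=; rewrite subr0.
  have [h1 h2] := inv n.+1; have [h3 h4] := inv n.
  apply: wboundW (half _ _ _ h1 h2 h3 h4 IH).
  by rewrite exprS invfM mulrCA.
have [g [hg lim]] := weighted_complete (fun n => (inv n).1) incr.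
have gb : wbound nu tau g gamma.
  move=> s st; apply: (@geometric_le _ _ (2 * gamma)) => n.
  have -> : g s = (g s - g_ n s) + 1 *: g_ n s by module_ring R.
  apply: (le_trans (wnorm_lin _ _ _ _ _)); rewrite normr1 mul1r; apply: lerD.
    exact: lim.
  by have [_ h] := inv n; apply: h.
have fix_g s : 0 < s <= tau -> rhs (S g s) = g s.
  move=> st; apply/eqP; rewrite -subr_eq0 -normr_le0.
  have s0 : 0 < s `^ (1 - nu) by apply: powR_gt0; slra.
  rewrite -(pmulr_rle0 _ s0).
  apply: (@geometric_le _ _ (2 * gamma)) => n; rewrite addr0.
  have [h1 h2] := inv n.
  have a1 := half _ _ _ hg gb h1 h2 (lim n) s st.
  have a2 := lim n.+1 s st.
  have -> : rhs (S g s) - g s = (Phi g s - Phi (g_ n) s) + (-1) *: (g s - g_ n.+1 s).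
    by rewrite /=  /Phi; module_ring R.
  apply: (le_trans (wnorm_lin _ _ _ _ _)); rewrite normrN1 mul1r.
  have p2 : (2 : R) ^+ n != 0 by rewrite expf_neq0.
  have e1 : 2^-1 * (2 * gamma / 2 ^+ n) = gamma / 2 ^+ n by field.
  have e2 : 2 * gamma / 2 ^+ n.+1 = gamma / 2 ^+ n by rewrite exprS; field.
  have -> : 2 * gamma / 2 ^+ n = gamma / 2 ^+ n + gamma / 2 ^+ n by ring.
  by rewrite e1 in a1; rewrite e2 in a2; apply: lerD.
exists (S g); have [h1 h2 h3] := good g hg gb.
split=> //; first by apply: solves_eq h1 => s st; rewrite fix_g.
by move=> s st; rewrite fix_g//; apply: h3.
Qed.

End Existence.

(** A solution starting in the ball cannot leave it before tau: as long as
    it is inside it equals u, which stays in the smaller ball. *)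
Lemma exit_time x u v : cont_interp i nu x -> interp_le i nu (x - x0) delta ->
  trajectory tau (delta / 2) (fun s => rhs (u s)) x u ->
  solves i B nu tau (fun s => rhs (v s)) x v ->
  in_BC nu tau (fun s => rhs (v s) - B (v s)) ->
  forall s : R, 0 < s <= tau -> v s = u s.
Proof.
move=> cx xd hu hv hdv.
pose du s := rhs (u s) - B (u s).
pose dv s := rhs (v s) - B (v s).
have hud : trajectory tau delta (fun s => rhs (u s)) x u by apply: trajectoryW hu; slra.
have xx : interp_le i nu (x - x) 0 by rewrite subrr; exact: interp_le0.
pose S := [set t | 0 < t <= tau /\ (wbound nu t v delta /\ wbound nu t dv delta)].
have eqS t : S t -> forall s : R, 0 < s <= t -> v s = u s.
  move=> [tt [b1 b2]] s st.
  have tt' : t <= tau by slra.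
  have hvt : trajectory t delta (fun s => rhs (v s)) x v.
    by split=> //; exact: solves_sub hv.
  have [_ h _] := stability tt cx cx hvt xd (trajectory_sub tt' hud) xd xx.
  apply/eqP; rewrite -subr_eq0 -normr_le0.
  have s0 : 0 < s `^ (1 - nu) by apply: powR_gt0; slra.
  by rewrite -(pmulr_rle0 _ s0); have := h s st; rewrite mulr0.
have [[vc _ v0] _ _] := hv; have [dvc _ dv0] := hdv.
have [[[uc _ _] _ _] ub ud] := hu.
have [S1 hS1] : exists t, S t.
  have [a a0 ha] := v0 delta d0; have [a' a'0 ha'] := dv0 delta d0.
  exists (Num.min tau (Num.min a a')); split.
    by rewrite !lt_min tau0 a0 a'0 ge_min lexx.
  split=> s; rewrite !le_min => /andP[s0 /and3P[s1 s2 s3]].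
    by apply: ha => //; rewrite s0.
  by apply: ha' => //; rewrite s0.
have supS : has_sup S by split; [exists S1 | exists tau => t [/andP[]]].
set c := sup S.
have c0 : 0 < c.
  have [/andP[S10 _] _] := hS1; apply: lt_le_trans S10 _.
  by apply: ub_le_sup => //; case: supS.
have ct : c <= tau by apply: ge_sup; [exists S1 | move=> t [/andP[]]].
have lt_eq s : 0 < s < c -> v s = u s.
  move=> /andP[s0 sc]; have [t St] := sup_adherent (eps := c - s) ltac:(by rewrite subr_gt0) supS.
  by rewrite -/c => ht; apply: (eqS t St); slra.
have cc : 0 < c <= tau by slra.
have c_eq : v c = u c.
  apply/eqP; rewrite -subr_eq0 -normr_le0; apply: ler_eps_pos => e e0.
  have [a a0 ha] := vc c (e / 2) cc ltac:(slra).
  have [b b0 hb] := uc c (e / 2) cc ltac:(slra).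
  pose q := Num.min (c / 2) (Num.min (a / 2) (b / 2)).
  have q0 : 0 < q by rewrite !lt_min; slra.
  have [q1 [q2 q3]] : q <= c / 2 /\ (q <= a / 2 /\ q <= b / 2).
    by rewrite /q !ge_min !lexx !orbT.
  have dist : `|c - q - c| = q by rewrite addrAC subrr sub0r normrN gtr0_norm.
  have h1 := ha (c - q) ltac:(slra) ltac:(rewrite dist; slra).
  have h2 := hb (c - q) ltac:(slra) ltac:(rewrite dist; slra).
  have vu := lt_eq (c - q) ltac:(slra).
  have -> : v c - u c = (u (c - q) - u c) - (v (c - q) - v c).
    by rewrite vu; module_ring R.
  by apply: (le_trans (ler_normB _ _)); slra.
have le_eq s : 0 < s <= c -> v s = u s.
  move=> /andP[s0]; rewrite le_eqVlt => /orP[/eqP->//|sc].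
  by apply: lt_eq; rewrite s0.
have vb : wbound nu c v (delta / 2).
  by move=> s sc; rewrite le_eq//; apply: ub; slra.
have dvb : wbound nu c dv (delta / 2).
  by move=> s sc; rewrite /dv le_eq//; apply: ud; slra.
have [ctau|] := ltP c tau; last first.
  by move=> tc s st; apply: le_eq; slra.
have nu01 : 0 <= nu <= 1 by slra.
have [a a0 ha] := wbound_extend nu01 cc d0 vc vb.
have [b b0 hb] := wbound_extend nu01 cc d0 dvc dvb.
pose t := Num.min tau (Num.min (c + a) (c + b)).
have ct' : c < t by rewrite !lt_min ctau; slra.
have St : S t.
  have ttau : t <= tau by rewrite ge_min lexx.
  split; first by slra.
  split=> s /andP[s0]; rewrite /t !le_min => /and3P[s1 s2 s3].
    by apply: ha => //; rewrite s0.
  by apply: hb => //; rewrite s0.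
have : t <= c by apply: ub_le_sup => //; case: supS.
by rewrite leNgt ct'.
Qed.

End Contraction.
End Ball.

Ltac slra ::= move: mu0 mubeta betanu nu1; lra.

(** The radius delta is chosen first, to make the quadratic terms small; then
    tau, which makes the remaining terms and the homogeneous trajectory of x0
    small relative to delta; and the initial values may vary by gamma. *)
Lemma local_wellposedness : exists tau eps sigma : R,
  [/\ 0 < tau, 0 < eps, 0 < sigma & exists u : E0 -> R -> E1,
    (forall x, cont_interp i nu x -> interp_le i nu (x - x0) eps ->
      [/\ V x, solves i B nu tau (fun s => rhs (u x s)) x (u x),
          in_BC nu tau (fun s => rhs (u x s)),
          forall s : R, 0 < s <= tau -> V (i (u x s))
        & forall v, solves i B nu tau (fun s => rhs (v s)) x v ->
            in_BC nu tau (fun s => rhs (v s) - B (v s)) ->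
            forall s : R, 0 < s <= tau -> v s = u x s]) /\
    forall x x' m, cont_interp i nu x -> interp_le i nu (x - x0) eps ->
      cont_interp i nu x' -> interp_le i nu (x' - x0) eps ->
      interp_le i nu (x - x') m ->
      wbound nu tau (fun s => u x s - u x' s) (sigma * m) /\
      wbound nu tau (fun s => rhs (u x s) - rhs (u x' s) - B (u x s - u x' s))
        (sigma * m)].
Proof.
have c1 := trace_const_ge1; have c2 := reg_const_ge1.
have c30 : 0 < c3 by slra.
have C'0 : 0 < C' by slra.
have Lc0 : 0 <= L * c3 by rewrite mulr_ge0// ltW.
have CLc0 : 0 <= C' * (L * c3) by rewrite mulr_ge0// ltW.
(* the quadratic terms are small in the ball of radius delta *)
pose delta := Num.min 1 (Num.min (r / c3) (1 / (16 * (C' * (L * c3)) + 1))).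
have d0 : 0 < delta by rewrite !lt_min ltr01 !divr_gt0//; slra.
have d1 : delta <= 1 by rewrite ge_min lexx.
have dr : c3 * delta <= r.
  by rewrite mulrC -ler_pdivlMr// /delta !ge_min lexx !orbT.
have dq : 16 * (C' * (L * c3)) * delta <= 1.
  have : delta <= 1 / (16 * (C' * (L * c3)) + 1) by rewrite /delta !ge_min lexx !orbT.
  by rewrite ler_pdivlMr; slra.
pose gamma := delta / (8 * C').
have g0 : 0 < gamma by rewrite divr_gt0// mulr_gt0.
have K0 := rhs_const_ge0 d0 d1.
set K := rhs_const delta in K0 *.
(* the remaining terms carry the factor tau^(1-nu) *)
pose om := Num.min (1 / (8 * (C' * (L * c3)) + 1)) (gamma / (2 * K + 1)).
have om0 : 0 < om by rewrite lt_min !divr_gt0//; slra.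
have n1 : 0 < 1 - nu by slra.
have [t1 t10 ht1] := powR_small n1 om0.
have zBC : in_BC nu T (fun=> 0 : E0) by exact: in_BC_cst.
have [e0 he0] := solvable (introT andP (conj T0 (lexx T))) zBC hx0.
have [_ _ e0n] := let: And3 a _ _ := he0 in a.
have [_ _ de0n] := solves_derBC hB zBC he0.
have d4 : 0 < delta / 4 by slra.
have [t2 t20 ht2] := e0n _ d4; have [t3 t30 ht3] := de0n _ d4.
pose tau := Num.min 1 (Num.min T (Num.min t1 (Num.min t2 t3))).
have tau0 : 0 < tau by rewrite !lt_min ltr01 T0 t10 t20.
have tau1 : tau <= 1 by rewrite ge_min lexx.
have tauT : tau <= T by rewrite /tau !ge_min lexx !orbT.
have taut1 : tau <= t1 by rewrite /tau !ge_min lexx !orbT.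
have taut2 : tau <= t2 by rewrite /tau !ge_min lexx !orbT.
have taut3 : tau <= t3 by rewrite /tau !ge_min lexx !orbT.
have he : trajectory tau (delta / 4) (fun=> 0) x0 e0.
  split; first exact: solves_sub he0.
    by move=> s st; apply: ht2; slra.
  by move=> s st; apply: ht3; slra.
have tauom : tau `^ (1 - nu) <= om by apply: ht1; slra.
have [om1 om2] : om <= 1 / (8 * (C' * (L * c3)) + 1) /\ om <= gamma / (2 * K + 1).
  by rewrite /om !ge_min !lexx orbT.
have tp := powR_ge0 tau (1 - nu).
have contract : C' * (2 * (L * c3) * (delta + tau `^ (1 - nu))) <= 2^-1.
  have h : (8 * (C' * (L * c3)) + 1) * tau `^ (1 - nu) <= 1.
    rewrite mulrC -ler_pdivlMr; last by slra.
    exact: le_trans tauom om1.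
  set p := tau `^ (1 - nu) in h tp *; set q := C' * (L * c3) in h dq CLc0.
  have -> : C' * (2 * (L * c3) * (delta + p)) = 2 * (q * delta) + 2 * (q * p).
    by rewrite /q; ring.
  have : 0 <= q * p by rewrite mulr_ge0.
  by slra.
have selfmap : L * (c3 * delta) * delta + tau `^ (1 - nu) * K <= gamma.
  have h1 : (2 * K + 1) * tau `^ (1 - nu) <= gamma.
    rewrite mulrC -ler_pdivlMr; last by slra.
    exact: le_trans tauom om2.
  have h2 : L * (c3 * delta) * delta <= gamma / 2.
    rewrite -(ler_pM2l C'0).
    have -> : C' * (gamma / 2) = delta / 16 by rewrite /gamma; field; rewrite gt_eqF.
    have -> : C' * (L * (c3 * delta) * delta) = (16 * (C' * (L * c3)) * delta) * (delta / 16).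
      by field.
    by rewrite ler_piMl//; slra.
  by set p := tau `^ (1 - nu) in h1 tp *; slra.
have base : C' * (gamma + gamma) + delta / 4 <= delta / 2.
  have -> : C' * (gamma + gamma) = delta / 4 by rewrite /gamma; field; rewrite gt_eqF.
  by slra.
have gd : gamma <= delta.
  by rewrite /gamma ler_pdivrMr ?mulr_gt0// ler_peMr ?(ltW d0)//; slra.
have ex x : exists u, cont_interp i nu x -> interp_le i nu (x - x0) gamma ->
    trajectory tau (delta / 2) (fun s => rhs (u s)) x u.
  have [[cx xg]|nx] := pselect (cont_interp i nu x /\ interp_le i nu (x - x0) gamma).
    by have [u hu] := fixed_point d0 d1 dr tau0 tau1 tauT contract g0 gd he base selfmap cx xg;
       exists u.
  by exists (fun=> 0) => h1 h2; case: nx.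
have [u hu] := choice ex.
have hud x : cont_interp i nu x -> interp_le i nu (x - x0) gamma ->
    trajectory tau delta (fun s => rhs (u x s)) x (u x).
  by move=> cx xg; apply: trajectoryW (hu x cx xg); slra.
have close x : interp_le i nu (x - x0) gamma -> interp_le i nu (x - x0) delta.
  exact: interp_leW.
exists tau, gamma, (1 + 2 * C'); split=> //; first by slra.
exists u; split=> [x cx xg|x x' m cx xg cx' xg' xm].
  have [h1 _] := rhs_BC d0 d1 dr tau1 (hud x cx xg) (close x xg).
  split=> //.
  - exact: (start_V d0 d1 dr cx (close x xg)).
  - by case: (hu x cx xg).
  - by move=> s st; apply: (trajectory_V d0 d1 dr tau1 (hud x cx xg) (close x xg) st).
  - move=> v hv hdv s st.
    exact: (exit_time d0 d1 dr tau0 tau1 tauT contract cx (close x xg) (hu x cx xg) hv hdv st).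
have tt : 0 < tau <= tau by slra.
have [_ h1 h2] := stability d0 d1 dr tau0 tau1 tauT contract tt cx cx'
  (hud x cx xg) (close x xg) (hud x' cx' xg') (close x' xg') xm.
by [].
Qed.

End Quasilinear.

Theorem proposition2p5 (R : realType) (E0 E1 : completeNormedModType R)
  (i : {linear E1 -> E0}) (hi : dense_embedding i)
  (mu : R) (hmu : 0 < mu < 1)
  (V : set E0) (hV : open_in_interp i mu V)
  (A : E0 -> {linear E1 -> E0}) (F1 F2 : E0 -> E0)
  (hA : forall x, V x -> max_reg i mu (A x))
  (hAF1 : locally_lipschitz i mu V A F1)
  (beta : R) (hbeta : mu < beta < 1)
  (m : nat) (betaj rho : 'I_m -> R)
  (hbetaj : forall j, mu <= betaj j <= beta)
  (hrho : forall j, 0 <= rho j)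
  (hcrit : forall j,
    (rho j * (beta - mu) + (betaj j - mu)) / (1 - mu) <= 1)
  (hF2 : forall x0 r, V x0 -> 0 < r -> exists2 C : R, 0 < C &
    forall x1 x2,
      (interp_closed_ball i mu x0 r `&` (V `&` cont_interp i beta)) x1 ->
      (interp_closed_ball i mu x0 r `&` (V `&` cont_interp i beta)) x2 ->
      `|F2 x1 - F2 x2| <=
        C * \sum_(j < m)
              (1 + interp_norm i beta x1 `^ rho j
                 + interp_norm i beta x2 `^ rho j)
              * interp_norm i (betaj j) (x1 - x2))
  (mubar : R) (hmubar : beta <= mubar < 1)
  (x0 : E0) (hx0 : (V `&` cont_interp i mubar) x0) :
  exists tau eps sigma : R, [/\ 0 < tau, 0 < eps, 0 < sigma &
    exists u : E0 -> R -> E1,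
      (forall x, interp_closed_ball i mubar x0 eps x ->
         is_solution i V A F1 F2 mubar tau x (u x) /\
         forall v, is_solution i V A F1 F2 mubar tau x v ->
           {in `]0, tau], v =1 u x}) /\
      (forall x1 x2, interp_closed_ball i mubar x0 eps x1 ->
                     interp_closed_ball i mubar x0 eps x2 ->
         (EE1_norm i mubar tau (fun t => u x1 t - u x2 t)%R
            <= (sigma * interp_norm i mubar (x1 - x2))%:E)%E)].
Proof.
have [_ /continuous_linear_bound[ki _ ik] _] := hi.
have [mu0 mu1] : 0 < mu /\ mu < 1 by lra.
have [mubeta betanu nu1] : [/\ mu <= beta, beta <= mubar & mubar < 1] by split; lra.
have mn : mu <= mubar < 1 by lra.
have [Vx0 cx0] := hx0.
have contA x : V x -> continuous (A x) by move=> /hA[].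
have [r r0 hr] := lipschitz_near_exists ik mu0 mubeta hV contA hAF1 hbetaj hrho hF2 Vx0.
have [L L0 lip] := hr (beta_radius i ki beta mubar x0).
have [kB [T [C [hB T0 C0 exist bound]]]] := max_reg_package ik mu0 mn (hA x0 Vx0).
have [tau [eps [sigma [tau0 eps0 sigma0 [u [hu hdiff]]]]]] :=
  local_wellposedness ik mu0 mubeta betanu nu1 cx0 r0 L0 lip hB T0 C0 exist bound.
have ball_in x : interp_closed_ball i mubar x0 eps x ->
    cont_interp i mubar x /\ interp_le i mubar (x - x0) eps.
  move=> [cx]; rewrite /closed_ball_ /= => xe; split=> //.
  have [h _] := cont_interpB cx0 cx.
  by rewrite -opprB; apply: interp_leN; apply: interp_leW xe (interp_le_norm h).
exists tau, eps, (2 * sigma); split=> //; first by rewrite mulr_gt0.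
have dU x : interp_closed_ball i mubar x0 eps x ->
    der_on tau (fun t => i (u x t)) (fun t => rhs i A F1 F2 x0 (u x t) - A x0 (u x t)).
  by move=> /ball_in[cx xe]; have [_ [_ du _] _ _ _] := hu x cx xe.
exists u; split=> [x hx|x1 x2 hx1 hx2].
  have [cx xe] := ball_in x hx; have [Vx hs hb hVu huniq] := hu x cx xe.
  have [he heq hini] := (solvesP ik _ _ hB tau0 hb).1 hs.
  split.
    split=> //.
    move=> t tt; have := heq t tt; rewrite /rhs => h.
    have -> : derive_on tau (i \o u x) t =
      (derive_on tau (i \o u x) t + A x0 (u x t)) - A x0 (u x t) by rewrite addrK.
    by rewrite h; module_ring R.
  move=> v [hve [_ hVv] hveq hvini] t; rewrite in_itv/= => tt.
  have dv := EE1_der hve.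
  have [hvb hdv] := (EE1P ik mubar tau0 dv).1 hve.
  have eqd s : 0 < s <= tau -> derive_on tau (i \o v) s =
      rhs i A F1 F2 x0 (v s) - A x0 (v s).
    move=> st; have := hveq s ltac:(by rewrite in_itv).
    move/(congr1 (fun z => z - A (i (v s)) (v s))); rewrite addrK => ->.
    by rewrite /rhs; module_ring R.
  apply: huniq tt; last by apply: in_BC_eq hdv => s st; rewrite eqd.
  split=> //; first by apply: der_on_eq dv => // s st; rewrite eqd.
  exact/(starts_atP _ _ tau0).
have [cx1 xe1] := ball_in x1 hx1; have [cx2 xe2] := ball_in x2 hx2.
have [h12 _] := cont_interpB cx1 cx2.
have [b1 b2] := hdiff x1 x2 _ cx1 xe1 cx2 xe2 (interp_le_norm h12).
have d12 : der_on tau (fun t => i (u x1 t - u x2 t)) (fun t =>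
    rhs i A F1 F2 x0 (u x1 t) - rhs i A F1 F2 x0 (u x2 t) - A x0 (u x1 t - u x2 t)).
  apply: der_on_eq (der_on_lin (-1) (dU x1 hx1) (dU x2 hx2)) => t _.
    have -> : i (u x1 t - u x2 t) = i (u x1 t) - i (u x2 t) by rewrite linearB.
    by module_ring R.
  have -> : A x0 (u x1 t - u x2 t) = A x0 (u x1 t) - A x0 (u x2 t) by rewrite linearB.
  by module_ring R.
have [_ e12] := der_on_derive d12.
apply: ge_ereal_sup => _ [t tt <-].
have {}tt : 0 < t <= tau by move: tt; rewrite /= in_itv.
rewrite lee_fin e12// mulrDr -mulrA mulr2n mulrDl !mul1r.
by apply: lerD; [exact: b2 | exact: b1].
Qed.
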